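(* Let $A$, $C$, $c$, $\beta$, $Q$, $f_Q$, $H$ and $X$ be as described in the context, and let $\mathfrak{D}=\{D\leq G\mid D \text{ is a } p\text{-subgroup with } D\cap N=Q \}$. Then there is a bijective correspondence, preserving the defect groups in $\mathfrak{D}$ (that is, corresponding points have a common defect group belonging to $\mathfrak{D}$), between the points of $A^G$ that strongly cover $\beta$ and the points of $X^H$ that strongly cover $\{f_Q\}$.
   Context: Conventions. $k$ is a field of prime characteristic $p$ (not necessarily algebraically closed), algebras are finite dimensional over $k$, $G$ is a finite group and $N\trianglelefteq G$ with $p$ dividing $|N|$. For a unit or group element $a$, ${}^af=afa^{-1}$ (or the action of $a$ on $f$). A $G$-algebra is a $k$-algebra with $G$ acting by algebra automorphisms; it is $p$-permutation if for every $p$-subgroup $P$ of $G$ it has a $P$-stable $k$-basis. For a $G$-algebra $A$ and $K\le L\le G$: $A^L$ is the subalgebra of $L$-fixed elements, $\mathrm{Tr}_K^L(a)=\sum_{x\in[L/K]}{}^xa$ for $a\in A^K$, $A_K^L=\mathrm{Tr}_K^L(A^K)$. For a $p$-subgroup $Q$, $A(Q)=A^Q/\sum_{R<Q}A_R^Q$, with quotient map $\mathrm{Br}_Q^A:A^Q\to A(Q)$; it is an $N_G(Q)$-algebra. A block of an algebra is a primitive idempotent of its centre. $N_G(Q,f)$ is the stabilizer in $N_G(Q)$ of $f\in A(Q)$. A point of $A^L$ is the $(A^L)^*$-conjugacy class of a primitive idempotent of $A^L$. A $p$-subgroup $D$ of $L$ is a defect group of a point $\alpha$ of $A^L$ if $\alpha\subseteq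 A_D^L$ and $\mathrm{Br}_D^A(\alpha)\neq0$. Brauer pairs: for a $p$-permutation $L$-algebra $B$ and a primitive idempotent $b$ of $B^L$, a $(B,b,L)$-Brauer pair is $(R,e)$ with $R$ a $p$-subgroup of $L$ and $e$ a block of $B(R)$ with $\mathrm{Br}_R^B(b)e\ne0$; $(R,e)\le(S,f)$ if $R\le S$ and for every primitive idempotent $i$ of $B^S$ with $\mathrm{Br}_S^B(i)f\ne0$ one has $\mathrm{Br}_R^B(i)e\ne0$. Strong covering: let $M\trianglelefteq L$ be finite groups, $B$ an $L$-algebra, $B'$ an $L$-invariant subalgebra with $1_B\in B'$, $\beta'\subseteq B'^M$ a point with defect group $Q$ such that $\beta'\cap B'^L\neq\emptyset$. A point $\alpha'$ of $B^L$ strongly covers $\beta'$ if for any $j\in\beta'\cap B'^L$ there are $i\in\alpha'$ and a point $\epsilon\subseteq B^M$ with defect group $Q$ such that $ji=ij=i$, and $if=fi=f$, $jf_1=f_1j=f_1$ for some $f,f_1\in\epsilon$. For points of $A^G$ strongly covering $\beta$ this is used with $L=G$, $M=N$, $B=A$, $B'=C$; for points of $X^H$ strongly covering $\{f_Q\}$ it is used with $L=H$, $M=QC_N(Q)$, $B=X$, $B'=C(Q)$. Setting. $A$ is a $G$-interior $k$-algebra, i.e. there is a group homomorphism $G\to A^*$, $u\mapsto u\cdot 1_A=1_A\cdot u$; $G$ acts on $A$ by conjugation, and $A$ is a $k[G\times G]$-module by $(u,v)\cdot a=u\cdot a\cdot v^{-1}$. It is assumed that this $G\times G$-action stabilizes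 a $k$-basis of $A$ (so $A$ is a $p$-permutation $G$-algebra) and that $A$ is projective as a $k[G\times 1]$-module and as a $k[1\times G]$-module. $C$ is an $N$-interior $G$-subalgebra of $A$ containing $1_A$ (a $G$-stable subalgebra containing $u\cdot 1_A$ for all $u\in N$), and $C$ is a $p$-permutation $G$-algebra. $c$ is a primitive idempotent of $C^N$ with $c\in C^G$, $\beta\subseteq C^N$ is the point containing $c$, and $Q$ is a defect group of $\beta$. $(Q,f_Q)$ is a maximal $(C,c,N)$-Brauer pair such that $f_Q$ is primitive in $C(Q)^{C_N(Q)}$, and $H=N_G(Q,f_Q)$. Since $f_Q$ is central in $C(Q)$, its point in $C(Q)^{C_N(Q)}=C(Q)^{QC_N(Q)}$ is $\{f_Q\}$; it has defect group $Q$ with respect to $QC_N(Q)$. $X=\overline{N}_A^{\mathrm{Aut}(Q)}(Q)$ is the extended Brauer quotient: $X=\bigoplus_{\varphi\in\mathrm{Aut}(Q)}A(\Delta_\varphi(Q))$, where for $R\le Q$, $\Delta_\varphi(R)=\{(\varphi(u),u)\mid u\in R\}\le G\times G$ and $A(\Delta_\varphi(Q))=A^{\Delta_\varphi(Q)}/\sum_{R<Q}\mathrm{Tr}_{\Delta_\varphi(R)}^{\Delta_\varphi(Q)}(A^{\Delta_\varphi(R)})$; multiplication is induced by that of $A$, taking the components of $\varphi$ and $\psi$ to that of $\varphi\psi$; $X$ is an $N_G(Q)$-interior algebra via $x\mapsto$ the class of $x\cdot 1_A$ in the component of $\varphi=(u\mapsto xux^{-1})$. The component of $\varphi=\mathrm{id}$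 is $A(Q)$, and $C(Q)$ is regarded as an $N_G(Q)$-subalgebra of $X$ via $C(Q)\to A(Q)\subseteq X$. Finally it is assumed that $f_Q$ normalizes a $k$-basis $\mathcal{B}$ of $X^{N_G(Q)}$: for any $s\in\mathcal{B}$ there is $s'\in\mathcal{B}$ with $f_Q\cdot s=s'\cdot f_Q$. *)

(* Defs.v *)
From HB Require Import structures.
From mathcomp Require Import boolp classical_sets functions.
From mathcomp Require Import all_boot all_order all_algebra all_fingroup.
From mathcomp Require Import pgroup.

Set Implicit Arguments.
Unset Strict Implicit.
Unset Printing Implicit Defensive.

Import GRing.Theory VectorInternalTheory.
Local Open Scope ring_scope.

(* Finite dimensional algebras.  In contrast with falgType, the zero algebra  *)
(* is allowed, since Brauer quotients may vanish.  The ring structure is      *)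
(* derived below rather than inherited, because the algebra structures of     *)
(* ssralg require 1 != 0.                                                     *)

HB.mixin Record Vector_isFinDimAlgebra (k : fieldType) A of Vector k A := {
  fdone : A;
  fdmul : A -> A -> A;
  fdmulA : associative fdmul;
  fdmul1 : left_id fdone fdmul;
  fdmulr1 : right_id fdone fdmul;
  fdmulDl : left_distributive fdmul +%R;
  fdmulDr : right_distributive fdmul +%R;
  fdscaleAl : forall (a : k) (u v : A), a *: fdmul u v = fdmul (a *: u) v;
  fdscaleAr : forall (a : k) (u v : A), a *: fdmul u v = fdmul u (a *: v)
}.

#[short(type="fdalgType")]
HB.structure Definition FinDimAlgebra (k : fieldType) :=
  {A of Vector_isFinDimAlgebra k A & Vector k A}.

HB.instance Definition _ (k : fieldType) (A : fdalgType k) :=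
  GRing.Zmodule_isPzRing.Build (FinDimAlgebra.sort A)
    (@fdmulA k A) (@fdmul1 k A) (@fdmulr1 k A) (@fdmulDl k A) (@fdmulDr k A).

Lemma fdalg_scaleAl (k : fieldType) (A : fdalgType k) (a : k) (u v : A) :
  a *: (u * v) = (a *: u) * v.
Proof. exact: fdscaleAl. Qed.
Lemma fdalg_scaleAr (k : fieldType) (A : fdalgType k) (a : k) (u v : A) :
  a *: (u * v) = u * (a *: v).
Proof. exact: fdscaleAr. Qed.

(* A space with an action of a subgroup L of gT is given by a function        *)
(* act : gT -> 'End(V), of which only the values on L matter.  fixed act L is *)
(* V^L, rtrace act K L is Tr_K^L, traces act K L is V_K^L and brauer_ker act  *)
(* Q is the sum of the V_R^Q for R < Q.                                       *)

Section Traces.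

Variables (k : fieldType) (gT : finGroupType) (V : vectType k).
Implicit Types (act : gT -> 'End(V)) (K L : {set gT}) (Q : {group gT}).

Definition fixed act L : {vspace V} :=
  (\bigcap_(x in L) fixedSpace (act x))%VS.

Definition rtrace act K L : 'End(V) :=
  \sum_(xK in lcosets K L) act (repr xK).

Definition traces act K L : {vspace V} := (rtrace act K L @: fixed act K)%VS.

Definition brauer_ker act Q : {vspace V} :=
  (\sum_(R : {group gT} | R \proper Q) traces act R Q)%VS.

Lemma fixedP act L v :
  reflect (forall x, x \in L -> act x v = v) (v \in fixed act L).
Proof.
rewrite memvE; apply: (iffP subv_bigcapP) => fix_v x Lx.
  by apply/fixedSpaceP; rewrite memvE fix_v.
by rewrite -memvE; apply/fixedSpaceP/fix_v.
Qed.

Lemma rtraceE act K L v :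
  rtrace act K L v = \sum_(xK in lcosets K L) act (repr xK) v.
Proof. by rewrite sum_lfunE. Qed.

Lemma repr_lcosets (K L : {group gT}) xK :
  K \subset L -> xK \in lcosets K L -> repr xK \in L.
Proof.
move=> sKL /lcosetsP[x Lx ->].
have /lcosetP[y Ky ->]: repr (x *: K)%g \in (x *: K)%g.
  by apply: mem_repr (lcoset_refl K x).
by rewrite groupM // (subsetP sKL).
Qed.

End Traces.

(* U / W, realised on a complement of (U :&: W) in U; qclass is the           *)
(* projection and vsval a linear section of it.                               *)

Section Quotient.

Variables (k : fieldType) (V : vectType k) (U W : {vspace V}).

Definition vquot : Type := subvs_of (U :\: W)%VS.
HB.instance Definition _ := Vector.on vquot.

Definition qrepr (x : vquot) : V := vsval (x : subvs_of (U :\: W)%VS).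
HB.instance Definition _ := GRing.Linear.copy qrepr (@vsval k V (U :\: W)%VS).

Definition qclass (v : V) : vquot := vsproj (U :\: W)%VS (addv_pi1 U W v).
Fact qclass_is_linear : linear qclass.
Proof. by move=> a u v; rewrite /qclass !linearP. Qed.
HB.instance Definition _ :=
  GRing.isLinear.Build k V vquot _ qclass qclass_is_linear.

Lemma qrepr_mem x : qrepr x \in U.
Proof. by apply: (subvP (diffvSl U W)); apply: subvsP. Qed.

Lemma qclassK v : v \in U -> qrepr (qclass v) - v \in W.
Proof.
move=> Uv; have Uv' : v \in (U + W)%VS by apply: subvP (addvSl U W) _ Uv.
rewrite /qrepr /qclass vsprojK; last first.
  exact: memv_pi.
by rewrite -{2}(addv_pi1_pi2 Uv') opprD addrA subrr sub0r rpredN memv_pi2.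
Qed.

Lemma qreprK x : qclass (qrepr x) = x.
Proof.
rewrite /qclass /qrepr /addv_pi1 daddv_pi_id ?vsvalK ?subvsP //.
exact: capv_diff.
Qed.

Lemma qclass_eq0 v : v \in U -> (qclass v == 0) = (v \in W).
Proof.
move=> Uv; apply/eqP/idP => [v0 | Wv].
  by have := qclassK Uv; rewrite v0 linear0 sub0r rpredN.
have Wq : qrepr (qclass v) \in W.
  by rewrite -(subrK v (qrepr _)) rpredD ?qclassK.
rewrite -[LHS]qreprK; suff -> : qrepr (qclass v) = 0 by rewrite linear0.
apply/eqP; rewrite -memv0 -(capv_diff U W) memv_cap Wq andbT.
exact: subvsP.
Qed.

Lemma qclass_eq u v : u \in U -> v \in U -> u - v \in W -> qclass u = qclass v.
Proof.
move=> Uu Uv Wuv; apply/eqP; rewrite -subr_eq0 -linearB /=.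
by rewrite qclass_eq0 // rpredB.
Qed.

End Quotient.

Section DirectSum.

Variables (k : fieldType) (I : finType) (V : I -> vectType k).

Definition dsum : Type := {dffun forall i, V i}.
HB.instance Definition _ := Choice.on dsum.

Implicit Types f g : dsum.
Definition mkdsum (F : forall i, V i) : dsum := [ffun i => F i].
Definition dcoord f i : V i := (f : {dffun forall i, V i}) i.

Lemma dsumE F i : dcoord (mkdsum F) i = F i.
Proof. exact: ffunE. Qed.
Lemma dsumP f g : (forall i, dcoord f i = dcoord g i) -> f = g.
Proof. by move=> fg; apply/ffunP. Qed.

Definition dsum_add f g := mkdsum (fun i => dcoord f i + dcoord g i).
Definition dsum_opp f := mkdsum (fun i => - dcoord f i).
Fact dsum_addA : associative dsum_add.
Proof. by move=> f g h; apply: dsumP => i; rewrite !dsumE addrA. Qed.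
Fact dsum_addC : commutative dsum_add.
Proof. by move=> f g; apply: dsumP => i; rewrite !dsumE addrC. Qed.
Fact dsum_add0 : left_id (mkdsum (fun=> 0)) dsum_add.
Proof. by move=> f; apply: dsumP => i; rewrite !dsumE add0r. Qed.
Fact dsum_addN : left_inverse (mkdsum (fun=> 0)) dsum_opp dsum_add.
Proof. by move=> f; apply: dsumP => i; rewrite !dsumE addNr. Qed.
HB.instance Definition _ :=
  GRing.isZmodule.Build dsum dsum_addA dsum_addC dsum_add0 dsum_addN.

Definition dsum_scale (a : k) f := mkdsum (fun i => a *: dcoord f i).
Fact dsum_scaleA a b f : dsum_scale a (dsum_scale b f) = dsum_scale (a * b) f.
Proof. by apply: dsumP => i; rewrite !dsumE scalerA. Qed.
Fact dsum_scale1 : left_id 1 dsum_scale.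
Proof. by move=> f; apply: dsumP => i; rewrite !dsumE scale1r. Qed.
Fact dsum_scaleDr : right_distributive dsum_scale +%R.
Proof. by move=> a f g; apply: dsumP => i; rewrite !dsumE scalerDr. Qed.
Fact dsum_scaleDl f : {morph dsum_scale^~ f : a b / a + b}.
Proof. by move=> a b; apply: dsumP => i; rewrite !dsumE scalerDl. Qed.
HB.instance Definition _ := GRing.Zmodule_isLmodule.Build k dsum
  dsum_scaleA dsum_scale1 dsum_scaleDr dsum_scaleDl.

Lemma dcoordD f g i : dcoord (f + g) i = dcoord f i + dcoord g i.
Proof. exact: dsumE. Qed.
Lemma dcoordZ a f i : dcoord (a *: f) i = a *: dcoord f i.
Proof. exact: dsumE. Qed.

Fact dsum_vect_axiom :
  Vector.axiom (\sum_(j < #|I|) dim (V (enum_val j))) dsum.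
Proof.
pose fr f := \mxrow_(j < #|I|) v2r (dcoord f (enum_val j)).
exists fr => [a f g|].
  apply/mxrowP => j; rewrite mxrowK dcoordD dcoordZ linearD linearZ.
  have sub_lin (r s : 'rV_(\sum_(j < #|I|) dim (V (enum_val j)))) :
      submxrow (a *: r + s) j = a *: submxrow r j + submxrow s j.
    by apply/rowP => i; rewrite !mxE.
  by rewrite sub_lin !mxrowK.
pose rf (r : 'rV_(\sum_(j < #|I|) dim (V (enum_val j)))) := mkdsum (fun i =>
  eq_rect _ (fun i => V i) (r2v (submxrow r (enum_rank i))) _ (enum_rankK i)).
exists rf => [f|r].
  apply: dsumP => i; rewrite dsumE mxrowK v2rK.
  have eq_f j (e : j = i) : eq_rect j V (dcoord f j) i e = dcoord f i.
    by case: _ / e.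
  exact: eq_f.
apply/mxrowP => j; rewrite mxrowK dsumE; apply: (canLR r2vK).
have eq_r j' (ej : j' = j) (e : enum_val j' = enum_val j) :
    eq_rect _ (fun i => V i) (r2v (submxrow r j')) _ e = r2v (submxrow r j).
  by case: _ / (esym ej) e => e; rewrite (eq_irrelevance e erefl).
by apply: eq_r; apply: enum_valK.
Qed.
HB.instance Definition _ := Lmodule_hasFinDim.Build k dsum dsum_vect_axiom.

End DirectSum.

Record subalgebra (k : fieldType) (A : fdalgType k) := Subalgebra {
  subalg_space :> {vspace A};
  subalg1 : 1 \in subalg_space;
  subalgM : {in subalg_space &, forall a b, a * b \in subalg_space}
}.

Section SubalgebraType.

Variables (k : fieldType) (A : fdalgType k) (C : subalgebra A).

Definition subalg_of : Type := subvs_of C.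
HB.instance Definition _ := Vector.on subalg_of.

Definition sval_of (x : subalg_of) : A := vsval (x : subvs_of C).
HB.instance Definition _ := GRing.Linear.copy sval_of (@vsval k A C).
Definition sproj (a : A) : subalg_of := vsproj C a.
HB.instance Definition _ := GRing.Linear.copy sproj (@vsproj k A C).

Lemma svalP x : sval_of x \in C.
Proof. exact: subvsP. Qed.
Lemma svalK x : sproj (sval_of x) = x.
Proof. exact: vsvalK. Qed.
Lemma sprojK a : a \in C -> sval_of (sproj a) = a.
Proof. exact: vsprojK. Qed.
Lemma sval_inj : injective sval_of.
Proof. exact: can_inj svalK. Qed.

Let smul x y := sproj (sval_of x * sval_of y).
Let smulE x y : sval_of (smul x y) = sval_of x * sval_of y.
Proof. by rewrite sprojK // subalgM ?svalP. Qed.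
Let soneE : sval_of (sproj 1) = 1.
Proof. by rewrite sprojK // subalg1. Qed.

Fact smulA : associative smul.
Proof. by move=> x y z; apply: sval_inj; rewrite !smulE mulrA. Qed.
Fact smul1 : left_id (sproj 1) smul.
Proof. by move=> x; apply: sval_inj; rewrite smulE soneE mul1r. Qed.
Fact smulr1 : right_id (sproj 1) smul.
Proof. by move=> x; apply: sval_inj; rewrite smulE soneE mulr1. Qed.
Fact smulDl : left_distributive smul +%R.
Proof.
move=> x y z; apply: sval_inj.
by rewrite [RHS]raddfD /= !smulE -mulrDl -raddfD.
Qed.
Fact smulDr : right_distributive smul +%R.
Proof.
move=> x y z; apply: sval_inj.
by rewrite [RHS]raddfD /= !smulE -mulrDr -raddfD.
Qed.
Fact sscaleAl (a : k) x y : a *: smul x y = smul (a *: x) y.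
Proof.
by apply: sval_inj; rewrite [LHS]linearZ /= !smulE linearZ /= fdalg_scaleAl.
Qed.
Fact sscaleAr (a : k) x y : a *: smul x y = smul x (a *: y).
Proof.
by apply: sval_inj; rewrite [LHS]linearZ /= !smulE linearZ /= fdalg_scaleAr.
Qed.
HB.instance Definition _ := Vector_isFinDimAlgebra.Build k subalg_of
  smulA smul1 smulr1 smulDl smulDr sscaleAl sscaleAr.
HB.instance Definition _ := GRing.PzRing.copy subalg_of
  (FinDimAlgebra.sort (subalg_of : fdalgType k)).

Lemma svalM x y : sval_of (x * y) = sval_of x * sval_of y.
Proof. exact: smulE. Qed.
Lemma sval1 : sval_of 1 = 1.
Proof. exact: soneE. Qed.

End SubalgebraType.

(* G-algebras, with G the whole group gT, and their Brauer quotients.         *)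

Record galgebra (k : fieldType) (gT : finGroupType) (B : fdalgType k) :=
  GAlgebra {
  gact :> gT -> 'End(B);
  gact_id : forall b, gact 1%g b = b;
  gact_mulg : forall x y b, gact (x * y)%g b = gact x (gact y b);
  gactM : forall x a b, gact x (a * b) = gact x a * gact x b;
  gact1 : forall x, gact x 1 = 1
}.

Section BrauerQuotient.

Variables (k : fieldType) (gT : finGroupType) (B : fdalgType k).
Variables (act : galgebra gT B) (Q : {group gT}).

Local Notation U := (fixed act Q).
Local Notation W := (brauer_ker act Q).

Let UM a b : a \in U -> b \in U -> a * b \in U.
Proof.
move=> /fixedP Ua /fixedP Ub; apply/fixedP => x Qx.
by rewrite gactM Ua ?Ub.
Qed.

Let U1 : 1 \in U.
Proof. by apply/fixedP => x _; rewrite gact1. Qed.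

Let W_ind (P : B -> Prop) :
    P 0 -> (forall a b, P a -> P b -> P (a + b)) ->
    (forall (R : {group gT}) a, R \proper Q -> a \in fixed act R ->
       P (rtrace act R Q a)) ->
  forall a, a \in W -> P a.
Proof.
move=> P0 PD PT _ /memv_sumP[f fW ->]; apply: big_ind => // R prRQ.
by have /memv_imgP[a Ua ->] := fW R prRQ; apply: PT.
Qed.

Let trW (R : {group gT}) a :
  R \proper Q -> a \in fixed act R -> rtrace act R Q a \in W.
Proof.
move=> prRQ Ra; rewrite memvE; apply: subv_trans (sumv_sup R prRQ (subvv _)).
by rewrite -memvE memv_img.
Qed.

Let WUr a b : a \in W -> b \in U -> a * b \in W.
Proof.
move=> Wa Ub; move: a Wa; apply: W_ind => [||R a prRQ /fixedP Ra].
- by rewrite mul0r mem0v.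
- by move=> a1 a2; rewrite mulrDl; apply: rpredD.
have sRQ := proper_sub prRQ; move/fixedP: Ub => Ub.
suff -> : rtrace act R Q a * b = rtrace act R Q (a * b).
  apply: trW => //; apply/fixedP => x Rx.
  by rewrite gactM Ra ?Ub ?(subsetP sRQ).
rewrite !rtraceE mulr_suml; apply: eq_bigr => xR /(repr_lcosets sRQ) Qx.
by rewrite gactM (Ub _ Qx).
Qed.

Let WUl a b : a \in U -> b \in W -> a * b \in W.
Proof.
move=> Ua Wb; move: b Wb; apply: W_ind => [||R b prRQ /fixedP Rb].
- by rewrite mulr0 mem0v.
- by move=> b1 b2; rewrite mulrDr; apply: rpredD.
have sRQ := proper_sub prRQ; move/fixedP: Ua => Ua.
suff -> : a * rtrace act R Q b = rtrace act R Q (a * b).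
  apply: trW => //; apply/fixedP => x Rx.
  by rewrite gactM Rb ?Ua ?(subsetP sRQ).
rewrite !rtraceE mulr_sumr; apply: eq_bigr => xR /(repr_lcosets sRQ) Qx.
by rewrite gactM (Ua _ Qx).
Qed.

Definition brauerQuotient : Type := vquot U W.
HB.instance Definition _ := Vector.on brauerQuotient.

Definition Br (b : B) : brauerQuotient := qclass U W b.
HB.instance Definition _ := GRing.Linear.copy Br (qclass U W).
Definition Brrepr (x : brauerQuotient) : B := @qrepr _ _ U W x.
HB.instance Definition _ := GRing.Linear.copy Brrepr (@qrepr _ _ U W).

Let mul (x y : brauerQuotient) := Br (Brrepr x * Brrepr y).

Let mulE a b : a \in U -> b \in U -> mul (Br a) (Br b) = Br (a * b).
Proof.
move=> Ua Ub; apply: qclass_eq; rewrite ?UM ?qrepr_mem //.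
rewrite -[X in X - _](subrK (a * Brrepr (Br b))) -mulrBl -addrA -mulrBr.
apply: rpredD; first by apply: WUr; [exact: qclassK | exact: qrepr_mem].
by apply: WUl => //; exact: qclassK.
Qed.

Let BrP (x : brauerQuotient) : exists2 a, a \in U & x = Br a.
Proof. by exists (Brrepr x); rewrite ?qrepr_mem // [RHS]qreprK. Qed.

Fact brauer_mulA : associative mul.
Proof.
move=> x y z; have [a Ua ->] := BrP x; have [b Ub ->] := BrP y.
have [c Uc ->] := BrP z.
by rewrite !mulE ?UM ?mulrA.
Qed.
Fact brauer_mul1 : left_id (Br 1) mul.
Proof. by move=> x; have [a Ua ->] := BrP x; rewrite mulE ?mul1r. Qed.
Fact brauer_mulr1 : right_id (Br 1) mul.
Proof. by move=> x; have [a Ua ->] := BrP x; rewrite mulE ?mulr1. Qed.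
Fact brauer_mulDl : left_distributive mul +%R.
Proof. by move=> x y z; rewrite /mul linearD mulrDl linearD. Qed.
Fact brauer_mulDr : right_distributive mul +%R.
Proof. by move=> x y z; rewrite /mul linearD mulrDr linearD. Qed.
Fact brauer_scaleAl (t : k) x y : t *: mul x y = mul (t *: x) y.
Proof. by rewrite /mul linearZ /= -fdalg_scaleAl linearZ. Qed.
Fact brauer_scaleAr (t : k) x y : t *: mul x y = mul x (t *: y).
Proof. by rewrite /mul linearZ /= -fdalg_scaleAr linearZ. Qed.
HB.instance Definition _ := Vector_isFinDimAlgebra.Build k brauerQuotient
  brauer_mulA brauer_mul1 brauer_mulr1 brauer_mulDl brauer_mulDr
  brauer_scaleAl brauer_scaleAr.
HB.instance Definition _ := GRing.PzRing.copy brauerQuotient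
  (FinDimAlgebra.sort (brauerQuotient : fdalgType k)).

Lemma BrM a b : a \in U -> b \in U -> Br (a * b) = Br a * Br b.
Proof. by move=> Ua Ub; rewrite -mulE. Qed.
Lemma Br1 : Br 1 = 1.
Proof. by []. Qed.
Lemma Br_eq0 a : a \in U -> (Br a == 0) = (a \in W).
Proof. exact: qclass_eq0. Qed.
Lemma Br_surj x : exists2 a, a \in U & x = Br a.
Proof. exact: BrP. Qed.

Definition brauer_act (x : gT) : 'End(brauerQuotient) :=
  linfun (fun b => Br (act x (Brrepr b))).

Lemma brauer_actE x b : brauer_act x b = Br (act x (Brrepr b)).
Proof.
pose f b := Br (act x (Brrepr b)).
have f_lin : linear f by move=> a u v; rewrite /f !linearP.
pose fM := GRing.isLinear.Build k _ _ _ f f_lin.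
pose fL : {linear brauerQuotient -> brauerQuotient} := HB.pack f fM.
exact: (lfunE fL).
Qed.

End BrauerQuotient.

(* Interior algebras.  biact is the action of G x G on B, which is            *)
(* (u, v) . b = u b v^-1, and conj_act is conjugation.                        *)

Record interior (k : fieldType) (gT : finGroupType) (B : fdalgType k) :=
  Interior {
  imap :> gT -> B;
  imap1 : imap 1%g = 1;
  imapM : forall x y, imap (x * y)%g = imap x * imap y
}.

Section Biaction.

Variables (k : fieldType) (gT : finGroupType) (B : fdalgType k).

Definition biact (rho : gT -> B) (w : gT * gT) : 'End(B) :=
  linfun (fun b => rho w.1 * b * rho w.2^-1%g).

Definition conj_act (rho : gT -> B) (x : gT) : 'End(B) := biact rho (x, x).

Lemma biactE rho w b : biact rho w b = rho w.1 * b * rho w.2^-1%g.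
Proof.
pose f (b : B) := rho w.1 * b * rho w.2^-1%g.
have f_lin : linear f.
  move=> a u v; rewrite /f mulrDr mulrDl.
  by rewrite -fdalg_scaleAr -fdalg_scaleAl.
pose fM := GRing.isLinear.Build k B B _ f f_lin.
pose fL : {linear B -> B} := HB.pack f fM.
exact: (lfunE fL).
Qed.

Lemma conj_actE rho x b : conj_act rho x b = rho x * b * rho x^-1%g.
Proof. exact: biactE. Qed.

Variable rho : interior gT B.

Lemma imapVK x : rho x^-1%g * rho x = 1.
Proof. by rewrite -imapM mulVg imap1. Qed.
Lemma imapKV x : rho x * rho x^-1%g = 1.
Proof. by rewrite -imapM mulgV imap1. Qed.

Fact conj_act_id b : conj_act rho 1%g b = b.
Proof. by rewrite conj_actE invg1 imap1 mul1r mulr1. Qed.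
Fact conj_act_mulg x y b :
  conj_act rho (x * y)%g b = conj_act rho x (conj_act rho y b).
Proof. by rewrite !conj_actE invMg !imapM !mulrA. Qed.
Fact conj_actM x a b :
  conj_act rho x (a * b) = conj_act rho x a * conj_act rho x b.
Proof.
by rewrite !conj_actE !mulrA -[_ * rho _ * rho x]mulrA imapVK mulr1.
Qed.
Fact conj_act1 x : conj_act rho x 1 = 1.
Proof. by rewrite conj_actE mulr1 imapKV. Qed.

Definition conj_galgebra : galgebra gT B :=
  GAlgebra conj_act_id conj_act_mulg conj_actM conj_act1.

End Biaction.

Record interior_subalgebra (k : fieldType) (gT : finGroupType)
    (A : fdalgType k) (rho : interior gT A) (N : {set gT}) :=
  InteriorSubalgebra {
  isubalg :> subalgebra A;
  isubalg_stable : forall x a, a \in isubalg -> conj_act rho x a \in isubalg;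
  isubalg_interior : forall u, u \in N -> rho u \in isubalg
}.

Section SubAction.

Variables (k : fieldType) (gT : finGroupType) (A : fdalgType k).
Variables (rho : interior gT A) (N : {set gT}).
Variable C : interior_subalgebra rho N.

Definition sub_act (x : gT) : 'End(subalg_of C) :=
  linfun (fun c : subalg_of C => sproj C (conj_act rho x (sval_of c))).

Lemma sub_actE x c : sval_of (sub_act x c) = conj_act rho x (sval_of c).
Proof.
pose f (c : subalg_of C) := sproj C (conj_act rho x (sval_of c)).
have f_lin : linear f by move=> a u v; rewrite /f !linearP.
pose fM := GRing.isLinear.Build k _ _ _ f f_lin.
pose fL : {linear subalg_of C -> subalg_of C} := HB.pack f fM.
rewrite /sub_act (lfunE fL) /= sprojK //; apply: isubalg_stable.
exact: svalP.
Qed.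

Fact sub_act_id c : sub_act 1%g c = c.
Proof. by apply: sval_inj; rewrite sub_actE (gact_id (conj_galgebra rho)). Qed.
Fact sub_act_mulg x y c : sub_act (x * y)%g c = sub_act x (sub_act y c).
Proof.
by apply: sval_inj; rewrite !sub_actE (gact_mulg (conj_galgebra rho)).
Qed.
Fact sub_actM x a b : sub_act x (a * b) = sub_act x a * sub_act x b.
Proof.
apply: sval_inj.
by rewrite sub_actE !svalM !sub_actE (gactM (conj_galgebra rho)).
Qed.
Fact sub_act1 x : sub_act x 1 = 1.
Proof.
by apply: sval_inj; rewrite sub_actE sval1 (gact1 (conj_galgebra rho)).
Qed.

Definition sub_galgebra : galgebra gT (subalg_of C) :=
  GAlgebra sub_act_id sub_act_mulg sub_actM sub_act1.

End SubAction.

(* The extended Brauer quotient of B at Q.  Its index set is Aut(Q), as the   *)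
(* finite group [subg Aut Q]; beware that for permutations phi * psi is       *)
(* psi o phi, so that the composition phi o psi below reads psi * phi.        *)

Definition Delta (gT : finGroupType) (phi : gT -> gT) (R : {set gT}) :
    {set gT * gT} :=
  [set (phi u, u) | u in R].

Section CosetReindex.

Variables (aT bT : finGroupType) (V : nmodType) (K L : {group aT}).
Variables (e : aT -> bT) (F : bT -> V).
Hypotheses (sKL : K \subset L) (e_inj : injective e).
Hypothesis eM : {in L &, {morph e : x y / (x * y)%g}}.
Hypothesis FK : forall x y, x \in L -> y \in K -> F (e x * e y)%g = F (e x).

Lemma imset_lcoset x : x \in L -> e @: (x *: K)%g = (e x *: (e @: K))%g.
Proof.
move=> Lx; apply/setP => z; apply/imsetP/lcosetP.
  case=> _ /lcosetP[y Ky ->] ->; exists (e y); first exact: imset_f.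
  by rewrite eM // (subsetP sKL).
case=> _ /imsetP[y Ky ->] ->; exists (x * y)%g.
  by rewrite mem_lcoset mulKg.
by rewrite eM // (subsetP sKL).
Qed.

Lemma sum_lcosets_imset :
  \sum_(yK in lcosets (e @: K) (e @: L)) F (repr yK) =
  \sum_(xK in lcosets K L) F (e (repr xK)).
Proof.
have -> : lcosets (e @: K) (e @: L) =
          (fun xK : {set aT} => e @: xK) @: lcosets K L.
  apply/setP => Z; apply/lcosetsP/imsetP.
    case=> _ /imsetP[x Lx ->] ->; exists (x *: K)%g.
      by apply/lcosetsP; exists x.
    by rewrite imset_lcoset.
  case=> _ /lcosetsP[x Lx ->] ->; exists (e x); first exact: imset_f.
  by rewrite imset_lcoset.
rewrite big_imset /=; last by move=> X Y _ _; apply: imset_inj.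
apply: eq_bigr => xK xKL; have Lr := repr_lcosets sKL xKL.
have [x Lx def_xK] := lcosetsP xKL.
have rK : repr xK \in xK by rewrite def_xK; apply: mem_repr (lcoset_refl K x).
have eK : xK = (repr xK *: K)%g.
  by rewrite {1}def_xK; apply/lcoset_eqP; rewrite lcoset_sym -def_xK.
have /imsetP[y yK ->] : repr (e @: xK) \in e @: xK.
  by apply: mem_repr (imset_f e rK).
move: yK; rewrite {1}eK => /lcosetP[z Kz ->].
by rewrite eM ?FK // (subsetP sKL).
Qed.

End CosetReindex.

Section ExtendedBrauerQuotient.

Variables (k : fieldType) (gT : finGroupType) (A : fdalgType k).
Variables (rho : interior gT A) (Q : {group gT}).

Local Notation AutQ := [subg [Aut Q]].
Implicit Types phi psi chi : AutQ.

Definition ext_fixed phi : {vspace A} :=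
  fixed (biact rho) (Delta (sgval phi) Q).

Definition ext_ker phi : {vspace A} :=
  (\sum_(R : {group gT} | R \proper Q)
     traces (biact rho) (Delta (sgval phi) R) (Delta (sgval phi) Q))%VS.

Definition ext_comp phi : vectType k := vquot (ext_fixed phi) (ext_ker phi).

Definition extBrauer : Type := dsum ext_comp.
HB.instance Definition _ := Vector.on extBrauer.

Definition ext_class phi (a : A) : ext_comp phi :=
  qclass (ext_fixed phi) (ext_ker phi) a.
HB.instance Definition _ phi := GRing.Linear.copy (ext_class phi)
  (qclass (ext_fixed phi) (ext_ker phi)).
Definition ext_repr (x : extBrauer) phi : A :=
  @qrepr _ _ (ext_fixed phi) (ext_ker phi) (dcoord x phi).
Definition mkext (F : forall phi, ext_comp phi) : extBrauer := mkdsum F.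

Local Notation U := ext_fixed.
Local Notation W := ext_ker.

Lemma subg_autM phi : {in Q &, {morph sgval phi : u v / (u * v)%g}}.
Proof. exact/morphicP/Aut_morphic/subgP. Qed.
Lemma subg_aut_closed phi u : u \in Q -> sgval phi u \in Q.
Proof. exact/Aut_closed/subgP. Qed.
Lemma subg_autV phi u : u \in Q -> (sgval phi u)^-1%g = sgval phi u^-1%g.
Proof.
by move=> Qu; rewrite -(autmE (subgP phi)) morphV.
Qed.

Lemma ext_fixedP phi (R : {set gT}) a :
  reflect (forall u, u \in R -> rho (sgval phi u) * a * rho u^-1%g = a)
          (a \in fixed (biact rho) (Delta (sgval phi) R)).
Proof.
apply: (iffP (@fixedP _ _ _ _ _ _)) => [fix_a u Ru | fix_a w].
  by rewrite -{2}(fix_a (sgval phi u, u)) ?biactE ?imset_f.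
by case/imsetP=> u Ru ->; rewrite biactE fix_a.
Qed.

Let comm_fixed phi (R : {set gT}) a u :
  a \in fixed (biact rho) (Delta (sgval phi) R) -> u \in R ->
  rho (sgval phi u) * a = a * rho u.
Proof.
by move=> /ext_fixedP Ra Ru; rewrite -{2}(Ra u) // -mulrA imapVK mulr1.
Qed.

Let fixed_comm phi (R : {set gT}) a :
  (forall u, u \in R -> rho (sgval phi u) * a = a * rho u) ->
  a \in fixed (biact rho) (Delta (sgval phi) R).
Proof.
by move=> Ra; apply/ext_fixedP => u Ru; rewrite Ra // -mulrA imapKV mulr1.
Qed.

Let U1 : 1 \in U 1%g.
Proof. by apply: fixed_comm => u _; rewrite perm1 mulr1 mul1r. Qed.

Let UM phi psi a b : a \in U phi -> b \in U psi -> a * b \in U (psi * phi)%g.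
Proof.
move=> Ua Ub; apply: fixed_comm => u Qu.
rewrite /= permM mulrA (comm_fixed Ua) ?subg_aut_closed //.
by rewrite -mulrA (comm_fixed Ub) ?mulrA.
Qed.

Lemma ext_traceE phi (R : {group gT}) a : R \subset Q ->
    a \in fixed (biact rho) (Delta (sgval phi) R) ->
  rtrace (biact rho) (Delta (sgval phi) R) (Delta (sgval phi) Q) a =
  \sum_(xR in lcosets R Q)
     rho (sgval phi (repr xR)) * a * rho (repr xR)^-1%g.
Proof.
move=> sRQ Ra; rewrite rtraceE.
have e_inj : injective (fun u => (sgval phi u, u)) by move=> u v [].
rewrite (@sum_lcosets_imset _ _ _ R Q _ (fun w => biact rho w a)) //.
- by apply: eq_bigr => xR _; rewrite biactE.
- by move=> u v Qu Qv; rewrite subg_autM.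
move=> x y Qx Ry; rewrite !biactE /= invMg !imapM.
by rewrite -(mulrA (rho (sgval phi x))) (comm_fixed Ra Ry) !mulrA
  -(mulrA _ (rho y)) imapKV mulr1.
Qed.

Let W_ind phi (P : A -> Prop) :
    P 0 -> (forall a b, P a -> P b -> P (a + b)) ->
    (forall (R : {group gT}) a, R \proper Q ->
       a \in fixed (biact rho) (Delta (sgval phi) R) ->
       P (\sum_(xR in lcosets R Q)
            rho (sgval phi (repr xR)) * a * rho (repr xR)^-1%g)) ->
  forall a, a \in W phi -> P a.
Proof.
move=> P0 PD PT _ /memv_sumP[f fW ->]; apply: big_ind => // R prRQ.
have /memv_imgP[a Ua ->] := fW R prRQ.
by rewrite ext_traceE ?proper_sub //; apply: PT.
Qed.

Let trW phi (R : {group gT}) a :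
  R \proper Q -> a \in fixed (biact rho) (Delta (sgval phi) R) ->
  \sum_(xR in lcosets R Q)
     rho (sgval phi (repr xR)) * a * rho (repr xR)^-1%g \in W phi.
Proof.
move=> prRQ Ra; rewrite -ext_traceE ?proper_sub // memvE.
apply: subv_trans (sumv_sup R prRQ (subvv _)).
by rewrite -memvE memv_img.
Qed.

Let WUl phi psi a b : a \in U phi -> b \in W psi -> a * b \in W (psi * phi)%g.
Proof.
move=> Ua Wb; move: b Wb; apply: W_ind => [||R b prRQ Rb].
- by rewrite mulr0 mem0v.
- by move=> b1 b2; rewrite mulrDr; apply: rpredD.
have sRQ := proper_sub prRQ.
rewrite (_ : _ * _ = \sum_(xR in lcosets R Q)
  rho (sgval (psi * phi)%g (repr xR)) * (a * b) * rho (repr xR)^-1%g).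
  apply: trW => //; apply: fixed_comm => u Ru; have Qu := subsetP sRQ u Ru.
  rewrite /= permM mulrA (comm_fixed Ua) ?subg_aut_closed //.
  by rewrite -mulrA (comm_fixed Rb) ?mulrA.
rewrite mulr_sumr; apply: eq_bigr => xR /(repr_lcosets sRQ) Qx.
by rewrite /= permM !mulrA (comm_fixed Ua) ?subg_aut_closed.
Qed.

Let WUr phi psi a b : a \in W phi -> b \in U psi -> a * b \in W (psi * phi)%g.
Proof.
move=> Wa Ub; move: a Wa; apply: W_ind => [||R a prRQ Ra].
- by rewrite mul0r mem0v.
- by move=> a1 a2; rewrite mulrDl; apply: rpredD.
have sRQ := proper_sub prRQ.
have psiK : cancel (sgval psi) (sgval psi^-1%g) by move=> u; rewrite /= permK.
have psiKV : cancel (sgval psi^-1%g) (sgval psi) by move=> u; rewrite /= permKV.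
pose R' := (autm (subgP psi^-1%g) @* R)%G.
have defR' : R' :=: sgval psi^-1%g @: R.
  by rewrite /= morphimEsub.
have psiR' : sgval psi @: R' = R.
  rewrite defR' -imset_comp -[RHS]imset_id; apply: eq_imset => u /=.
  by rewrite permKV.
have psiQ : sgval psi @: Q = Q.
  by rewrite -(autmE (subgP psi)) -morphimEdom im_autm.
have prR'Q : R' \proper Q.
  rewrite properEcard -(card_imset R' (can_inj psiK)) psiR'.
  rewrite proper_card // andbT defR'; apply/subsetP => _ /imsetP[u Ru ->].
  exact: subg_aut_closed (subsetP sRQ u Ru).
have sR'Q := proper_sub prR'Q.
rewrite (_ : _ * _ = \sum_(xR in lcosets R' Q)
  rho (sgval (psi * phi)%g (repr xR)) * (a * b) * rho (repr xR)^-1%g).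
  apply: trW => //; apply: fixed_comm => u Ru; have Qu := subsetP sR'Q u Ru.
  rewrite /= permM mulrA (comm_fixed Ra) -?psiR' ?imset_f //.
  by rewrite -mulrA (comm_fixed Ub) ?mulrA.
rewrite mulr_suml -{1}psiR' -{1}psiQ.
rewrite (@sum_lcosets_imset _ _ _ R' Q (sgval psi)
  (fun x => rho (sgval phi x) * a * rho x^-1%g * b)) //.
- apply: eq_bigr => xR /(repr_lcosets sR'Q) Qx.
  by rewrite subg_autV // /= permM -!mulrA (comm_fixed Ub) ?groupV.
- exact: can_inj psiK.
- exact: subg_autM.
move=> x y Qx R'y; have Ry : sgval psi y \in R by rewrite -psiR' imset_f.
rewrite subg_autM ?subg_aut_closed // ?invMg ?imapM; last exact: (subsetP sR'Q).
by rewrite -(mulrA (rho (sgval phi _))) (comm_fixed Ra Ry) !mulrA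
  -(mulrA _ (rho (sgval psi y))) imapKV mulr1.
Qed.

Let mul (x y : extBrauer) : extBrauer :=
  mkext (fun chi => \sum_phi
    ext_class chi (ext_repr x phi * ext_repr y (chi * phi^-1)%g)).
Let one : extBrauer :=
  mkext (fun phi => if phi == 1%g then ext_class phi 1 else 0).

Lemma ext_reprP x phi : ext_repr x phi \in U phi.
Proof. exact: qrepr_mem. Qed.
Lemma ext_reprK x phi : ext_class phi (ext_repr x phi) = dcoord x phi.
Proof. exact: qreprK. Qed.
Lemma ext_classE phi a b :
  a \in U phi -> b \in U phi -> a - b \in W phi ->
  ext_class phi a = ext_class phi b.
Proof. exact: qclass_eq. Qed.

Let mk_repr (F : forall phi, A) phi :
    (forall phi, F phi \in U phi) ->
  ext_repr (mkext (fun phi => ext_class phi (F phi))) phi - F phi \in W phi.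
Proof. by move=> UF; rewrite /ext_repr dsumE; apply: qclassK. Qed.

Let mulE (F G : forall phi, A) :
    (forall phi, F phi \in U phi) -> (forall phi, G phi \in U phi) ->
  mul (mkext (fun phi => ext_class phi (F phi)))
      (mkext (fun phi => ext_class phi (G phi))) =
  mkext (fun chi => ext_class chi (\sum_phi F phi * G (chi * phi^-1)%g)).
Proof.
move=> UF UG; apply: dsumP => chi; rewrite !dsumE linear_sum.
apply: eq_bigr => phi _.
have def_chi : (chi * phi^-1 * phi)%g = chi by rewrite mulgKV.
have in_chi a b : a \in U phi -> b \in U (chi * phi^-1)%g -> a * b \in U chi.
  by move=> Ua Ub; rewrite -[chi]def_chi UM.
apply: ext_classE; rewrite ?in_chi ?ext_reprP //.
set x := ext_repr _ _; set y := ext_repr _ _.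
rewrite -[X in X - _](subrK (F phi * y)) -mulrBl -addrA -mulrBr.
apply: rpredD; rewrite -[in W _]def_chi.
  by apply: WUr; [apply: mk_repr | apply: ext_reprP].
by apply: WUl => //; apply: mk_repr.
Qed.

Let extP x : exists2 F : forall phi, A, forall phi, F phi \in U phi &
  x = mkext (fun phi => ext_class phi (F phi)).
Proof.
exists (ext_repr x) => [phi|]; first exact: ext_reprP.
by apply: dsumP => phi; rewrite dsumE ext_reprK.
Qed.

Let UMsum (F G : forall phi, A) chi :
    (forall phi, F phi \in U phi) -> (forall phi, G phi \in U phi) ->
  \sum_phi F phi * G (chi * phi^-1)%g \in U chi.
Proof.
move=> UF UG; apply: rpred_sum => phi _.
by have := UM (UF phi) (UG (chi * phi^-1)%g); rewrite mulgKV.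
Qed.

Let oneE : one = mkext (fun phi => ext_class phi (if phi == 1%g then 1 else 0)).
Proof. by apply: dsumP => phi; rewrite !dsumE; case: eqP; rewrite ?linear0. Qed.
Let one_mem phi : (if phi == 1%g then 1 else 0 : A) \in U phi.
Proof. by case: eqP => [->|_]; rewrite ?U1 ?mem0v. Qed.

Fact ext_mulA : associative mul.
Proof.
move=> x y z; have [F UF ->] := extP x; have [G UG ->] := extP y.
have [H UH ->] := extP z.
rewrite !mulE //; try by move=> phi; apply: UMsum.
apply: dsumP => chi; rewrite !dsumE; congr ext_class.
under eq_bigr do rewrite mulr_sumr.
under [RHS]eq_bigr do rewrite mulr_suml.
rewrite [RHS]exchange_big; apply: eq_bigr => phi _ /=.
rewrite [RHS](reindex_inj (mulIg phi)); apply: eq_bigr => psi _ /=.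
by rewrite mulrA mulgK invMg mulgA.
Qed.
Fact ext_mul1 : left_id one mul.
Proof.
move=> x; have [F UF ->] := extP x; rewrite oneE mulE //.
apply: dsumP => chi; rewrite !dsumE (bigD1 1%g) //= eqxx mul1r invg1 mulg1.
by rewrite big1 ?addr0 // => phi /negPf->; rewrite mul0r.
Qed.
Fact ext_mulr1 : right_id one mul.
Proof.
move=> x; have [F UF ->] := extP x; rewrite oneE mulE //.
apply: dsumP => chi; rewrite !dsumE (bigD1 chi) //= mulgV eqxx mulr1.
rewrite big1 ?addr0 // => phi; rewrite eq_sym -eq_mulgV1 => /negPf->.
by rewrite mulr0.
Qed.

Let reprD x y phi : ext_repr (x + y) phi = ext_repr x phi + ext_repr y phi.
Proof. by rewrite /ext_repr dcoordD linearD. Qed.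
Let reprZ t x phi : ext_repr (t *: x) phi = t *: ext_repr x phi.
Proof. by rewrite /ext_repr dcoordZ linearZ. Qed.

Fact ext_mulDl : left_distributive mul +%R.
Proof.
move=> x y z; apply: dsumP => chi; rewrite dcoordD !dsumE -big_split.
by apply: eq_bigr => phi _; rewrite /= reprD mulrDl linearD.
Qed.
Fact ext_mulDr : right_distributive mul +%R.
Proof.
move=> x y z; apply: dsumP => chi; rewrite dcoordD !dsumE -big_split.
by apply: eq_bigr => phi _; rewrite /= reprD mulrDr linearD.
Qed.
Fact ext_scaleAl (t : k) x y : t *: mul x y = mul (t *: x) y.
Proof.
apply: dsumP => chi; rewrite dcoordZ !dsumE scaler_sumr.
by apply: eq_bigr => phi _; rewrite reprZ -fdalg_scaleAl linearZ.
Qed.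
Fact ext_scaleAr (t : k) x y : t *: mul x y = mul x (t *: y).
Proof.
apply: dsumP => chi; rewrite dcoordZ !dsumE scaler_sumr.
by apply: eq_bigr => phi _; rewrite reprZ -fdalg_scaleAr linearZ.
Qed.
HB.instance Definition _ := Vector_isFinDimAlgebra.Build k extBrauer
  ext_mulA ext_mul1 ext_mulr1 ext_mulDl ext_mulDr ext_scaleAl ext_scaleAr.
HB.instance Definition _ := GRing.PzRing.copy extBrauer
  (FinDimAlgebra.sort (extBrauer : fdalgType k)).

(* The homogeneous element given by a in the component of phi.               *)
Definition ext_inj phi (a : A) : extBrauer :=
  mkext (fun psi => if psi == phi then ext_class psi a else 0).

Lemma ext_injM phi psi a b : a \in U phi -> b \in U psi ->
  ext_inj phi a * ext_inj psi b = ext_inj (psi * phi)%g (a * b).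
Proof.
move=> Ua Ub.
have injE chi c : ext_inj chi c =
    mkext (fun psi => ext_class psi (if psi == chi then c else 0)).
  by apply: dsumP => ?; rewrite !dsumE; case: eqP; rewrite ?linear0.
have injU chi c : c \in U chi ->
    forall psi, (if psi == chi then c else 0) \in U psi.
  by move=> Uc ?; case: eqP => [->|]; rewrite ?mem0v.
rewrite !injE [LHS]mulE; try exact: injU.
apply: dsumP => chi; rewrite !dsumE (bigD1 phi) //= eqxx big1 ?addr0.
  rewrite (can2_eq (mulgKV phi) (mulgK phi)).
  by case: eqP; rewrite ?mulr0.
by move=> ? /negPf->; rewrite mul0r.
Qed.

(* x.1_A lies in the component of u |-> x u x^-1, and conj_aut Q x^-1 is the  *)
(* automorphism u |-> u ^ x^-1 = x u x^-1 of Q, for x in 'N(Q).               *)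
Definition ext_conj (x : gT) : AutQ := subg [Aut Q] (conj_aut Q x^-1%g).
Definition ext_imap (x : gT) : extBrauer := ext_inj (ext_conj x) (rho x).

Lemma ext_conjE x u : x \in 'N(Q)%g -> u \in Q ->
  sgval (ext_conj x) u = (x * u * x^-1)%g.
Proof.
move=> Nx Qu; rewrite subgK ?Aut_aut // norm_conj_autE ?groupV //.
by rewrite conjgE invgK mulgA.
Qed.

Lemma ext_imap1 : ext_imap 1%g = 1.
Proof.
have -> : ext_imap 1%g = ext_inj 1%g 1; last by [].
rewrite /ext_imap imap1; congr ext_inj; apply: val_inj => /=.
by rewrite subgK ?Aut_aut // invg1 morph1.
Qed.

Lemma ext_imap_mem x : x \in 'N(Q)%g -> rho x \in U (ext_conj x).
Proof.
move=> Nx; apply: fixed_comm => u Qu.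
by rewrite ext_conjE // -!imapM mulgKV.
Qed.

Lemma ext_imapM : {in 'N(Q)%g &, {morph ext_imap : x y / (x * y)%g >-> x * y}}.
Proof.
move=> x y Nx Ny; rewrite [RHS]ext_injM ?ext_imap_mem // -imapM.
congr ext_inj; apply: val_inj => /=.
by rewrite !subgK ?Aut_aut // invMg morphM ?groupV.
Qed.

Definition ext_act : gT -> 'End(extBrauer) := conj_act ext_imap.

End ExtendedBrauerQuotient.

(* The homomorphism C(Q) -> A(Q) <= X, the class of c being sent to the class *)
(* of c in the component of the identity of Q.                                *)

Section ExtendedEmbedding.

Variables (k : fieldType) (gT : finGroupType) (A : fdalgType k).
Variables (rho : interior gT A) (N : {set gT}).
Variables (C : interior_subalgebra rho N) (Q : {group gT}).

Local Notation CQ := (brauerQuotient (sub_galgebra C) Q).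

Definition ext_emb (y : CQ) : extBrauer rho Q :=
  ext_inj rho (1%g : [subg [Aut Q]]) (sval_of (Brrepr y)).

Lemma sub_fixedP (R : {set gT}) (x : subalg_of C) :
  x \in fixed (sub_galgebra C) R ->
  sval_of x \in fixed (biact rho) (Delta (sgval (1%g : [subg [Aut Q]])) R).
Proof.
move/fixedP => Rx; apply/ext_fixedP => u Ru; rewrite perm1 -conj_actE.
by rewrite -sub_actE Rx.
Qed.

Lemma sub_brauer_ker (x : subalg_of C) :
  x \in brauer_ker (sub_galgebra C) Q ->
  sval_of x \in ext_ker rho (1%g : [subg [Aut Q]]).
Proof.
case/memv_sumP => f fW ->; rewrite linear_sum; apply: rpred_sum => R prRQ.
have sRQ := proper_sub prRQ.
have /memv_imgP[a Ra ->] := fW R prRQ; rewrite memvE.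
apply: subv_trans (sumv_sup R prRQ (subvv _)); rewrite -memvE.
apply/memv_imgP; exists (sval_of a); first exact: sub_fixedP.
rewrite ext_traceE ?sub_fixedP // rtraceE linear_sum; apply: eq_bigr => xR _.
by rewrite /= sub_actE conj_actE perm1.
Qed.

Lemma ext_embE x : x \in fixed (sub_galgebra C) Q ->
  ext_emb (Br (sub_galgebra C) Q x) =
  ext_inj rho (1%g : [subg [Aut Q]]) (sval_of x).
Proof.
move=> Qx; apply: dsumP => phi; rewrite !dsumE; case: eqP => // ->.
apply: ext_classE; [exact/sub_fixedP/qrepr_mem | exact: sub_fixedP |].
by rewrite -linearB; apply: sub_brauer_ker; apply: qclassK.
Qed.

Lemma ext_embM : {morph ext_emb : x y / x * y}.
Proof.
move=> x y; have [a Qa ->] := Br_surj x; have [b Qb ->] := Br_surj y.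
have Qab : a * b \in fixed (sub_galgebra C) Q.
  have /fixedP Ua := Qa; have /fixedP Ub := Qb.
  by apply/fixedP => u Qu; rewrite gactM Ua ?Ub.
rewrite -BrM // !ext_embE // ext_injM ?mulg1; try exact: sub_fixedP.
by rewrite svalM.
Qed.

Lemma ext_emb1 : ext_emb 1 = 1.
Proof.
rewrite -Br1 ext_embE ?sval1 //.
by apply/fixedP => u _; rewrite gact1.
Qed.

End ExtendedEmbedding.

Section Points.

Variable B : pzRingType.
Implicit Types (S alpha : set B).

Definition primitive_idempotent S (i : B) : Prop :=
  [/\ S i, i != 0, i * i = i &
      forall e f, S e -> S f -> e * e = e -> f * f = f ->
        e * f = 0 -> f * e = 0 -> i = e + f -> e = 0 \/ f = 0].

Definition conjugacy_class S (i : B) : set B :=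
  [set j | exists u v,
     [/\ S u, S v, u * v = 1, v * u = 1 & j = u * i * v]]%classic.

Definition is_point S alpha : Prop :=
  exists2 i, primitive_idempotent S i & alpha = conjugacy_class S i.

Definition is_block (e : B) : Prop :=
  primitive_idempotent [set z | forall x, z * x = x * z]%classic e.

End Points.

Section DefectGroups.

Variables (k : fieldType) (p : nat) (gT : finGroupType) (B : fdalgType k).

Definition point_of (act : gT -> 'End(B)) (L : {set gT}) : set B -> Prop :=
  is_point [set` fixed act L]%classic.

Definition defect_group (act : gT -> 'End(B)) (L : {set gT}) (alpha : set B)
    (D : {group gT}) : Prop :=
  [/\ D \subset L, (p.-group D)%g,
      forall i, alpha i -> i \in traces act D L &
      exists2 i, alpha i & i \notin brauer_ker act D].

Definition p_permutation (act : gT -> 'End(B)) (L : {set gT}) : Prop :=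
  forall P : {group gT}, P \subset L -> (p.-group P)%g ->
  exists2 bs : seq B, basis_of {:B} bs &
    forall x b, x \in P -> b \in bs -> act x b \in bs.

Variable act : galgebra gT B.

Definition brauer_pair (b : B) (L : {set gT})
    (P : {R : {group gT} & brauerQuotient act R}) : Prop :=
  let: existT R e := P in
  [/\ R \subset L, (p.-group R)%g, is_block e & Br act R b * e != 0].

Definition brauer_pair_le (P P' : {R : {group gT} & brauerQuotient act R}) :
    Prop :=
  let: existT R e := P in let: existT R' e' := P' in
  R \subset R' /\
  forall i : B, primitive_idempotent [set` fixed act R']%classic i ->
    Br act R' i * e' != 0 -> Br act R i * e != 0.

Definition maximal_brauer_pair (b : B) (L : {set gT})
    (P : {R : {group gT} & brauerQuotient act R}) : Prop :=
  brauer_pair b L P /\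
  forall P', brauer_pair b L P' -> brauer_pair_le P P' -> P' = P.

Definition norm_stabiliser (Q : {group gT}) (f : brauerQuotient act Q) :
    {set gT} :=
  [set x in 'N(Q)%g | brauer_act act Q x f == f]%SET.

End DefectGroups.

(* The point alpha of B^L strongly covers the point beta' of B'^M, which has  *)
(* defect group Q.  iota is the inclusion of B' in B, or more generally a     *)
(* homomorphism B' -> B along which B' is regarded as a subalgebra.           *)

Definition strongly_covers (k : fieldType) (p : nat) (gT : finGroupType)
    (B' B : fdalgType k) (act' : gT -> 'End(B')) (act : gT -> 'End(B))
    (iota : B' -> B) (M L : {set gT}) (Q : {group gT})
    (beta' : set B') (alpha : set B) : Prop :=
  forall j, beta' j -> j \in fixed act' L ->
  exists i epsilon,
    [/\ alpha i /\ (iota j * i = i /\ i * iota j = i),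
        point_of act M epsilon /\ defect_group p act M epsilon Q,
        exists2 f, epsilon f & i * f = f /\ f * i = f &
        exists2 f1, epsilon f1 & iota j * f1 = f1 /\ f1 * iota j = f1].

(* V, with the action act of the group K, is projective as a kK-module; kK-   *)
(* modules are k-spaces with a linear action of K.                            *)

Definition group_module (k : fieldType) (hT : finGroupType) (K : {set hT})
    (M : lmodType k) (act : hT -> {linear M -> M}) : Prop :=
  (forall m, act 1%g m = m) /\
  (forall x y m, x \in K -> y \in K -> act (x * y)%g m = act x (act y m)).

Definition equivariant (hT : finGroupType) (K : {set hT}) (M M' : Type)
    (act : hT -> M -> M) (act' : hT -> M' -> M') (f : M -> M') : Prop :=
  forall x m, x \in K -> f (act x m) = act' x (f m).

Definition projective_module (k : fieldType) (hT : finGroupType)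
    (K : {set hT}) (V : lmodType k) (act : hT -> V -> V) : Prop :=
  forall (M M' : lmodType k)
    (a : hT -> {linear M -> M}) (a' : hT -> {linear M' -> M'}),
  group_module K a -> group_module K a' ->
  forall (f : {linear M -> M'}) (g : {linear V -> M'}),
  equivariant K a a' f -> equivariant K act a' g ->
  (forall m', exists m, f m = m') ->
  exists2 h : {linear V -> M}, equivariant K act a h & forall v, f (h v) = g v.

(* Main.v *)
(* Let e be the image of f_Q in X and let I be the ideal of X generated by    *)
(* the augmentation ideal of kQ.  As Q is a p-group, I contains no nonzero    *)
(* idempotent.  Because A has a permutation basis on which Q acts freely from *)
(* the left, for Q <= D <= N_G(Q) every element of X^D is congruent modulo I  *)
(* to the image tau(a) of some a in A^D: the components of X at phi <> 1 have *)
(* no basis vector fixed by Q, and Q acts trivially on X / I.  Since f_Q      *)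
(* normalizes a basis of X^{N_G(Q)}, e m = e m e for m in X^{N_G(Q)}, so that *)
(* theta(a) = e tau(a) is a homomorphism from A^G to eX^He.  It maps every    *)
(* G-fixed member of beta to e.  The N_G(Q)-conjugates of f_Q are orthogonal  *)
(* and sum to Br_Q(c), and therefore, for D with D :&: N = Q, theta maps      *)
(* A_D^G onto e X_D^H e modulo I.  Primitive idempotents and their conjugacy  *)
(* then lift along theta as they do along a surjection with nilpotent kernel. *)

Require Import Defs.
From HB Require Import structures.
From mathcomp Require Import boolp classical_sets functions.
From mathcomp Require Import all_boot all_order all_algebra all_fingroup.
From mathcomp Require Import cyclic pgroup sylow gseries maximal.

Set Implicit Arguments.
Unset Strict Implicit.
Unset Printing Implicit Defensive.

Import GRing.Theory.
Local Open Scope ring_scope.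

(** * Idempotents of finite dimensional algebras *)

(** Idempotents are transported along [theta] a = e tau(a), where e is the image of f_Q in X and tau
    is [ext_unit], that is Br_Q into the identity component of X. Since e m = e m e on X^{N_G(Q)},
    [theta] is multiplicative on A^G ([thetaM]).

    Let I be the ideal of X generated by the u - 1 for u in Q, and J the sum of the X_D^H with D <=
    H a p-group meeting N in Q. Modulo I, the image of A^G contains eJe ([theta_lift]). Indeed
    elements of X^D come from A^D modulo I ([ext_approx]), because projectivity makes Q act freely
    from the left on the permutation basis ([left_free]); and conjugates of f_Q by elements outside
    H are orthogonal to f_Q, so that cutting Tr_D^{N_G(Q)} by e leaves Tr_D^H only
    ([theta_trace_aug]).

    Moreover I contains no nonzero idempotent ([ext_aug_idempotent]). Hence, for i primitive in A^G,
    an element of the local algebra iA^Gi whose image is congruent to a nonzero idempotent is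
    invertible ([theta_unit]). This gives in turn primitivity of theta(i) ([covering_primitive]),
    injectivity on points ([covering_conj]), surjectivity ([covering_lift]) and equality of defect
    groups ([covering_defect_group]). That theta(i) is nonzero follows from [theta_eq0], as Br_Q(c)
    lies under the sum of the conjugates of f_Q ([block_sum_Br]).

    It remains to make strong covering intrinsic. On the side of A it amounts to containing some i
    under c with Br_Q(i) nonzero and i in A_D^G for some D meeting N in Q
    ([strongly_covers_covering], [covering_strongly_covers]); on the side of X it amounts to
    containing an idempotent under e ([ext_strongly_covers]). *)

Section Multiplications.

Variables (k : fieldType) (B : fdalgType k).

Definition lmul (a : B) : 'End(B) := linfun (fun x : B => a * x).
Definition rmul (a : B) : 'End(B) := linfun (fun x : B => x * a).

Lemma lmulE a x : lmul a x = a * x.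
Proof.
have f_lin : linear (fun x : B => a * x).
  by move=> t u v; rewrite mulrDr -fdalg_scaleAr.
pose fM := GRing.isLinear.Build k B B _ (fun x => a * x) f_lin.
pose fL : {linear B -> B} := HB.pack (fun x => a * x) fM.
exact: (lfunE fL).
Qed.

Lemma rmulE a x : rmul a x = x * a.
Proof.
have f_lin : linear (fun x : B => x * a).
  by move=> t u v; rewrite mulrDl -fdalg_scaleAl.
pose fM := GRing.isLinear.Build k B B _ (fun x => x * a) f_lin.
pose fL : {linear B -> B} := HB.pack (fun x => x * a) fM.
exact: (lfunE fL).
Qed.

Lemma iter_lmul n a x : iter n (lmul a) x = a ^+ n * x.
Proof.
by elim: n => [|n IH]; rewrite ?expr0 ?mul1r // iterS IH lmulE exprS mulrA.
Qed.

Lemma iter_rmul n a x : iter n (rmul a) x = x * a ^+ n.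
Proof.
by elim: n => [|n IH]; rewrite ?expr0 ?mulr1 // iterS IH rmulE exprSr mulrA.
Qed.

End Multiplications.

Lemma iter_limg_stable (k : fieldType) (V : vectType k) (f : 'End(V))
    (U : {vspace V}) : (f @: U <= U)%VS ->
  exists n, forall m1 m2 x, (n <= m1)%N -> (n <= m2)%N -> x \in U ->
    exists2 y, y \in U & iter m1 f x = iter m2 f y.
Proof.
move=> fU; pose W n := iter n (fun V => f @: V)%VS U.
have WP n x : reflect (exists2 y, y \in U & x = iter n f y) (x \in W n).
  elim: n x => [|n IH] x; first by apply: (iffP idP) => [Ux | [y Uy ->]] //;
    exists x.
  apply: (iffP memv_imgP) => [[y /IH[z Uz ->] ->] | [z Uz ->]].
    by exists z.
  by exists (iter n f z) => //; apply/IH; exists z.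
have dW n : (W n.+1 <= W n)%VS.
  by elim: n => [|n IH] //; apply: limgS.
have [n eW] : exists n, W n.+1 = W n.
  have [n] : exists n, (\dim (W n) <= \dim (W n.+1))%N.
    apply: contrapT => /forallNP no.
    have lt n : (\dim (W n) + n <= \dim U)%N.
      elim: n => [|n IH]; first by rewrite addn0.
      have /negP := no n; rewrite -ltnNge => h.
      by apply: leq_trans IH; rewrite addnS -addSn leq_add2r.
    by have := lt (\dim U).+1; rewrite addnS ltnNge leq_addl.
  by move=> le; exists n; apply/eqP; rewrite eqEdim dW le.
have eWm m : (n <= m)%N -> W m = W n.
  move=> le_nm; rewrite -(subnK le_nm); elim: (m - n)%N => [|d IH] //.
  by rewrite addSn /= -/(W _) IH -[RHS]eW.
exists n => m1 m2 x le1 le2 Ux.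
by apply/WP; rewrite (eWm m2) // -(eWm m1) //; apply/WP; exists x.
Qed.

Section Idempotents.

Variables (k : fieldType) (B : fdalgType k) (S : subalgebra B).
Implicit Types a b e f g i j : B.

Let SM a b : a \in S -> b \in S -> a * b \in S.
Proof. exact: subalgM. Qed.

Lemma subalgX a n : a \in S -> a ^+ n \in S.
Proof.
by move=> Sa; elim: n => [|n IH]; rewrite ?expr0 ?subalg1 // exprS SM.
Qed.

(** Fitting's lemma: once the chains a^n S and S a^n are stationary, x = a^n satisfies x = x x b =
    b' x x, which makes x b = b' x an idempotent. *)
Lemma subalg_fitting a : a \in S ->
  exists e b b', [/\ [/\ e \in S, b \in S & b' \in S], e * e = e,
    a * b = e /\ b' * a = e & e = 0 -> exists n, a ^+ n = 0].
Proof.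
move=> Sa.
have [|n1 st1] := @iter_limg_stable _ _ (lmul a) S.
  by apply/subvP => _ /memv_imgP[x Sx ->]; rewrite lmulE SM.
have [|n2 st2] := @iter_limg_stable _ _ (rmul a) S.
  by apply/subvP => _ /memv_imgP[x Sx ->]; rewrite rmulE SM.
(* The successor leaves a factor a to split off x on either side. *)
pose n := (n1 + n2).+1; pose x := a ^+ n; have Sx : x \in S by apply: subalgX.
have le1 : (n1 <= n)%N by rewrite leqW ?leq_addr.
have le2 : (n2 <= n)%N by rewrite leqW ?leq_addl.
have [b Sb] := st1 n (n + n)%N 1 le1 (leq_trans le1 (leq_addr _ _)) (subalg1 S).
have [b' Sb'] := st2 n (n + n)%N 1 le2 (leq_trans le2 (leq_addr _ _)) (subalg1
  S).
rewrite !iter_lmul !iter_rmul mulr1 mul1r exprD -/x => def_x' def_x.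
have xb : x * b = b' * x by rewrite {1}def_x' -2!mulrA [x * (x * b)]mulrA
  -def_x.
have xxb : x * (x * b) = x by rewrite mulrA -def_x.
exists (x * b), (a ^+ (n1 + n2) * b), (b' * a ^+ (n1 + n2)).
split; first by rewrite !SM ?subalgX.
- by rewrite {1}xb -mulrA xxb -xb.
- by rewrite mulrA -exprS -mulrA -exprSr -/x xb.
by move=> e0; exists n; rewrite -/x -xxb e0 mulr0.
Qed.

Local Notation primitive := (primitive_idempotent [set` S]%classic).

Lemma primitiveW i : primitive i -> [/\ i \in S, i != 0 & i * i = i].
Proof. by case. Qed.

Lemma primitive_sub i e : primitive i -> e \in S -> e * e = e ->
  i * e = e -> e * i = e -> e = 0 \/ e = i.
Proof.
case=> Si i0 ii prim Se ee ie ei.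
have [] := prim e (i - e); rewrite ?mulrBl ?mulrBr ?ie ?ei ?ee ?ii ?subrr ?subr0
  //=.
- by rewrite rpredB.
- by rewrite addrC subrK.
- by left.
by move/eqP; rewrite subr_eq0 => /eqP ->; right.
Qed.

(** The corner iSi is local: the Fitting idempotent of a lies under i, hence is 0 or i. *)
Lemma primitive_dichotomy i a : primitive i -> a \in S -> i * a = a -> a * i =
  a ->
  (exists n, a ^+ n = 0) \/
  exists2 b, b \in S & [/\ i * b = b, b * i = b, a * b = i & b * a = i].
Proof.
move=> prim Sa ia ai; have [Si i0 ii] := primitiveW prim.
have [e [b [b' [[Se Sb Sb'] ee [ab ba] nil]]]] := subalg_fitting Sa.
have ie : i * e = e by rewrite -ab mulrA ia.
have ei : e * i = e by rewrite -ba -mulrA ai.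
have [/nil|e_i] := primitive_sub prim Se ee ie ei; first by left.
pose x := i * b * i; pose y := i * b' * i.
have ax : a * x = i by rewrite /x !mulrA ai ab e_i ii.
have ya : y * a = i by rewrite /y -!mulrA ia ba e_i ii.
have ix : i * x = x by rewrite /x !mulrA ii.
have xi : x * i = x by rewrite /x -!mulrA ii.
have yi : y * i = y by rewrite /y -!mulrA ii.
have xy : x = y by rewrite -ix -{1}ya -mulrA ax yi.
by right; exists x; [rewrite !SM | split; rewrite // xy].
Qed.

(** The nilpotent elements of the local corner iSi are closed under addition, so the terms i F_t i,
    whose sum is i, cannot all be nilpotent. *)
Lemma primitive_sum (I : finType) (P : pred I) (F : I -> B) i : primitive i ->
    (forall t, P t -> F t \in S) -> i = \sum_(t | P t) F t ->
  exists2 t, P t & exists2 b, b \in S & [/\ i * b = b, b * i = b,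
    (i * F t * i) * b = i & b * (i * F t * i) = i].
Proof.
move=> prim SF def_i; have [Si i0 ii] := primitiveW prim.
apply: contrapT => no.
pose rad x := [/\ x \in S, i * x = x, x * i = x & exists n, x ^+ n = 0].
have rad_nonunit x b : rad x -> i * b = b -> x * b = i -> False.
  case=> Sx ix xi [n nx] ib xb; move/eqP: i0; apply.
  have ibi m : i * (b ^+ m * i) = b ^+ m * i.
    by case: m => [|m]; rewrite ?mul1r // exprS !mulrA ib.
  have : x ^+ n * (b ^+ n * i) = i.
    elim: n {nx} => [|n IH]; first by rewrite !mul1r.
    by rewrite exprSr exprS -!mulrA [x * _]mulrA xb ibi.
  by rewrite nx mul0r.
have radD x y : rad x -> rad y -> rad (x + y).
  move=> rx ry; have [Sx ix xi nx] := rx; have [Sy iy yi ny] := ry.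
  have Sz : x + y \in S by rewrite rpredD.
  have iz : i * (x + y) = x + y by rewrite mulrDr ix iy.
  have zi : (x + y) * i = x + y by rewrite mulrDl xi yi.
  split=> //; have [//|[b Sb [ib bi zb bz]]] :=
    primitive_dichotomy prim Sz iz zi.
  exfalso; have Sxb : x * b \in S by rewrite SM.
  have ixb : i * (x * b) = x * b by rewrite mulrA ix.
  have xbi : x * b * i = x * b by rewrite -mulrA bi.
  have [[n nxb]|[d Sd [id di xbd dxb]]] := primitive_dichotomy prim Sxb ixb xbi;
    last first.
    by apply: (rad_nonunit x (b * d)); rewrite // mulrA ?ib.
  pose c := i * (\sum_(t < n) (x * b) ^+ t) * i.
  have ybc : (y * b) * c = i.
    have -> : y * b = i - x * b by rewrite -zb mulrDl addrC addKr.
    have geo : (1 - x * b) * (\sum_(t < n) (x * b) ^+ t) = 1.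
      by rewrite -opprB mulNr -subrX1 nxb sub0r opprK.
    have fac : i - x * b = i * (1 - x * b) by rewrite mulrBr mulr1 ixb.
    rewrite /c !mulrA mulrBl ii xbi fac -[i * _ * \sum_(t < n) _]mulrA geo.
    by rewrite mulr1 ii.
  by apply: (rad_nonunit y (b * c)) => //; rewrite mulrA ?ib.
suff ri : rad i by apply: (rad_nonunit i i).
rewrite {1}def_i.
have -> : \sum_(t | P t) F t = \sum_(t | P t) i * F t * i.
  by rewrite -mulr_suml -mulr_sumr -def_i !ii.
apply: (big_ind rad) => [|x y|t Pt]; first by split;
  rewrite ?mulr0 ?mul0r ?mem0v //; exists 1%N.
  exact: radD.
have St : i * F t * i \in S by rewrite !SM ?SF.
have [||nt|[b Sb [ib bi tb bt]]] := primitive_dichotomy prim St.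
- by rewrite !mulrA ii.
- by rewrite -mulrA ii.
- by split; rewrite // ?mulrA ?ii // -!mulrA ii.
by case: no; exists t => //; exists b.
Qed.

Local Notation conj := (conjugacy_class [set` S]%classic).

Lemma conj_refl i : conj i i.
Proof. by exists 1, 1; rewrite /= !mul1r mulr1; split=> //; apply: subalg1. Qed.

Lemma conj_sym i j : conj i j -> conj j i.
Proof.
case=> u [v [Su Sv uv vu ->]]; exists v, u; split=> //.
by rewrite !mulrA vu mul1r -mulrA vu mulr1.
Qed.

Lemma conj_trans i j g : conj i j -> conj j g -> conj i g.
Proof.
case=> u [v [Su Sv uv vu ->]] [u' [v' [Su' Sv' uv' vu' ->]]].
exists (u' * u), (v * v'); split; rewrite /= ?SM ?mulrA //.
  by rewrite -[u' * u * v]mulrA uv mulr1.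
by rewrite -[v * v' * u']mulrA vu' mulr1.
Qed.

Lemma conj_class_eq i j : conj i j -> conj i = conj j.
Proof.
move=> cij; apply/seteqP; split=> g; last exact: conj_trans.
exact/conj_trans/conj_sym.
Qed.

Lemma conj_primitive i j : conj i j -> primitive i -> primitive j.
Proof.
case=> u [v [Su Sv uv vu ->]] [Si i0 ii prim].
have vK x y : x * v * (u * y) = x * y by rewrite -mulrA [v * _]mulrA vu mul1r.
have uK x y : x * u * (v * y) = x * y by rewrite -mulrA [u * _]mulrA uv mul1r.
split; rewrite /= ?SM //.
- apply: contraNneq i0 => ui0; rewrite -[i]mul1r -[_ * i]mulr1 -vu -[v * u *
  i]mulrA.
  by rewrite [_ * (v * u)]mulrA -[_ * _ * v]mulrA ui0 mulr0 mul0r.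
- by rewrite !mulrA -[_ * _ * v * u]mulrA vu mulr1 -!mulrA [i * (i * _)]mulrA
  ii.
move=> e f Se Sf ee ff ef fe sum.
have vuK x : v * x * u = 0 -> x = 0.
  by move=> x0; rewrite -[x]mul1r -[_ * x]mulr1 -uv -!mulrA [v * _]mulrA [v * x
    * _]mulrA x0 mul0r mulr0.
have conjM x y : (v * x * u) * (v * y * u) = v * (x * y) * u.
  by rewrite !mulrA -[_ * u * v]mulrA uv mulr1.
case: (prim (v * e * u) (v * f * u));
  rewrite /= ?SM // ?conjM ?ee ?ff ?ef ?fe ?mulr0 ?mul0r //.
- by rewrite -mulrDl -mulrDr -sum !mulrA vu mul1r -mulrA vu mulr1.
- by move/vuK; left.
by move/vuK; right.
Qed.

Let unipotent (x : B) : x * x = 0 -> (1 + x) * (1 - x) = 1 /\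
  (1 - x) * (1 + x) = 1.
Proof.
move=> xx; split; first by rewrite mulrBr mulr1 mulrDl mul1r xx addr0 addrK.
by rewrite mulrDr mulr1 mulrBl mul1r xx subr0 subrK.
Qed.

Lemma conj_same_right e f : e \in S -> f \in S -> e * f = f -> f * e = e ->
  conj e f.
Proof.
move=> Se Sf ef fe; have ee : e * e = e by rewrite -{2}fe mulrA ef fe.
have ff : f * f = f by rewrite -{2}ef mulrA fe ef.
have [|uv vu] := @unipotent (f - e).
  by rewrite mulrBl !mulrBr ee ef fe ff !subrr.
exists (1 - (f - e)), (1 + (f - e)); split; rewrite //= ?(rpredB, rpredD,
  subalg1) //.
rewrite [(1 - _) * e]mulrBl mul1r [(f - e) * e]mulrBl ee fe subrr subr0 mulrDr
  mulr1 mulrBr ee ef.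
by rewrite addrC subrK.
Qed.

Lemma conj_same_left e f : e \in S -> f \in S -> e * f = e -> f * e = f ->
  conj e f.
Proof.
move=> Se Sf ef fe; have ee : e * e = e by rewrite -{1}ef -mulrA fe ef.
have ff : f * f = f by rewrite -{1}fe -mulrA ef fe.
have [|uv vu] := @unipotent (f - e).
  by rewrite mulrBl !mulrBr ee ef fe ff !subrr.
exists (1 + (f - e)), (1 - (f - e)); split; rewrite //= ?(rpredB, rpredD,
  subalg1) //.
rewrite [(1 + _) * e]mulrDl mul1r [(f - e) * e]mulrBl ee fe [e + _]addrC subrK
  mulrBr mulr1 mulrBr ff fe.
by rewrite subrr subr0.
Qed.

(* With j = jij + j(1-i)j in the local algebra jSj, either jij is invertible, *)
(* and i, j are linked by an idempotent generating jS and Si, or j is         *)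
(* conjugate to an idempotent orthogonal to i, and can be swapped with i.     *)
Lemma primitive_conj i j g g' : primitive i -> primitive j ->
  g \in S -> g' \in S -> i = g * j * g' -> conj i j.
Proof.
move=> prim_i prim_j Sg Sg' def_i.
have [Si i0 ii] := primitiveW prim_i; have [Sj j0 jj] := primitiveW prim_j.
pose x := i * g * j; pose y := j * g' * i.
have Sx : x \in S by rewrite !SM.
have Sy : y \in S by rewrite !SM.
have xy : x * y = i.
  by rewrite /x /y !mulrA -[_ * j * j]mulrA jj -2![i * _ * _]mulrA -def_i ii.
have [ix xj] : i * x = x /\ x * j = x by rewrite /x !mulrA ii -!mulrA jj.
have [jy yi] : j * y = y /\ y * i = y by rewrite /y !mulrA jj -!mulrA ii.
clearbody x y; have yx : y * x = j.
  have yxyx : y * x * (y * x) = y * x by rewrite mulrA -[y * x * y]mulrA xy yi.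
  have [|||yx0|//] := primitive_sub prim_j _ yxyx; rewrite ?SM ?mulrA ?jy //.
    by rewrite -mulrA xj.
  case/eqP: i0; rewrite -ii -{1}xy -xy mulrA -[x * y * x]mulrA yx0 mulr0.
  by rewrite mul0r.
have def_j : j = \sum_(b : bool) j * (if b then i else 1 - i).
  by rewrite big_bool /= -mulrDr addrC subrK mulr1.
have [|b _ [w Sw [jw wj]]] := primitive_sum prim_j _ def_j.
  by case=> _; rewrite SM ?rpredB ?subalg1.
rewrite mulrA jj; set t := (if b then _ else _) => jtjw wjtj.
have tt : t * t = t.
  by rewrite /t; case: (b); rewrite // mulrBl mul1r mulrBr mulr1 ii subrr subr0.
have St : t \in S by rewrite /t; case: (b); rewrite ?rpredB ?subalg1.
pose h := w * t; have Sh : h \in S by rewrite SM.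
have wtw : w * t * w = w.
  suff -> : w * t * w = w * (j * t * j * w) by rewrite jtjw wj.
  by rewrite !mulrA wj -[w * t * j * w]mulrA jw.
have wtj : w * t * j = j by rewrite -{2}wjtj !mulrA wj.
have cjh : conj j h by apply: conj_same_right; rewrite // /h mulrA jw.
apply: conj_sym; apply: (conj_trans cjh).
have ht : h * t = h by rewrite /h -mulrA tt.
have hh : h * h = h by rewrite /h mulrA wtw.
clearbody h.
pose h2 := t * h; have Sh2 : h2 \in S by rewrite SM.
have th2 : t * h2 = h2 by rewrite /h2 mulrA tt.
have h2t : h2 * t = h2 by rewrite /h2 -mulrA ht.
have chh2 : conj h h2.
  by apply: conj_same_left; rewrite // /h2 ?[h * _]mulrA ?ht -?mulrA hh.
apply: (conj_trans chh2); have cjh2 := conj_trans cjh chh2.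
have [_ h20 h2h2] := primitiveW (conj_primitive cjh2 prim_j).
clearbody h2; clear chh2 cjh hh ht h Sh; move: th2 h2t; rewrite /t.
case: (b) => [ih2 h2i|].
  have [h2_0|<-] := primitive_sub prim_i Sh2 h2h2 ih2 h2i;
    last exact: conj_refl.
  by rewrite h2_0 eqxx in h20.
rewrite mulrBl mulrBr mul1r mulr1.
move=> /(canRL (subrK _))/eqP; rewrite addrC -subr_eq subrr eq_sym => /eqP ih2.
move=> /(canRL (subrK _))/eqP; rewrite addrC -subr_eq subrr eq_sym => /eqP h2i.
have [u [v [Su Sv uv vu def_h2]]] := cjh2.
(* x1 and y1 exchange the orthogonal idempotents i and h2; adding z = 1 - i - h2 gives a
   self-inverse unit that swaps them. *)
pose x1 := x * v; pose y1 := u * y.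
have [Sx1 Sy1] : x1 \in S /\ y1 \in S by rewrite !SM.
have x1y1 : x1 * y1 = i by rewrite /x1 /y1 mulrA -[x * v * u]mulrA vu mulr1.
have y1x1 : y1 * x1 = h2.
  by rewrite /x1 /y1 mulrA -[u * y * x]mulrA yx -def_h2.
have ix1 : i * x1 = x1 by rewrite /x1 mulrA ix.
have y1i : y1 * i = y1 by rewrite /y1 -mulrA yi.
have x1h2 : x1 * h2 = x1 by rewrite -y1x1 mulrA x1y1 ix1.
have h2y1 : h2 * y1 = y1 by rewrite -y1x1 -mulrA x1y1 y1i.
clearbody x1 y1.
have h2x1 : h2 * x1 = 0 by rewrite -ix1 mulrA h2i mul0r.
have x1i : x1 * i = 0 by rewrite -x1h2 -mulrA h2i mulr0.
have y1h2 : y1 * h2 = 0 by rewrite -y1i -mulrA ih2 mulr0.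
have iy1 : i * y1 = 0 by rewrite -h2y1 mulrA ih2 mul0r.
have x1x1 : x1 * x1 = 0 by rewrite -{2}ix1 mulrA x1i mul0r.
have y1y1 : y1 * y1 = 0 by rewrite -{2}h2y1 mulrA y1h2 mul0r.
pose z := 1 - i - h2.
have x1z : x1 * z = 0 by rewrite /z !mulrBr mulr1 x1i x1h2 subr0 subrr.
have y1z : y1 * z = 0 by rewrite /z !mulrBr mulr1 y1i y1h2 subr0 subrr.
have zx1 : z * x1 = 0 by rewrite /z !mulrBl mul1r ix1 h2x1 subr0 subrr.
have zy1 : z * y1 = 0 by rewrite /z !mulrBl mul1r iy1 h2y1 subr0 subrr.
have zi : z * i = 0 by rewrite /z !mulrBl mul1r ii h2i subr0 subrr.
have zh2 : z * h2 = 0 by rewrite /z !mulrBl mul1r ih2 h2h2 subr0 subrr.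
have zz : z * z = z by rewrite {2}/z !mulrBr mulr1 zi zh2 !subr0.
have Sz : z \in S by rewrite !rpredB ?subalg1.
have def_z : z = 1 - i - h2 by []; clearbody z.
have ss : (x1 + y1 + z) * (x1 + y1 + z) = 1.
  rewrite !mulrDl !mulrDr x1x1 x1y1 x1z y1x1 y1y1 y1z zx1 zy1 zz !add0r !addr0.
  by rewrite def_z -addrA [h2 + _]addrC subrK addrC subrK.
apply: conj_sym; exists (x1 + y1 + z), (x1 + y1 + z); split;
  rewrite //= ?rpredD //.
rewrite ![(_ + _) * i]mulrDl x1i y1i zi add0r addr0 !mulrDr y1x1 y1y1 y1z.
by rewrite !addr0.
Qed.

(** Induction on the dimension of gB, which drops when g splits into two nonzero orthogonal
    idempotents. *)
Lemma primitive_decomposition g : g \in S -> g * g = g ->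
  exists n (F : 'I_n -> B), g = \sum_t F t /\
    forall t, [/\ primitive (F t), g * F t = F t & F t * g = F t].
Proof.
have [d] := ubnP (\dim (lmul g @: fullv)); elim: d g => // d IH g le_d Sg gg.
have [g0|g0] := eqVneq g 0.
  by exists 0, (fun=> 0); rewrite big_ord0; split=> // -[].
have [prim|nprim] := pselect (primitive g).
  by exists 1, (fun=> g); rewrite big_ord1.
have [e [f [Se Sf ee ff [[ef fe sum] [e0 f0]]]]] : exists e f, [/\ e \in S,
  f \in S,
    e * e = e, f * f = f & [/\ e * f = 0, f * e = 0 & g = e + f] /\ (e != 0 /\
      f != 0)].
  apply: contrapT => no; case: nprim; split=> // e f Se Sf ee ff ef fe sum.
  have [->|e0] := eqVneq e 0; first by left.
  have [->|f0] := eqVneq f 0; first by right.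
  by case: no; exists e, f.
have lt e1 f1 : e1 * e1 = e1 -> f1 * f1 = f1 -> e1 * f1 = 0 -> f1 != 0 ->
    g = e1 + f1 -> f1 * e1 = 0 -> (\dim (lmul e1 @: fullv) < d)%N.
  move=> ee1 ff1 ef1 f10 sum1 fe1; apply: leq_trans (ltnSE le_d).
  rewrite ltnNge; apply: contra f10 => le.
  have /eqP eq : (lmul e1 @: fullv == lmul g @: fullv)%VS.
    rewrite eqEdim le andbT; apply/subvP => _ /memv_imgP[x _ ->].
    have -> : lmul e1 x = lmul g (lmul e1 x).
      by rewrite !lmulE mulrA sum1 mulrDl ee1 fe1 addr0.
    by rewrite memv_img ?memvf.
  have : lmul g f1 \in (lmul e1 @: fullv)%VS by rewrite eq memv_img ?memvf.
  rewrite lmulE sum1 mulrDl ef1 ff1 add0r => /memv_imgP[x _].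
  by rewrite lmulE => def_f; rewrite -ff1 {2}def_f mulrA fe1 mul0r.
have [n1 [F1 [sum1 F1P]]] := IH e (lt e f ee ff ef f0 sum fe) Se ee.
rewrite addrC in sum.
have [n2 [F2 [sum2 F2P]]] := IH f (lt f e ff ee fe e0 sum ef) Sf ff.
exists (n1 + n2)%N, (fun t => match split t with inl t1 => F1 t1 | inr t2 =>
  F2 t2 end).
split.
  rewrite big_split_ord sum addrC /= {1}sum1 {1}sum2; congr (_ + _);
    apply: eq_bigr => t _.
    by rewrite (unsplitK (inl t)).
  by rewrite (unsplitK (inr t)).
have ge : g * e = e by rewrite sum mulrDl fe ee add0r.
have eg : e * g = e by rewrite sum mulrDr ef ee add0r.
have gf : g * f = f by rewrite sum mulrDl ef ff addr0.
have fg : f * g = f by rewrite sum mulrDr fe ff addr0.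
move=> t; case: (split t) => t'.
  have [prim l r] := F1P t'.
  by split; rewrite //; [rewrite -{1}l mulrA ge | rewrite -{1}r -mulrA eg].
have [prim l r] := F2P t'; split; rewrite //.
  by rewrite -{1}l mulrA gf.
by rewrite -{1}r -mulrA fg.
Qed.

End Idempotents.

(** * Relative traces *)

(** Multiplicativity is restricted to K so as to cover [ext_act], for which it is available on
    N_G(Q) only. *)
Definition linear_action (k : fieldType) (gT : finGroupType) (V : vectType k)
    (K : {set gT}) (act : gT -> 'End(V)) : Prop :=
  (forall v, act 1%g v = v) /\
  (forall x y v, x \in K -> y \in K -> act (x * y)%g v = act x (act y v)).

Section ActionTraces.

Variables (k : fieldType) (gT : finGroupType) (V : vectType k).
Variables (K : {group gT}) (act : gT -> 'End(V)).
Hypothesis actK : linear_action K act.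
Implicit Types (D L M P R : {group gT}) (W : {vspace V}).

Let act1 v : act 1%g v = v.
Proof. by case: actK. Qed.
Let actM x y v : x \in K -> y \in K -> act (x * y)%g v = act x (act y v).
Proof. by case: actK => _; apply. Qed.

Lemma fixedE (L : {set gT}) v x : v \in fixed act L -> x \in L -> act x v = v.
Proof. by move/fixedP; apply. Qed.

Lemma fixedS (L M : {set gT}) : L \subset M -> (fixed act M <= fixed act L)%VS.
Proof.
move=> sLM; apply/subvP => v /fixedP fix_v; apply/fixedP => x Lx.
by rewrite fix_v ?(subsetP sLM).
Qed.

Lemma act_repr_lcoset D v x : D \subset K -> v \in fixed act D -> x \in K ->
  act (repr (x *: D)%g) v = act x v.
Proof.
move=> sDK fix_v Kx; have : repr (x *: D)%g \in (x *: D)%g.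
  by apply: mem_repr (lcoset_refl D x).
by case/lcosetP => y Dy ->; rewrite actM ?(fixedE fix_v Dy) // (subsetP sDK).
Qed.

Lemma fixed_act D v x : x \in K -> D \subset K -> v \in fixed act D ->
  act x v \in fixed act (D :^ x^-1)%g.
Proof.
move=> Kx sDK fix_v; apply/fixedP => y; rewrite mem_conjgV => Dyx.
have Kyx := subsetP sDK _ Dyx.
have Ky : y \in K by rewrite -(groupJr _ Kx).
by rewrite -actM // conjgC actM // (fixedE fix_v Dyx).
Qed.

Section OrbitSum.

Variables (T : finType) (S : {set T}) (P : {group gT}) (op : gT -> T -> T).
Variable F : T -> V.
Hypothesis sPK : P \subset K.
Hypothesis op1 : forall t, t \in S -> op 1%g t = t.
Hypothesis opM : forall x y t, x \in P -> y \in P -> t \in S ->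
  op (x * y)%g t = op x (op y t).
Hypothesis opS : forall x t, x \in P -> t \in S -> op x t \in S.
Hypothesis opF : forall x t, x \in P -> t \in S -> act x (F t) = F (op x t).

Definition stab_of t : {set gT} := [set x in P | op x t == t].

Lemma stab_of_group t : t \in S -> group_set (stab_of t).
Proof.
move=> St; apply/group_setP; split=> [|x y].
  by rewrite inE group1 op1 ?eqxx.
rewrite !inE => /andP[Px /eqP xt] /andP[Py /eqP yt].
by rewrite groupM //= opM // yt xt.
Qed.

Lemma orbit_sum t0 : t0 \in S ->
  \sum_(t in [set op x t0 | x in P]) F t = rtrace act (stab_of t0) P (F t0).
Proof.
move=> St0; pose R := Group (stab_of_group St0).
have sRP : R \subset P by apply/subsetP => x; rewrite inE => /andP[].
have opR x : x \in P -> op (repr (x *: R)%g) t0 = op x t0.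
  move=> Px; have : repr (x *: R)%g \in (x *: R)%g.
    by apply: mem_repr (lcoset_refl R x).
  case/lcosetP => y; rewrite inE => /andP[Py /eqP yt] ->.
  by rewrite opM // yt.
rewrite -[stab_of t0]/(R : {set gT}) rtraceE.
have -> : [set op x t0 | x in P] = [set op (repr X) t0 | X in lcosets R P].
  apply/setP => t; apply/imsetP/imsetP =>
    [[x Px ->] | [X /(repr_lcosets sRP) PX ->]].
    by exists (x *: R)%g; [apply/lcosetsP; exists x | rewrite opR].
  by exists (repr X).
rewrite big_imset /= => [|X Y /lcosetsP[x Px ->] /lcosetsP[y Py ->]].
  by apply: eq_bigr => X /(repr_lcosets sRP) PX; rewrite opF.
rewrite !opR // => eq_op; apply: (lcoset_eqP (G := R)); rewrite mem_lcoset inE.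
by rewrite groupM ?groupV //= opM ?groupV // eq_op -opM ?groupV // mulVg op1.
Qed.

(** The terms over one orbit add up to a trace from a stabiliser. Mackey's formula and all arguments
    with permutation bases below rest on this. *)
Lemma orbit_sum_mem W :
    (forall t, t \in S -> rtrace act (stab_of t) P (F t) \in W) ->
  \sum_(t in S) F t \in W.
Proof.
move=> WF; pose orb t := [set op x t | x in P].
rewrite (partition_big orb (mem (orb @: S))) /=; last by move=> t;
  apply: imset_f.
apply: rpred_sum => _ /imsetP[t0 St0 ->].
rewrite (_ : \sum_(t in S | _) F t = rtrace act (stab_of t0) P (F t0)) ?WF //.
rewrite -orbit_sum //; apply: eq_bigl => t; apply/andP/imsetP =>
  [[St /eqP eq_o]|[x Px ->]].
  have : t \in orb t by apply/imsetP; exists 1%g; rewrite ?op1.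
  by rewrite eq_o => /imsetP.
split; [exact: opS | apply/eqP/setP => s].
apply/imsetP/imsetP => -[y Py ->].
  by exists (y * x)%g; rewrite ?groupM ?opM.
exists (y * x^-1)%g; first by rewrite groupM ?groupV.
by rewrite -opM ?groupM ?groupV // mulgKV.
Qed.

End OrbitSum.

Lemma rtrace_fixed R P v : R \subset P -> P \subset K -> v \in fixed act R ->
  rtrace act R P v \in fixed act P.
Proof.
move=> sRP sPK fix_v; apply/fixedP => x Px.
have sRK := subset_trans sRP sPK; have Kx := subsetP sPK x Px.
rewrite rtraceE linear_sum /=.
rewrite [RHS](reindex_inj (can_inj (lcosetK x))) /=.
apply: eq_big => [X|X /lcosetsP[y Py ->]]; last first.
  have Ky := subsetP sPK y Py.
  by rewrite -lcosetM !act_repr_lcoset ?groupM // actM.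
apply/lcosetsP/lcosetsP => -[y Py def_X].
  by exists (x * y)%g; rewrite ?groupM // def_X lcosetM.
exists (x^-1 * y)%g; first by rewrite groupM ?groupV.
by rewrite lcosetM -def_X lcosetK.
Qed.

Lemma traces_fixed R P : R \subset P -> P \subset K ->
  (traces act R P <= fixed act P)%VS.
Proof.
by move=> sRP sPK; apply/subvP => _ /memv_imgP[v fv ->]; apply: rtrace_fixed.
Qed.

Lemma rtrace_in R P v : v \in fixed act R ->
  rtrace act R P v \in traces act R P.
Proof. exact: memv_img. Qed.

(* S is a union of (M, D)-double cosets in L. *)
Lemma mackey_mem D L M W (S : {set {set gT}}) v :
    D \subset L -> L \subset K -> M \subset L -> v \in fixed act D ->
    S \subset lcosets D L ->
    (forall x X, x \in M -> X \in S -> (x *: X)%g \in S) ->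
    (forall y, y \in L -> (y *: D)%g \in S ->
       rtrace act (M :&: D :^ y^-1)%g M (act y v) \in W) ->
  \sum_(X in S) act (repr X) v \in W.
Proof.
move=> sDL sLK sML fix_v sS MS WS; have sDK := subset_trans sDL sLK.
apply: (@orbit_sum_mem _ S M (fun x X => x *: X)%g) => //.
- by move=> X _; rewrite mul1g.
- by move=> x y X _ _ _; rewrite lcosetM.
- move=> x X Mx /(subsetP sS)/lcosetsP[y Ly ->].
  have Lx := subsetP sML x Mx.
  by rewrite -lcosetM !act_repr_lcoset ?groupM ?(subsetP sLK) // actM ?(subsetP
    sLK).
move=> X SX; have /lcosetsP[y Ly def_X] := subsetP sS X SX.
rewrite def_X act_repr_lcoset ?(subsetP sLK) //.
rewrite (_ : stab_of _ _ _ = M :&: D :^ y^-1)%g; first by apply: WS;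
  rewrite -?def_X.
apply/setP => x; rewrite !inE; congr (_ && _).
rewrite mem_conjgV -lcosetM; apply/eqP/idP => [eq_c | Dxy].
  have : (x * y)%g \in (y *: D)%g by rewrite -eq_c lcoset_refl.
  by rewrite mem_lcoset.
by apply/lcoset_eqP; rewrite mem_lcoset.
Qed.

(** Mackey's formula as a membership criterion; [D :^ y^-1] is y D y^-1. *)
Lemma rtrace_mackey D L M W v :
    D \subset L -> L \subset K -> M \subset L -> v \in fixed act D ->
    (forall y, y \in L -> rtrace act (M :&: D :^ y^-1)%g M (act y v) \in W) ->
  rtrace act D L v \in W.
Proof.
move=> sDL sLK sML fix_v WL; rewrite rtraceE.
apply: (mackey_mem sDL sLK sML fix_v) => // [x X Mx /lcosetsP[y Ly ->]|y Ly _].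
  apply/lcosetsP; exists (x * y)%g; rewrite ?lcosetM //.
  by rewrite groupM // (subsetP sML).
exact: WL.
Qed.

Lemma rtrace_conj D L v x : D \subset L -> L \subset K -> v \in fixed act D ->
  x \in L -> rtrace act D L v = rtrace act (D :^ x^-1)%g L (act x v).
Proof.
move=> sDL sLK fix_v Lx; have sDK := subset_trans sDL sLK.
have Kx := subsetP sLK x Lx.
rewrite !rtraceE; pose h (X : {set gT}) := (X :* x^-1)%g.
have h_inj : injective h by apply: can_inj (rcosetK _).
have hE y : h (y *: D)%g = ((y * x^-1) *: (D :^ x^-1))%g.
  by rewrite /h conjsgE invgK -lcosetM mulgKV mulgA.
have -> : lcosets (D :^ x^-1) L = h @: lcosets D L.
  apply/setP => X; apply/lcosetsP/imsetP =>
    [[y Ly ->]|[_ /lcosetsP[y Ly ->] ->]].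
    exists (y * x *: D)%g; first by apply/lcosetsP; exists (y * x)%g;
      rewrite ?groupM.
    by rewrite hE mulgK.
  by exists (y * x^-1)%g; rewrite ?hE // groupM ?groupV.
rewrite [RHS]big_imset /=; last by move=> X Y _ _; apply: h_inj.
apply: eq_bigr => _ /lcosetsP[y Ly ->]; have Ky := subsetP sLK y Ly.
have DxK : (D :^ x^-1 \subset K)%g by rewrite -(conjGid (groupVr Kx)) conjSg.
rewrite hE !(act_repr_lcoset (D := (D :^ x^-1)%G)) ?groupM ?groupV //.
- by rewrite act_repr_lcoset // -actM ?groupM ?groupV // mulgKV.
- exact: fixed_act.
Qed.

Lemma traces_conj D L x : D \subset L -> L \subset K -> x \in L ->
  traces act (D :^ x^-1)%g L = traces act D L.
Proof.
move=> sDL sLK Lx; have sDK := subset_trans sDL sLK; have Kx :=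
  subsetP sLK x Lx.
have sDxL : (D :^ x^-1)%g \subset L by rewrite -(conjGid (groupVr Lx)) conjSg.
have sub (E : {group gT}) y : E \subset L -> y \in L -> (traces act E L <=
  traces act (E :^ y^-1)%g L)%VS.
  move=> sEL Ly; apply/subvP => _ /memv_imgP[v fv ->].
  rewrite (rtrace_conj (x := y)) // memv_img // fixed_act ?(subsetP sLK) //.
  exact: subset_trans sEL sLK.
apply/eqP; rewrite eqEsubv (sub D x) // andbT.
have := sub (D :^ x^-1)%G x^-1%g sDxL; rewrite groupV /= => /(_ Lx).
by rewrite invgK -conjsgM mulVg conjsg1.
Qed.

Lemma rtrace_trans R (S : {group gT}) P v : R \subset S -> S \subset P ->
  P \subset K ->
  v \in fixed act R -> rtrace act S P (rtrace act R S v) = rtrace act R P v.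
Proof.
move=> sRS sSP sPK fv; have sRP := subset_trans sRS sSP.
have sSK := subset_trans sSP sPK; have sRK := subset_trans sRS sSK.
rewrite !rtraceE [RHS](partition_big (fun X => X * S)%g (mem (lcosets S P))) /=.
  apply: eq_bigr => Y PY; have Py := repr_lcosets sSP PY.
  have [y Py' def_Y] := lcosetsP PY.
  have def_Y' : Y = (repr Y *: S)%g.
    have : repr Y \in (y *: S)%g by rewrite def_Y;
      apply: mem_repr (lcoset_refl S y).
    by move/lcoset_eqP=> ->.
  pose h (X : {set gT}) := (repr Y *: X)%g.
  have h_inj : injective h by apply: can_inj (lcosetK _).
  transitivity (\sum_(X in h @: lcosets R S) act (repr X) v).
    rewrite [RHS]big_imset /=; last by move=> X1 X2 _ _; apply: h_inj.
    rewrite linear_sum /=; apply: eq_bigr => _ /lcosetsP[x Sx ->].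
    have Kx := subsetP sSK x Sx; have Ky := subsetP sPK _ Py.
    by rewrite /h -lcosetM !act_repr_lcoset ?groupM // actM.
  apply: eq_bigl => X; apply/imsetP/andP => [[_ /lcosetsP[x Sx ->] ->]|].
    split; last by apply/eqP; rewrite /h -lcosetM -!mulgA mulSGid // lcosetM
      lcoset_id.
    apply/lcosetsP; exists (repr Y * x)%g; last by rewrite lcosetM.
    exact: groupM Py (subsetP sSP _ Sx).
  case=> /lcosetsP[x Px ->] /eqP eqY.
  have : x \in Y by rewrite -eqY -{1}[x]mulg1 mem_mulg // lcoset_refl.
  rewrite def_Y' mem_lcoset => Syx; exists ((repr Y)^-1 * x *: R)%g.
    by apply/lcosetsP; exists ((repr Y)^-1 * x)%g.
  by rewrite /h -lcosetM mulKVg.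
move=> _ /lcosetsP[x Px ->]; apply/lcosetsP; exists x => //.
by rewrite -mulgA mulSGid.
Qed.

Lemma traces_brauer_ker R P : R \proper P -> (traces act R P <=
  brauer_ker act P)%VS.
Proof. by move=> prRP; apply: (sumv_sup R). Qed.

Lemma brauer_ker_sub P W :
  (forall R, R \proper P -> (traces act R P <= W)%VS) ->
    (brauer_ker act P <= W)%VS.
Proof. by move=> sW; apply/subv_sumP => R; apply: sW. Qed.

Lemma rtrace_norm R P v x : R \subset P -> P \subset K -> x \in K ->
  x \in 'N(P)%g ->
  v \in fixed act R -> act x (rtrace act R P v) =
    rtrace act (R :^ x^-1)%g P (act x v).
Proof.
move=> sRP sPK Kx Nx fv; have sRK := subset_trans sRP sPK.
rewrite !rtraceE linear_sum; pose h (X : {set gT}) := (X :^ x^-1)%g.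
have h_inj : injective h by apply: conjsg_inj.
have Nx' : x^-1%g \in 'N(P)%g by rewrite groupV.
have hE y : h (y *: R)%g = ((y ^ x^-1) *: (R :^ x^-1))%g.
  by rewrite /h conjsMg conjg_set1.
have -> : lcosets (R :^ x^-1) P = h @: lcosets R P.
  apply/setP => X; apply/lcosetsP/imsetP =>
    [[y Py ->]|[_ /lcosetsP[y Py ->] ->]].
    exists ((y ^ x) *: R)%g; last by rewrite hE conjgK.
    by apply/lcosetsP; exists (y ^ x)%g; rewrite ?memJ_norm.
  by exists (y ^ x^-1)%g; rewrite ?hE // memJ_norm.
rewrite [RHS]big_imset /=; last by move=> X Y _ _; apply: h_inj.
apply: eq_bigr => _ /lcosetsP[y Py ->]; have Ky := subsetP sPK y Py.
have RxK : (R :^ x^-1 \subset K)%g by rewrite -(conjGid (groupVr Kx)) conjSg.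
rewrite hE (act_repr_lcoset (D := (R :^ x^-1)%G)) ?groupJ ?groupV //.
  rewrite act_repr_lcoset // -!actM ?groupJ ?groupM ?groupV //.
  by rewrite conjgE invgK -mulgA mulgKV.
exact: fixed_act.
Qed.

Lemma brauer_ker_norm P v x : P \subset K -> x \in K -> x \in 'N(P)%g ->
  v \in brauer_ker act P -> act x v \in brauer_ker act P.
Proof.
move=> sPK Kx Nx /memv_sumP[F FW ->]; rewrite linear_sum /=; apply: rpred_sum =>
  R prRP.
have sRP := proper_sub prRP; have sRK := subset_trans sRP sPK.
have /memv_imgP[w fw ->] := FW R prRP; rewrite rtrace_norm //.
have prRxP : (R :^ x^-1)%G \proper P.
  by rewrite -(normP (groupVr Nx)) properE !conjSg -properE.
by apply: (subvP (traces_brauer_ker prRxP)); apply: rtrace_in; apply: fixed_act.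
Qed.

(* Q permutes the cosets xD outside N(Q) without fixed points, so that their  *)
(* orbits contribute proper traces.                                           *)
Lemma brauer_rtrace D L (Q : {group gT}) v :
    D \subset L -> L \subset K -> Q \subset D -> D \subset 'N(Q)%g ->
    (forall x, x \in L -> Q \subset (D :^ x)%g -> x \in 'N(Q)%g) ->
    v \in fixed act D ->
  rtrace act D L v - rtrace act D (L :&: 'N(Q))%g v \in brauer_ker act Q.
Proof.
move=> sDL sLK sQD sDN DN fv; rewrite !rtraceE.
have sDLN : D \subset (L :&: 'N(Q))%g by rewrite subsetI sDL.
rewrite (bigID (mem (lcosets D (L :&: 'N(Q))%g))) /=.
have inLN X : (X \in lcosets D L) && (X \in lcosets D (L :&: 'N(Q))%g) =
    (X \in lcosets D (L :&: 'N(Q))%g).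
  rewrite andb_idl // => /lcosetsP[x /setIP[Lx _] ->].
  by apply/lcosetsP; exists x.
rewrite (eq_bigl _ _ inLN) addrAC subrr add0r.
pose S := lcosets D L :\: lcosets D (L :&: 'N(Q))%g.
rewrite (eq_bigl (fun X => X \in S)) => [|X]; last by rewrite in_setD andbC.
have sQL := subset_trans sQD sDL; have nQQ : Q \subset 'N(Q)%g := normG Q.
apply: (mackey_mem (D := D) (L := L) (M := Q)) => //; first exact: subsetDl.
  move=> x X Qx /setDP[/lcosetsP[y Ly def_X] nX]; apply/setDP; split.
    apply/lcosetsP; exists (x * y)%g; last by rewrite def_X lcosetM.
    exact: groupM (subsetP sQL x Qx) Ly.
  apply: contra nX => /lcosetsP[z /setIP[Lz Nz] def_xX].
  have Lx := subsetP sQL x Qx; have Nx := subsetP nQQ x Qx.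
  apply/lcosetsP; exists (x^-1 * z)%g; first by rewrite inE !groupM ?groupV.
  by rewrite lcosetM -def_xX lcosetK.
move=> y Ly /setDP[_ nX].
have pr : ((Q :&: D :^ y^-1)%G \proper Q)%g.
  rewrite properE subsetIl subsetI subxx /=; apply: contra nX => sQDy.
  have Ny := DN y^-1%g (groupVr Ly) sQDy.
  by apply/lcosetsP; exists y; rewrite // inE Ly -groupV.
apply: (subvP (traces_brauer_ker pr)); apply: rtrace_in.
apply: (subvP (fixedS (subsetIr _ _))); apply: fixed_act => //.
  exact: (subsetP sLK).
exact: subset_trans sDL sLK.
Qed.

End ActionTraces.

(** Some summand b of i has i b i invertible in the local algebra iSi, and then the ideal that
    contains b contains i. *)
Lemma rosenberg (k : fieldType) (B : fdalgType k) (S : subalgebra B)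
    (I : finType) (P : pred I) (W : I -> {vspace B}) (i : B) :
    primitive_idempotent [set` S]%classic i ->
    (forall t, P t -> (W t <= S)%VS) ->
    (forall t a b, P t -> a \in S -> b \in W t -> a * b \in W t /\
      b * a \in W t) ->
    i \in (\sum_(t | P t) W t)%VS ->
  exists2 t, P t & i \in W t.
Proof.
move=> prim sWS idW /memv_sumP[F WF def_i].
have [Si i0 ii] := primitiveW prim.
have [|t Pt [b Sb [_ _ tb _]]] := primitive_sum prim _ def_i.
  by move=> t Pt; apply: (subvP (sWS t Pt)); apply: WF.
exists t => //; rewrite -tb; apply: (idW t b _ Pt Sb _).2.
apply: (idW t i _ Pt Si _).2; apply: (idW t i _ Pt Si _).1; exact: WF.
Qed.

(** * Trace ideals and defect groups in algebras with a group action *)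

Definition algebra_action (k : fieldType) (gT : finGroupType) (B : fdalgType k)
    (K : {set gT}) (act : gT -> 'End(B)) : Prop :=
  [/\ linear_action K act, forall x a b, x \in K -> act x (a * b) =
    act x a * act x b &
      forall x, x \in K -> act x 1 = 1].

Lemma galgebra_action (k : fieldType) (gT : finGroupType) (B : fdalgType k)
  (act : galgebra gT B) (K : {set gT}) : algebra_action K act.
Proof.
split=> [|x a b _|x _]; [|exact: Defs.gactM|exact: Defs.gact1].
by split=> [|x y v _ _]; [exact: gact_id|exact: gact_mulg].
Qed.

Section AlgebraActions.

Variables (k : fieldType) (gT : finGroupType) (B : fdalgType k).
Variables (K : {group gT}) (act : gT -> 'End(B)).
Hypothesis actK : algebra_action K act.
Implicit Types (D L M P R : {group gT}) (a b i j : B).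

Let linK : linear_action K act. Proof. by case: actK. Qed.

Lemma fixedM (L : {set gT}) : L \subset K ->
  {in fixed act L &, forall a b, a * b \in fixed act L}.
Proof.
have [_ actM _] := actK.
move=> sLK a b /fixedP fa /fixedP fb; apply/fixedP => x Lx.
by rewrite actM ?fa ?fb // (subsetP sLK).
Qed.

Lemma fixed1 (L : {set gT}) : L \subset K -> 1 \in fixed act L.
Proof.
have [_ _ act1] := actK.
by move=> sLK; apply/fixedP => x Lx; rewrite act1 ?(subsetP sLK).
Qed.

Definition fixed_subalgebra (L : {set gT}) (sLK : L \subset K) : subalgebra B :=
  Subalgebra (fixed1 sLK) (fixedM sLK).

Lemma rtraceMr R P a b : R \subset P -> P \subset K -> b \in fixed act P ->
  rtrace act R P a * b = rtrace act R P (a * b).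
Proof.
have [_ actM _] := actK.
move=> sRP sPK /fixedP fb; rewrite !rtraceE mulr_suml.
apply: eq_bigr => X /(repr_lcosets sRP) PX.
by rewrite actM ?(subsetP sPK) // fb.
Qed.

Lemma rtraceMl R P a b : R \subset P -> P \subset K -> b \in fixed act P ->
  b * rtrace act R P a = rtrace act R P (b * a).
Proof.
have [_ actM _] := actK.
move=> sRP sPK /fixedP fb; rewrite !rtraceE mulr_sumr.
apply: eq_bigr => X /(repr_lcosets sRP) PX.
by rewrite actM ?(subsetP sPK) // fb.
Qed.

Lemma traces_ideal R P a b : R \subset P -> P \subset K -> a \in fixed act P ->
  b \in traces act R P -> a * b \in traces act R P /\ b * a \in traces act R P.
Proof.
move=> sRP sPK fa /memv_imgP[c fc ->].
rewrite rtraceMl // rtraceMr //.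
have fa' := subvP (fixedS act sRP) a fa.
by split; apply: rtrace_in; apply: fixedM; rewrite // (subset_trans sRP).
Qed.

Lemma brauer_ker_ideal P a b : P \subset K -> a \in fixed act P ->
  b \in brauer_ker act P -> a * b \in brauer_ker act P /\
    b * a \in brauer_ker act P.
Proof.
move=> sPK fa /memv_sumP[F kF ->]; rewrite mulr_sumr mulr_suml.
by split; apply: rpred_sum => R prRP;
  apply: (subvP (traces_brauer_ker act prRP));
   case: (traces_ideal (proper_sub prRP) sPK fa (kF R prRP)).
Qed.

(** Every term of Mackey's formula is a trace from the proper subgroup M :&: y D y^-1 of M. *)
Lemma traces_not_conj D L M a : D \subset L -> L \subset K -> M \subset L ->
    (forall y, y \in L -> ~~ (M \subset D :^ y^-1)%g) ->
  a \in traces act D L -> a \in brauer_ker act M.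
Proof.
move=> sDL sLK sML nMD /memv_imgP[b fb ->].
apply: (rtrace_mackey linK sDL sLK sML fb) => y Ly.
apply: (subvP (traces_brauer_ker act (R := (M :&: D :^ y^-1)%G) _)).
  by rewrite properE subsetIl subsetI subxx nMD.
apply: rtrace_in; apply: (subvP (fixedS act (subsetIr _ _))).
apply: (fixed_act linK) => //; first exact: (subsetP sLK).
exact: subset_trans sDL sLK.
Qed.

Lemma traces_not_conj_sub D L M a : D \subset L -> L \subset K -> M \subset L ->
  a \in traces act D L -> a \notin brauer_ker act M ->
  exists2 y, y \in L & (M \subset D :^ y)%g.
Proof.
move=> sDL sLK sML Da; apply: contraNP => no.
apply: traces_not_conj Da => // y Ly; apply/negP => sMD.
by apply: no; exists y^-1%g; rewrite ?groupV.
Qed.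

Lemma traces_Sylow (p : nat) L P a : p \in [pchar k] -> L \subset K ->
  (p.-Sylow(L) P)%g -> a \in fixed act L -> a \in traces act P L.
Proof.
move=> char_k sLK sylP fa; have sPL := pHall_sub sylP.
have n0 : #|L : P|%g%:R != 0 :> k.
  rewrite -(dvdn_pcharf char_k) -p'natE ?(pcharf_prime char_k) //.
  by case/and3P: sylP.
apply/memv_imgP; exists (#|L : P|%g%:R^-1 *: a).
  by rewrite rpredZ // (subvP (fixedS act sPL)).
have -> : rtrace act P L (#|L : P|%g%:R^-1 *: a) = #|L : P|%g%:R *: (#|L :
  P|%g%:R^-1 *: a).
  rewrite rtraceE (eq_bigr (fun=> #|L : P|%g%:R^-1 *: a)).
    by rewrite sumr_const -scaler_nat card_lcosets.
  move=> X /(repr_lcosets sPL) LX; rewrite linearZ /=.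
  by rewrite (fixedE fa).
by rewrite scalerA divff // scale1r.
Qed.

Lemma minimal_defect_group (p : nat) L i : p \in [pchar k] -> L \subset K ->
    i \in fixed act L ->
  exists D, [/\ D \subset L, (p.-group D)%g, i \in traces act D L &
    forall R, R \subset L -> (p.-group R)%g -> i \in traces act R L ->
      (#|D| <= #|R|)%N].
Proof.
move=> char_k sLK fi; have [P sylP] := Sylow_exists p L.
pose ok (D : {group gT}) := [&& D \subset L, (p.-group D)%g &
  i \in traces act D L].
have okP : ok P by rewrite /ok (pHall_sub sylP) (pHall_pgroup sylP)
  (traces_Sylow char_k).
case: (arg_minnP (fun D : {group gT} => #|D|) okP) => D /and3P[sDL pD iD] minD.
by exists D; split=> // R sRL pR iR; apply: minD; apply/and3P.
Qed.

(* By Rosenberg's lemma, since Tr_D^L(a Tr_R^D(b)) = Tr_R^L(ab) for a in B^D. *)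
Lemma minimal_brauer (p : nat) L D i : D \subset L -> L \subset K ->
  (p.-group D)%g ->
    primitive_idempotent [set` fixed act L]%classic i ->
    i \in traces act D L ->
    (forall R, R \subset L -> (p.-group R)%g -> i \in traces act R L ->
      (#|D| <= #|R|)%N) ->
  i \notin brauer_ker act D.
Proof.
move=> sDL sLK pD prim iD minD; apply/negP => iker.
have sDK := subset_trans sDL sLK.
have [Si i0 ii] := @primitiveW _ _ (fixed_subalgebra sLK) _ prim.
have /memv_imgP[a fa def_i] := iD.
have fi : i \in fixed act L by [].
have fiD := subvP (fixedS act sDL) i fi.
have isum : i \in (\sum_(R : {group gT} | R \proper D) traces act R L)%VS.
  have /memv_sumP[F FW sumF] := iker.
  rewrite -{1}ii {1}def_i rtraceMr // sumF mulr_sumr linear_sum /=.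
  apply: memv_sumr => R prRD; have sRD := proper_sub prRD.
  have /memv_imgP[b fb ->] := FW R prRD.
  rewrite rtraceMl // (rtrace_trans linK) //; first apply: rtrace_in.
    by apply: fixedM => //; [exact: subset_trans sRD sDK | apply: (subvP (fixedS
      act sRD))].
  by apply: fixedM => //; [exact: subset_trans sRD sDK | apply: (subvP (fixedS
    act sRD))].
have [||R prRD iR] := @rosenberg _ _ (fixed_subalgebra sLK) _ _ _ _ prim _ _
  isum.
- move=> R prRD; apply: (traces_fixed linK) => //.
  exact: subset_trans (proper_sub prRD) sDL.
- move=> R c b prRD fc; apply: traces_ideal => //.
  exact: subset_trans (proper_sub prRD) sDL.
have sRD := proper_sub prRD.
have := minD R (subset_trans sRD sDL) (pgroupS sRD pD) iR.
by rewrite leqNgt proper_card.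
Qed.

End AlgebraActions.

(** * The augmentation ideal of a p-group *)

Lemma mulrn_dvd_pchar (k : fieldType) (p : nat) (V : lmodType k) (v : V) (n :
  nat) :
  p \in [pchar k] -> (p %| n)%N -> v *+ n = 0.
Proof.
by move=> char_k; rewrite (dvdn_pcharf char_k) -scaler_nat => /eqP ->;
  rewrite scale0r.
Qed.

Lemma expr_sub1_pchar (k : fieldType) (p : nat) (B : fdalgType k) (x : B) :
  p \in [pchar k] -> (x - 1) ^+ p = x ^+ p - 1.
Proof.
move=> char_k; have p_pr := pcharf_prime char_k.
apply/eqP; rewrite eq_sym subr_eq; apply/eqP.
rewrite -{1}[x](subrK 1) exprDn_comm; last exact: commr1.
have -> : p = p.-1.+1 by rewrite prednK ?prime_gt0.
rewrite big_ord_recl big_ord_recr /= !prednK ?prime_gt0 //.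
rewrite /bump /= add1n prednK ?prime_gt0 // bin0 binn !mulr1n subn0 subnn expr0
  !expr1n !mulr1.
rewrite big1 ?add0r // => t _; apply: (mulrn_dvd_pchar _ char_k).
by rewrite prime_dvd_bin //= /bump /= add1n -ltn_predRL.
Qed.

Section Augmentation.

Variables (k : fieldType) (p : nat) (gT : finGroupType) (B : fdalgType k).
Hypothesis char_k : p \in [pchar k].
Variables (Q : {group gT}) (rho : gT -> B).
Hypothesis pQ : (p.-group Q)%g.
Hypothesis rho1 : rho 1%g = 1.
Hypothesis rhoM : {in Q &, {morph rho : x y / (x * y)%g >-> x * y}}.
Variable V : {vspace B}.
Hypothesis rhoV : forall u v, u \in Q -> v \in V -> rho u * v \in V.

Definition augmentation (R : {set gT}) : {vspace B} :=
  (\sum_(u in R) (lmul (rho u - 1) @: V))%VS.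

Lemma augmentation_mem (R : {set gT}) u v :
  u \in R -> v \in V -> (rho u - 1) * v \in augmentation R.
Proof.
move=> Ru Vv; rewrite -lmulE memvE; apply: subv_trans (sumv_sup u Ru (subvv _)).
by rewrite -memvE memv_img.
Qed.

Let rhoX z n : z \in Q -> rho (z ^+ n)%g = rho z ^+ n.
Proof.
by move=> Qz; elim: n => [|n IH]; rewrite ?rho1 // expgS rhoM ?groupX // IH
  exprS.
Qed.

(* Writing R = M<z> with M maximal in R, V = (z - 1)V + W for the z-stable    *)
(* subspace W = augmentation M, hence V = (z - 1)^p V + W = W, because        *)
(* (z - 1)^p = z^p - 1 with z^p in M.                                         *)
Lemma augmentation_eq0 (R : {group gT}) :
  R \subset Q -> (V <= augmentation R)%VS -> V = 0%VS.
Proof.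
have [n] := ubnP #|R|; elim: n R => // n IH R ltRn sRQ sVR.
have [R1|[M maxM _]] := maximal_exists (sub1G R).
  apply/eqP; rewrite -subv0; apply: subv_trans sVR _.
  rewrite /augmentation -R1 big_set1; apply/subvP => _ /memv_imgP[v _ ->].
  by rewrite lmulE rho1 subrr mul0r mem0v.
have pR := pgroupS sRQ pQ.
have nMR := p_maximal_normal pR maxM; have iMR := p_maximal_index pR maxM.
have prMR := maxgroupp maxM; have sMR := proper_sub prMR.
have sMQ := subset_trans sMR sRQ.
apply: (IH M) => //.
  by apply: leq_trans (proper_card prMR) _; rewrite -ltnS.
have [z Rz nMz] : exists2 z, z \in R & z \notin M by apply/subsetPn;
  case/andP: prMR.
have Qz := subsetP sRQ z Rz.
have Mzp : (z ^+ p)%g \in M.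
  have nMz' := subsetP (normal_norm nMR) z Rz.
  apply: coset_idr; first by rewrite groupX.
  rewrite morphX // -iMR -card_quotient ?normal_norm //.
  by apply/eqP; rewrite -order_dvdn order_dvdG // mem_quotient.
have defR : (M * <[z]>)%g = R.
  by apply: mulg_normal_maximal; rewrite ?cycle_subG.
set W := augmentation M.
have zW v : v \in W -> (rho z - 1) * v \in W.
  move=> Wv; rewrite mulrBl mul1r rpredB //.
  have /memv_sumP[F FW ->] := Wv; rewrite mulr_sumr; apply: rpred_sum => u Mu.
  have Qu := subsetP sMQ u Mu.
  have /memv_imgP[w Vw ->] := FW u Mu;
    rewrite lmulE mulrA mulrBr mulr1 -rhoM //.
  have Mzu : (z * u * z^-1)%g \in M.
    by rewrite -{1}(invgK z) -mulgA -conjgE memJ_norm // groupV (subsetP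
      (normal_norm nMR)).
  have -> : (z * u)%g = (z * u * z^-1 * z)%g by rewrite mulgKV.
  rewrite rhoM ?(subsetP sMQ _ Mzu) // -{2}[rho z]mul1r -mulrBl -mulrA.
  by apply: augmentation_mem; rewrite ?rhoV.
have step v : v \in V -> exists2 w, w \in V & v - (rho z - 1) * w \in W.
  move=> Vv; have /memv_sumP[F FV ->] := subvP sVR v Vv.
  apply: (big_ind (fun v => exists2 w, w \in V & v - (rho z - 1) * w \in W)).
  - by exists 0; rewrite ?mem0v // mulr0 subrr mem0v.
  - move=> v1 v2 [w1 Vw1 W1] [w2 Vw2 W2]; exists (w1 + w2);
    first by rewrite rpredD.
    by rewrite mulrDr opprD addrACA rpredD.
  move=> u Ru; have /memv_imgP[w Vw ->] := FV u Ru; rewrite lmulE.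
  move: Ru; rewrite -defR => /mulsgP[m _ Mm /cycleP[t ->] ->].
  have Qm := subsetP sMQ m Mm.
  (* Modulo W, the factor m z^t - 1 becomes z^t - 1 = (z - 1)(1 + z + ... + z^(t-1)). *)
  exists ((\sum_(s < t) rho z ^+ s) * w).
    by rewrite mulr_suml; apply: rpred_sum => s _;
      rewrite -rhoX // rhoV ?groupX.
  rewrite mulrA -subrX1 -rhoX // -mulrBl opprB addrA subrK rhoM ?groupX //.
  by rewrite -{2}[rho (z ^+ t)%g]mul1r -mulrBl -mulrA augmentation_mem // rhoV
    ?groupX.
have stepn m v : v \in V -> exists2 w, w \in V & v - (rho z - 1) ^+ m * w \in W.
  elim: m v => [|m IHm] v Vv; first by exists v; rewrite // mul1r subrr mem0v.
  have [w1 Vw1 Ww1] := IHm v Vv; have [w2 Vw2 Ww2] := step w1 Vw1.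
  exists w2 => //; rewrite -(subrK ((rho z - 1) ^+ m * w1) v) -addrA rpredD //.
  rewrite exprSr -mulrA -mulrBr; elim: (m) => [|m' IHm'];
    first by rewrite mul1r.
  by rewrite exprS -mulrA zW.
apply/subvP => v Vv; have [w Vw Ww] := stepn p v Vv.
rewrite -(subrK ((rho z - 1) ^+ p * w) v) rpredD //.
by rewrite (expr_sub1_pchar _ char_k) -rhoX // augmentation_mem.
Qed.

End Augmentation.

(** * The extended Brauer quotient *)

Section ExtendedQuotient.

Variables (k : fieldType) (gT : finGroupType) (A : fdalgType k).
Variables (rho : interior gT A) (Q : {group gT}).

Local Notation AutQ := [subg [Aut Q]].
Local Notation X := (extBrauer rho Q).
Implicit Types (phi psi : AutQ) (a b : A) (R P : {group gT}).

Lemma ext_imap_imapV x : x \in 'N(Q)%g ->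
  ext_imap rho Q x * ext_imap rho Q x^-1%g = 1.
Proof. by move=> Nx; rewrite -ext_imapM ?groupV // mulgV ext_imap1. Qed.

Lemma ext_imap_Vimap x : x \in 'N(Q)%g ->
  ext_imap rho Q x^-1%g * ext_imap rho Q x = 1.
Proof. by move=> Nx; rewrite -ext_imapM ?groupV // mulVg ext_imap1. Qed.

Lemma ext_action : algebra_action 'N(Q)%g (ext_act rho Q).
Proof.
split=> [|x a b Nx|x Nx].
- split=> [v|x y v Nx Ny].
    by rewrite /ext_act conj_actE invg1 !ext_imap1 mul1r mulr1.
  by rewrite /ext_act !conj_actE invMg !ext_imapM ?groupV // !mulrA.
- rewrite /ext_act !conj_actE !mulrA; congr (_ * _ * _).
  by rewrite -[_ * ext_imap rho Q x]mulrA ext_imap_Vimap // mulr1.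
by rewrite /ext_act conj_actE mulr1 ext_imap_imapV.
Qed.

Fact ext_inj_is_linear phi : linear (ext_inj rho phi).
Proof.
move=> t a b; apply: dsumP => psi; rewrite dcoordD dcoordZ !dsumE.
by case: eqP; rewrite ?linearP // scaler0 addr0.
Qed.
HB.instance Definition _ phi :=
  GRing.isLinear.Build k A X _ (ext_inj rho phi) (ext_inj_is_linear phi).

Definition ext_unit (a : A) : X := ext_inj rho (1%g : AutQ) a.
HB.instance Definition _ := GRing.Linear.copy ext_unit (ext_inj rho (1%g :
  AutQ)).

Lemma fixed_Delta1 (R : {set gT}) :
  fixed (biact rho) (Delta (sgval (1%g : AutQ)) R) = fixed (conj_act rho) R.
Proof.
apply/vspaceP => a; apply/ext_fixedP/fixedP => fa u Ru.
  by rewrite conj_actE -{2}(fa u Ru) perm1.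
by rewrite perm1 -conj_actE fa.
Qed.

Lemma ext_fixed1 : ext_fixed rho (1%g : AutQ) = fixed (conj_act rho) Q.
Proof. exact: fixed_Delta1. Qed.

Lemma ext_ker1 : ext_ker rho (1%g : AutQ) = brauer_ker (conj_act rho) Q.
Proof.
apply: eq_bigr => R prRQ; have sRQ := proper_sub prRQ.
have tr a : a \in fixed (conj_act rho) R ->
    rtrace (biact rho) (Delta (sgval (1%g : AutQ)) R) (Delta (sgval (1%g :
      AutQ)) Q) a =
    rtrace (conj_act rho) R Q a.
  move=> fa; rewrite ext_traceE ?fixed_Delta1 // rtraceE.
  by apply: eq_bigr => Y _; rewrite perm1 conj_actE.
rewrite /traces fixed_Delta1; apply/vspaceP => b.
by apply/memv_imgP/memv_imgP => -[a fa ->]; exists a; rewrite // tr.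
Qed.

Lemma ext_unitM a b : a \in fixed (conj_act rho) Q ->
  b \in fixed (conj_act rho) Q ->
  ext_unit (a * b) = ext_unit a * ext_unit b.
Proof. by rewrite -ext_fixed1 => fa fb; rewrite [RHS]ext_injM ?mulg1. Qed.

Lemma ext_unit_eq0 a : a \in fixed (conj_act rho) Q ->
  (ext_unit a == 0) = (a \in brauer_ker (conj_act rho) Q).
Proof.
rewrite -ext_fixed1 -ext_ker1 => fa; rewrite -[RHS](qclass_eq0 _ fa).
apply/eqP/eqP => [a0 | a0].
  have := congr1 (fun x : X => dcoord x (1%g : AutQ)) a0.
  by rewrite !dsumE eqxx.
by apply: dsumP => phi; rewrite !dsumE; case: eqP => // ->.
Qed.

Lemma ext_autP phi psi : (forall u, u \in Q -> sgval phi u = sgval psi u) ->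
  phi = psi.
Proof. by move=> eq_u; apply: val_inj; apply: (@eq_Aut _ Q);
  rewrite ?subgP. Qed.

(** With c_x : u |-> x u x^-1, this is the composite of c_x^-1, then phi, then c_x, as products of
    permutations read from left to right. It indexes the component to which conjugation by x sends
    that of phi. *)
Definition ext_autJ (x : gT) phi : AutQ :=
  ((ext_conj Q x)^-1 * phi * ext_conj Q x)%g.

Lemma ext_conjM x y : x \in 'N(Q)%g -> y \in 'N(Q)%g ->
  ext_conj Q (x * y)%g = (ext_conj Q y * ext_conj Q x)%g.
Proof.
move=> Nx Ny; apply: ext_autP => u Qu.
have Qyu : (y * u * y^-1)%g \in Q.
  by rewrite -{1}(invgK y) -mulgA -conjgE memJ_norm ?groupV.
by rewrite /= permM !ext_conjE ?(groupM Nx Ny) // invMg !mulgA.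
Qed.

Lemma ext_conj1 : ext_conj Q 1%g = 1%g.
Proof.
by apply: ext_autP => u Qu; rewrite ext_conjE ?group1 // perm1 invg1 mulg1
  mul1g.
Qed.

Lemma ext_conjV x : x \in 'N(Q)%g -> ext_conj Q x^-1%g = (ext_conj Q x)^-1%g.
Proof.
move=> Nx; apply/eqP; rewrite eq_sym eq_invg_mul -ext_conjM ?groupV //.
by rewrite mulVg ext_conj1.
Qed.

Lemma ext_autJ_fixed x phi a : x \in 'N(Q)%g -> a \in ext_fixed rho phi ->
  conj_act rho x a \in ext_fixed rho (ext_autJ x phi).
Proof.
move=> Nx fa; apply/ext_fixedP => u Qu.
have Qxu : (x^-1 * u * x)%g \in Q by rewrite -mulgA -conjgE memJ_norm.
have -> : sgval (ext_autJ x phi) u = (x * sgval phi (x^-1 * u * x) * x^-1)%g.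
  rewrite /ext_autJ -ext_conjV // /= !permM.
  by rewrite (ext_conjE (x := x^-1%g)) ?groupV // invgK ext_conjE //
    subg_aut_closed.
have -> : (u^-1 = x * (x^-1 * u * x)^-1 * x^-1)%g.
  by rewrite !invMg invgK !mulgA mulgV mul1g mulgK.
move: Qxu; set v := (x^-1 * u * x)%g => Qv.
rewrite !conj_actE !imapM !mulrA -[_ * rho x^-1%g * rho x]mulrA imapVK mulr1.
rewrite -[_ * rho x^-1%g * rho x]mulrA imapVK mulr1; congr (_ * _).
by rewrite -!mulrA; congr (_ * _); rewrite !mulrA; move/ext_fixedP: fa; apply.
Qed.

Lemma ext_act_inj x phi a : x \in 'N(Q)%g -> a \in ext_fixed rho phi ->
  ext_act rho Q x (ext_inj rho phi a) =
  ext_inj rho (ext_autJ x phi) (conj_act rho x a).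
Proof.
move=> Nx fa; have Nx' : x^-1%g \in 'N(Q)%g by rewrite groupV.
have fx := ext_imap_mem rho Nx; have fx' := ext_imap_mem rho Nx'.
have fxa : rho x * a \in ext_fixed rho (phi * ext_conj Q x)%g.
  apply/ext_fixedP => u Qu; rewrite /= permM.
  have Qpu : sgval phi u \in Q by apply: subg_aut_closed.
  rewrite ext_conjE // !imapM !mulrA -[_ * rho x^-1%g * rho x]mulrA imapVK
    mulr1.
  by rewrite -!mulrA; congr (_ * _); rewrite !mulrA; move/ext_fixedP: fa; apply.
rewrite /ext_act !conj_actE /ext_imap (ext_injM fx fa) (ext_injM fxa fx').
by rewrite ext_conjV // mulgA.
Qed.

Lemma ext_unit_act x a : x \in 'N(Q)%g -> a \in fixed (conj_act rho) Q ->
  ext_act rho Q x (ext_unit a) = ext_unit (conj_act rho x a).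
Proof.
by rewrite -ext_fixed1 => Nx fa; rewrite [LHS]ext_act_inj // /ext_autJ mulg1
  mulVg.
Qed.

Lemma ext_unit_fixed (L : {set gT}) a : L \subset 'N(Q)%g ->
  a \in fixed (conj_act rho) Q -> a \in fixed (conj_act rho) L ->
  ext_unit a \in fixed (ext_act rho Q) L.
Proof.
move=> sLN fQ /fixedP fL; apply/fixedP => x Lx.
by rewrite ext_unit_act ?fL // (subsetP sLN).
Qed.

Lemma ext_unit_rtrace R P a : Q \subset R -> R \subset P -> P \subset 'N(Q)%g ->
  a \in fixed (conj_act rho) R ->
  ext_unit (rtrace (conj_act rho) R P a) =
    rtrace (ext_act rho Q) R P (ext_unit a).
Proof.
move=> sQR sRP sPN fa; rewrite !rtraceE linear_sum.
apply: eq_bigr => Y /(repr_lcosets sRP) PY;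
  rewrite ext_unit_act ?(subsetP sPN) //.
exact: (subvP (fixedS _ sQR)).
Qed.

Lemma ext_sum (x : X) : x = \sum_phi ext_inj rho phi (ext_repr x phi).
Proof.
apply: dsumP => psi.
have -> : dcoord (\sum_phi ext_inj rho phi (ext_repr x phi)) psi =
    \sum_phi dcoord (ext_inj rho phi (ext_repr x phi)) psi.
  by apply: (big_morph (fun y : X => dcoord y psi) (fun f g =>
    dcoordD f g psi)); apply: dsumE.
rewrite (bigD1 psi) //= big1 ?addr0 => [|phi /negPf ne]; last first.
  by rewrite dsumE eq_sym ne.
by rewrite dsumE eqxx ext_reprK.
Qed.

End ExtendedQuotient.

(** * The augmentation ideal of the extended Brauer quotient *)

Section ExtendedAugmentation.

Variables (k : fieldType) (p : nat) (gT : finGroupType) (A : fdalgType k).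
Variables (rho : interior gT A) (Q : {group gT}).
Hypothesis char_k : p \in [pchar k].
Hypothesis pQ : (p.-group Q)%g.

Local Notation AutQ := [subg [Aut Q]].
Local Notation X := (extBrauer rho Q).
Local Notation actX := (ext_act rho Q).
Local Notation rhoX := (ext_imap rho Q).

Definition ext_aug : {vspace X} := augmentation rhoX fullv Q.
Local Notation I := ext_aug.

Let sQN : Q \subset 'N(Q)%g. Proof. exact: normG. Qed.

Lemma ext_augMr (x y : X) : x \in I -> x * y \in I.
Proof.
move=> /memv_sumP[F FW ->]; rewrite mulr_suml; apply: rpred_sum => u Qu.
have /memv_imgP[w _ ->] := FW u Qu; rewrite lmulE -mulrA.
by apply: augmentation_mem; rewrite ?memvf.
Qed.

Lemma ext_augMl (x y : X) : x \in I -> y * x \in I.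
Proof.
move=> /memv_sumP[F FW ->]; rewrite mulr_sumr; apply: rpred_sum => u Qu.
have /memv_imgP[w _ ->] := FW u Qu; rewrite lmulE mulrA; apply: ext_augMr.
rewrite (ext_sum y) mulr_suml; apply: rpred_sum => phi _.
have Nu := subsetP sQN u Qu; have Qpu := subg_aut_closed phi Qu.
have Npu := subsetP sQN _ Qpu.
set a := ext_repr y phi; have fa : a \in ext_fixed rho phi by apply: ext_reprP.
suff eq_mul : ext_inj rho phi a * rhoX u =
  rhoX (sgval phi u) * ext_inj rho phi a.
  rewrite mulrBr mulr1 eq_mul -{2}[ext_inj rho phi a]mul1r -mulrBl.
  by apply: augmentation_mem; rewrite ?memvf.
rewrite !ext_injM ?ext_imap_mem //; congr ext_inj.
  apply: ext_autP => v Qv; rewrite /= !permM !ext_conjE ?subg_aut_closed //.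
  by rewrite !subg_autM ?subg_autV ?groupM ?groupV.
by move/ext_fixedP: fa => /(_ u Qu) {1}<-; rewrite -!mulrA imapVK mulr1.
Qed.

Lemma ext_act_aug u (y : X) : u \in Q -> actX u y - y \in I.
Proof.
move=> Qu; have Nu := subsetP sQN u Qu; rewrite /ext_act conj_actE.
have def : rhoX u * y * rhoX u^-1%g - y =
    (rhoX u - 1) * (y * rhoX u^-1%g) + y * ((rhoX u^-1%g - 1) * 1).
  by rewrite mulr1 mulrBr mulr1 mulrBl mul1r mulrA addrA subrK.
rewrite def rpredD //; first by apply: augmentation_mem; rewrite ?memvf.
by apply: ext_augMl; apply: augmentation_mem; rewrite ?memvf ?groupV.
Qed.

(* Q acts trivially modulo the augmentation ideal, so that Tr_R^Q is          *)
(* multiplication by |Q : R|.                                                 *)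
Lemma traces_ext_aug (R : {group gT}) : R \proper Q ->
  (traces actX R Q <= I)%VS.
Proof.
move=> prRQ; have sRQ := proper_sub prRQ.
apply/subvP => _ /memv_imgP[y _ ->].
have p_dvd : (p %| #|Q : R|%g)%N.
  have := pnat_dvd (dvdn_indexg Q R) pQ.
  move/p_natP => [[|n]].
    by move/eqP; rewrite indexg_eq1 => sQR; case/andP: prRQ => _ /negP.
  by move=> ->; apply: dvdn_exp.
rewrite rtraceE; have -> : \sum_(Y in lcosets R Q) actX (repr Y) y =
    \sum_(Y in lcosets R Q) (actX (repr Y) y - y) + y *+ #|Q : R|%g.
  by rewrite sumrB sumr_const card_lcosets subrK.
rewrite (mulrn_dvd_pchar y char_k p_dvd) addr0; apply: rpred_sum => Y YQ.
by rewrite ext_act_aug // (repr_lcosets sRQ YQ).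
Qed.

Lemma brauer_ker_ext_aug : (brauer_ker actX Q <= I)%VS.
Proof. exact: brauer_ker_sub traces_ext_aug. Qed.

Lemma ext_aug_act x (y : X) : y \in I -> actX x y \in I.
Proof. by move=> Iy; rewrite /ext_act conj_actE ext_augMr // ext_augMl. Qed.

(** Here Xg = Xgg lies in Ig, which is the augmentation ideal of kQ times Xg; since Q is a p-group,
    [augmentation_eq0] forces Xg = 0. *)
Lemma ext_aug_idempotent (g : X) : g * g = g -> g \in I -> g = 0.
Proof.
move=> gg Ig; pose V := (rmul g @: fullv)%VS.
have V0 : V = 0%VS.
  apply: (@augmentation_eq0 _ _ _ _ char_k Q rhoX pQ _ _ _ _ Q).
  - exact: ext_imap1.
  - by move=> u v Qu Qv; rewrite ext_imapM ?(subsetP sQN).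
  - move=> u _ Qu /memv_imgP[v _ ->]; rewrite rmulE mulrA -rmulE.
    by rewrite memv_img ?memvf.
  - by [].
  apply/subvP => _ /memv_imgP[v _ ->]; rewrite rmulE -gg mulrA.
  have /memv_sumP[F FW ->] := ext_augMl v Ig; rewrite mulr_suml.
  apply: rpred_sum => u Qu; have /memv_imgP[w _ ->] := FW u Qu.
  rewrite lmulE -mulrA; apply: augmentation_mem => //.
  by rewrite -rmulE memv_img ?memvf.
have : rmul g 1 \in V by rewrite memv_img ?memvf.
by rewrite V0 memv0 rmulE mul1r => /eqP.
Qed.

Lemma traces_ext_aug_not_sub (D L : {group gT}) : D \subset L ->
  L \subset 'N(Q)%g ->
  Q \subset L -> ~~ (Q \subset D) -> (traces actX D L <= I)%VS.
Proof.
move=> sDL sLN sQL nQD; apply/subvP => y Dy; apply: (subvP brauer_ker_ext_aug).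
apply: (traces_not_conj (ext_action rho Q) sDL sLN sQL _ Dy) => x Lx.
apply: contra nQD => sQDx; rewrite -(conjSg _ _ x^-1%g).
by rewrite (normsP sLN) ?groupV.
Qed.

End ExtendedAugmentation.

(** * Permutation bases *)

Section PermutationBasis.

Variables (k : fieldType) (p : nat) (gT : finGroupType) (V : vectType k).
Hypothesis char_k : p \in [pchar k].
Variables (K : {group gT}) (act : gT -> 'End(V)) (bs : seq V).
Hypothesis actK : linear_action K act.
Hypothesis basis_bs : basis_of {:V} bs.
Hypothesis bs_stable : forall x b, x \in K -> b \in bs -> act x b \in bs.

Local Notation T := 'I_(size bs).
Implicit Types (t s : T) (v : V).

Definition bvec t : V := tnth (in_tuple bs) t.
Definition bcoord t v : k := coord (in_tuple bs) t v.
Definition bperm x t : T := insubd t (index (act x (bvec t)) bs).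

Lemma bvec_mem t : bvec t \in bs.
Proof. exact: mem_tnth. Qed.

Lemma bvecE v : v = \sum_t bcoord t v *: bvec t.
Proof.
rewrite {1}(coord_basis (X := in_tuple bs) basis_bs (memvf v)).
by apply: eq_bigr => t _; rewrite /bvec (tnth_nth 0).
Qed.

Lemma bcoord_vec t s : bcoord t (bvec s) = (t == s)%:R.
Proof.
rewrite /bcoord /bvec (tnth_nth 0) coord_free ?(basis_free basis_bs) //.
by rewrite eq_sym.
Qed.

Lemma bvec_inj : injective bvec.
Proof.
move=> t s eq_v; apply/eqP; have := bcoord_vec t s.
by rewrite -eq_v bcoord_vec eqxx; case: eqP => // _ /eqP; rewrite oner_eq0.
Qed.

Lemma bcoordB t u v : bcoord t (u - v) = bcoord t u - bcoord t v.
Proof. exact: linearB. Qed.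
Lemma bcoordZ t a v : bcoord t (a *: v) = a * bcoord t v.
Proof. exact: linearZ. Qed.
Lemma bcoord_sum t (I : Type) (r : seq I) (P : pred I) (F : I -> V) :
  bcoord t (\sum_(i <- r | P i) F i) = \sum_(i <- r | P i) bcoord t (F i).
Proof. exact: linear_sum. Qed.

Lemma bperm_vec x t : x \in K -> bvec (bperm x t) = act x (bvec t).
Proof.
move=> Kx; have in_bs := bs_stable Kx (bvec_mem t).
rewrite /bvec (tnth_nth 0) /bperm val_insubd index_mem in_bs.
exact: nth_index.
Qed.

Lemma bperm1 t : bperm 1%g t = t.
Proof. by apply: bvec_inj; rewrite bperm_vec ?group1 //; case: actK. Qed.

Lemma bpermM x y t : x \in K -> y \in K -> bperm (x * y)%g t =
  bperm x (bperm y t).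
Proof.
by move=> Kx Ky; apply: bvec_inj; case: actK => _ aM;
  rewrite !bperm_vec ?groupM ?aM.
Qed.

Lemma bpermK x : x \in K -> cancel (bperm x) (bperm x^-1%g).
Proof. by move=> Kx t; rewrite -bpermM ?groupV // mulVg bperm1. Qed.

Lemma bcoord_perm x t v : x \in K -> bcoord (bperm x t) (act x v) = bcoord t v.
Proof.
move=> Kx; rewrite {1}[v]bvecE linear_sum bcoord_sum /= (bigD1 t) //=.
rewrite linearZ /= -bperm_vec // bcoordZ bcoord_vec eqxx mulr1.
rewrite big1 ?addr0 // => s ne_s; rewrite linearZ /= -bperm_vec // bcoordZ
  bcoord_vec.
case: eqP => [eq_b|_]; last by rewrite mulr0.
by case/eqP: ne_s; rewrite -(bpermK Kx s) -eq_b bpermK.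
Qed.

Definition bfixed (P : {set gT}) : {set T} := [set t | [forall x in P,
  bperm x t == t]].

Lemma bfixedP (P : {set gT}) t :
  reflect (forall x, x \in P -> bperm x t = t) (t \in bfixed P).
Proof. by rewrite inE; apply: (iffP forall_inP) => h x Px; apply/eqP/h. Qed.

Variable P : {group gT}.
Hypotheses (sPK : P \subset K) (pP : (p.-group P)%g).

Lemma p_dvd_index (R : {group gT}) : R \proper P -> (p %| #|P : R|%g)%N.
Proof.
move=> prRP; have /p_natP[[|n]] := pnat_dvd (dvdn_indexg P R) pP.
  by move/eqP; rewrite indexg_eq1 => sPR; case/andP: prRP => _ /negP.
by move=> ->; apply: dvdn_exp.
Qed.

(** At a P-fixed index, the |P : R| terms of a trace from R < P share one coordinate, and p divides
    |P : R|. *)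
Lemma bcoord_brauer_ker v t : v \in brauer_ker act P -> t \in bfixed P ->
  bcoord t v = 0.
Proof.
move=> /memv_sumP[F FW ->] /bfixedP tP; rewrite bcoord_sum big1 // => R prRP.
have sRP := proper_sub prRP.
have /memv_imgP[w _ ->] := FW R prRP; rewrite rtraceE bcoord_sum.
rewrite (eq_bigr (fun=> bcoord t w)).
  by rewrite sumr_const card_lcosets (mulrn_dvd_pchar (V :=
    k^o) _ char_k) ?p_dvd_index.
move=> Y /(repr_lcosets sRP) PY.
by rewrite -{1}(tP _ PY) bcoord_perm ?(subsetP sPK).
Qed.

Definition fixed_part v : V := \sum_(t in bfixed P) bcoord t v *: bvec t.

(** The basis vectors not fixed by P form nontrivial orbits on which v has constant coefficients, so
    each orbit contributes a trace from a proper subgroup. *)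
Lemma fixed_partP v : v \in fixed act P ->
  v - fixed_part v \in brauer_ker act P.
Proof.
move=> fv; rewrite {1}[v]bvecE (bigID (mem (bfixed P))) /= /fixed_part addrC
  addrK.
rewrite (eq_bigl (fun t => t \in ~: bfixed P)); last by move=> t;
  rewrite in_setC.
have bfixedJ x t : x \in P -> t \notin bfixed P -> bperm x t \notin bfixed P.
  move=> Px; apply: contra => /bfixedP xt; apply/bfixedP => y Py.
  have Kx := subsetP sPK x Px.
  have := xt (x * y * x^-1)%g; rewrite !groupM ?groupV // => /(_ isT).
  rewrite -bpermM ?groupM ?groupV ?(subsetP sPK) // mulgKV.
  by rewrite bpermM ?(subsetP sPK _ Py) // => /(can_inj (bpermK Kx)).
have opF x t : x \in P -> t \in ~: bfixed P ->
    act x (bcoord t v *: bvec t) = bcoord (bperm x t) v *: bvec (bperm x t).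
  move=> Px _; have Kx := subsetP sPK x Px.
  by rewrite linearZ /= -bperm_vec // -{2}(fixedE fv Px) bcoord_perm.
have op1 t : t \in ~: bfixed P -> bperm 1%g t = t by rewrite bperm1.
have opM x y t : x \in P -> y \in P -> t \in ~: bfixed P ->
    bperm (x * y)%g t = bperm x (bperm y t).
  by move=> Px Py _; rewrite bpermM ?(subsetP sPK).
apply: (@orbit_sum_mem _ _ _ act _ (~: bfixed P) P bperm) => // [x t Px|t St].
  by rewrite !in_setC; apply: bfixedJ.
pose R := Group (stab_of_group op1 opM St).
have prRP : R \proper P.
  rewrite properE; apply/andP; split; first by apply/subsetP => x;
    rewrite inE => /andP[].
  have := St; rewrite in_setC; apply: contra => /subsetP sPR; apply/bfixedP =>
    x Px.
  by have := sPR x Px; rewrite inE => /andP[_ /eqP].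
apply: (subvP (traces_brauer_ker act prRP)); apply: (@rtrace_in _ _ _ _ R).
by apply/fixedP => x; rewrite inE => /andP[Px /eqP xt]; rewrite opF // xt.
Qed.

Lemma brauer_kerP v : v \in fixed act P ->
  reflect (forall t, t \in bfixed P -> bcoord t v = 0) (v \in brauer_ker act P).
Proof.
move=> fv; apply: (iffP idP) => [kv t|v0]; first exact: bcoord_brauer_ker.
have := fixed_partP fv; rewrite /fixed_part big1 ?subr0 // => t Pt.
by rewrite v0 ?scale0r.
Qed.

End PermutationBasis.

(** The kernel is detected by the coordinates at fixed basis vectors, and those fixed by D are fixed
    by P. *)
Lemma brauer_ker_sub_pgroup (k : fieldType) (p : nat) (gT : finGroupType)
    (V : vectType k) (K : {group gT}) (act : gT -> 'End(V)) (bs : seq V)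
    (D P : {group gT}) (v : V) :
    p \in [pchar k] -> linear_action K act -> basis_of {:V} bs ->
    (forall x b, x \in K -> b \in bs -> act x b \in bs) ->
    P \subset D -> D \subset K -> (p.-group D)%g -> v \in fixed act D ->
  v \in brauer_ker act P -> v \in brauer_ker act D.
Proof.
move=> char_k actK basis_bs bs_stable sPD sDK pD fv kv.
have sPK := subset_trans sPD sDK; have pP := pgroupS sPD pD.
apply/(brauer_kerP char_k actK basis_bs bs_stable sDK pD fv) => t /bfixedP tD.
apply: (bcoord_brauer_ker char_k actK basis_bs bs_stable sPK pP kv).
by apply/bfixedP => x Px; rewrite tD ?(subsetP sPD).
Qed.

(** * Freeness of the left action on a permutation basis *)

Section LeftFreeness.

Variables (k : fieldType) (gT : finGroupType) (A : fdalgType k).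
Variable rho : interior gT A.

(** Functions G -> A under left translation model kG (x) A; [induced_eval] is the multiplication map
    onto A. *)
Definition shift_fun (w : gT * gT) (F : {ffun gT -> A}) : {ffun gT -> A} :=
  [ffun x => F (w.1^-1 * x)%g].
Fact shift_fun_is_linear w : linear (shift_fun w).
Proof. by move=> t F F'; apply/ffunP => x; rewrite !ffunE. Qed.
HB.instance Definition _ w := GRing.isLinear.Build k {ffun gT -> A} {ffun gT ->
  A} _
  (shift_fun w) (shift_fun_is_linear w).

Definition induced_eval (F : {ffun gT -> A}) : A := \sum_x rho x * F x.
Fact induced_eval_is_linear : linear induced_eval.
Proof.
move=> t F F'; rewrite /induced_eval scaler_sumr -big_split /=.
by apply: eq_bigr => x _; rewrite !ffunE mulrDr fdalg_scaleAr.
Qed.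
HB.instance Definition _ := GRing.isLinear.Build k {ffun gT -> A} A _
  induced_eval induced_eval_is_linear.

(* h is a kG-linear section of the multiplication map kG (x) A -> A. *)
Lemma projective_section : projective_module (finset.setX [set: gT] 1%g) (biact
  rho) ->
  exists h : A -> gT -> A, (forall u x a, h (rho u * a) x = h a (u^-1 * x)%g) /\
    forall a, \sum_x rho x * h a x = a.
Proof.
move=> proj.
pose a (w : gT * gT) : {linear {ffun gT -> A} -> {ffun gT -> A}} := shift_fun w.
pose a' (w : gT * gT) : {linear A -> A} := biact rho w.
pose f : {linear {ffun gT -> A} -> A} := induced_eval.
pose g : {linear A -> A} := idfun.
pose G1 : {set gT * gT} := finset.setX [set: gT] 1%g.
have ga : group_module G1 a.
  split=> [F|[x1 x2] [y1 y2] F _ _]; apply/ffunP => x;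
    rewrite !ffunE ?invg1 ?mul1g //=.
  by rewrite invMg mulgA.
have ga' : group_module G1 a'.
  split=> [m|[x1 x2] [y1 y2] m _ _]; rewrite /a' /=.
    by rewrite biactE invg1 imap1 mul1r mulr1.
  by rewrite !biactE /= invMg !imapM !mulrA.
have ef : equivariant G1 a a' f.
  move=> [u v] F; rewrite inE => /andP[_ /set1P/= ->].
  rewrite /f /a' /a /= biactE /= invg1 imap1 mulr1 /induced_eval mulr_sumr.
  rewrite (reindex_inj (mulgI u)) /=; apply: eq_bigr => x _.
  by rewrite ffunE mulrA -imapM mulKg.
have eg : equivariant G1 (biact rho) a' g by [].
have sf m : exists F, f F = m.
  exists [ffun x => if x == 1%g then m else 0].
  rewrite /f /= /induced_eval (bigD1 1%g) //=
    ffunE eqxx imap1 mul1r big1 ?addr0 //.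
  by move=> x /negPf ne; rewrite ffunE ne mulr0.
have [h hE hK] := proj _ _ a a' ga ga' f g ef eg sf.
exists (fun b x => h b x); split=> [u x b|b]; last exact: hK.
have := hE (u, 1%g) b; rewrite inE in_setT group1 => /(_ isT).
rewrite /= biactE /= invg1 imap1 mulr1 => ->.
by rewrite ffunE.
Qed.

(** The section h writes b as the sum of the x h_b(x). If u fixes b, the coordinate of x h_b(x) at b
    is constant on each <u>x; for u <> 1 the prime p divides |<u>|, and the coordinate of b at b
    would be 0 instead of 1. *)
Lemma left_free (p : nat) (bs : seq A) (Q : {group gT}) (u : gT) b :
    p \in [pchar k] -> projective_module (finset.setX [set: gT] 1%g) (biact rho)
      ->
    basis_of {:A} bs -> (forall w c, c \in bs -> biact rho w c \in bs) ->
    (p.-group Q)%g -> u \in Q -> b \in bs -> rho u * b = b -> u = 1%g.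
Proof.
move=> char_k proj basis_bs stable pQ Qu bs_b ub; apply/eqP/negPn/negP => u1.
have [h [hE hK]] := projective_section proj.
pose act (x : gT) : 'End(A) := biact rho (x, 1%g).
have actE x a : act x a = rho x * a by rewrite /act biactE invg1 imap1 mulr1.
have actK : linear_action [set: gT] act.
  by split=> [v|x y v _ _]; rewrite !actE ?imap1 ?mul1r // imapM mulrA.
have sb x c : x \in [set: gT] -> c \in bs -> act x c \in bs by move=> _;
  apply: stable.
have [t def_b] : exists t : 'I_(size bs), b = bvec t.
  by have /tnthP[t ->] : b \in in_tuple bs by []; exists t.
have fix_t : bperm act u t = t.
  by apply: bvec_inj basis_bs _ _ _; rewrite (bperm_vec sb) ?inE // -def_b actE.
pose F x : k^o := bcoord t (rho x * h b x).
have Fu v x : v \in <[u]>%g -> F (v * x)%g = F x.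
  case/cycleP => n ->; elim: n => [|n IH]; first by rewrite mul1g.
  rewrite expgS -mulgA -{}IH /F -{1}ub hE mulKg imapM -mulrA -actE.
  by rewrite -{1}fix_t (bcoord_perm actK basis_bs sb) ?inE.
(* For the trivial action of <u> on k, the trace from the trivial group is multiplication by |<u>|,
   which is 0 in k. *)
have : \sum_(x in [set: gT]) F x \in (0%VS : {vspace k^o}).
  apply: (@orbit_sum_mem _ _ _ (fun=> \1%VF) _ [set: gT] <[u]>%G (fun v x =>
    v * x)%g).
  - by move=> x _; rewrite mul1g.
  - by move=> x y z _ _ _; rewrite mulgA.
  - by move=> x z _ _; rewrite inE.
  - by move=> v x uv _; rewrite id_lfunE Fu.
  move=> x _; have -> : stab_of <[u]>%G (fun v x => v * x)%g x = 1%G.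
    apply/setP => v; rewrite !inE -{2}[x]mul1g (inj_eq (mulIg x)).
    by case: eqP => [->|_]; rewrite ?group1 ?andbF.
  rewrite rtraceE (eq_bigr (fun=> F x)) => [|Y _]; last by rewrite id_lfunE.
  rewrite sumr_const card_lcosets indexg1.
  rewrite (mulrn_dvd_pchar (V := k^o) _ char_k) ?mem0v //.
  have pu : (p.-group <[u]>)%g by apply: pgroupS pQ; rewrite cycle_subG.
  have /p_natP[[|n]] := pu; last by move=> ->; apply: dvdn_exp.
  by move/eqP; rewrite -trivg_card1 cycle_eq1 (negPf u1).
rewrite memv0 (eq_bigl xpredT) => [|x]; last by rewrite inE.
have -> : \sum_x F x = bcoord t b by rewrite -{1}(hK b) bcoord_sum.
by rewrite def_b (bcoord_vec basis_bs) eqxx oner_eq0.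
Qed.

End LeftFreeness.

(** * Approximation of X^D by A^D modulo the augmentation ideal *)

Section TwistedAction.

Variables (k : fieldType) (gT : finGroupType) (A : fdalgType k).
Variables (rho : interior gT A) (Q : {group gT}) (phi : [subg [Aut Q]]).

(** The action of Delta_phi(Q) carried over to Q, so that the results on permutation bases apply to
    every component of X. *)
Definition twist (u : gT) : 'End(A) := biact rho (sgval phi u, u).

Lemma twist_action : linear_action Q twist.
Proof.
split=> [v|x y v Qx Qy]; rewrite /twist !biactE /=.
  have -> : sgval phi 1%g = 1%g by rewrite -(autmE (subgP phi)) morph1.
  by rewrite invg1 !imap1 mul1r mulr1.
by rewrite subg_autM // invMg !imapM !mulrA.
Qed.

Lemma twist_fixed (R : {set gT}) :
  fixed (biact rho) (Delta (sgval phi) R) = fixed twist R.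
Proof.
apply/vspaceP => a; apply/ext_fixedP/fixedP => fa u Ru.
  by rewrite /twist biactE fa.
by have := fa u Ru; rewrite /twist biactE.
Qed.

Lemma ext_fixed_twist : ext_fixed rho phi = fixed twist Q.
Proof. exact: twist_fixed. Qed.

Lemma ext_ker_twist : ext_ker rho phi = brauer_ker twist Q.
Proof.
apply: eq_bigr => R prRQ; have sRQ := proper_sub prRQ.
have tr a : a \in fixed twist R ->
    rtrace (biact rho) (Delta (sgval phi) R) (Delta (sgval phi) Q) a =
    rtrace twist R Q a.
  move=> fa; rewrite ext_traceE ?twist_fixed // rtraceE.
  by apply: eq_bigr => Y _; rewrite /twist biactE.
rewrite /traces twist_fixed; apply/vspaceP => b.
by apply/memv_imgP/memv_imgP => -[a fa ->]; exists a; rewrite // tr.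
Qed.

End TwistedAction.

Section ExtendedApproximation.

Variables (k : fieldType) (p : nat) (gT : finGroupType) (A : fdalgType k).
Variables (rho : interior gT A) (Q : {group gT}) (bs : seq A).
Hypothesis char_k : p \in [pchar k].
Hypothesis pQ : (p.-group Q)%g.
Hypothesis basis_bs : basis_of {:A} bs.
Hypothesis bs_stable : forall w b, b \in bs -> biact rho w b \in bs.
Hypothesis bs_free : forall u b, u \in Q -> b \in bs -> rho u * b = b ->
  u = 1%g.

Local Notation AutQ := [subg [Aut Q]].
Local Notation X := (extBrauer rho Q).
Local Notation actX := (ext_act rho Q).
Local Notation I := (ext_aug rho Q).
Local Notation T := 'I_(size bs).
Local Notation cp := (@bperm k gT A (conj_act rho) bs).
Local Notation fixT phi := (@bfixed k gT A (twist rho phi) bs Q).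
Implicit Types (phi psi : AutQ) (t : T).

Let conjK : linear_action [set: gT] (conj_act rho).
Proof. by have [] := galgebra_action (conj_galgebra rho) [set: gT]. Qed.

Let conj_bs x b : x \in [set: gT] -> b \in bs -> conj_act rho x b \in bs.
Proof. by move=> _; apply: bs_stable. Qed.

Let twist_bs phi x b : x \in Q -> b \in bs -> twist rho phi x b \in bs.
Proof. by move=> _; apply: bs_stable. Qed.

Let fixTP phi t : reflect (bvec t \in ext_fixed rho phi) (t \in fixT phi).
Proof.
rewrite ext_fixed_twist; apply: (iffP (bfixedP _ _ _)) => [ft|/fixedP ft x Qx].
  by apply/fixedP => x Qx; rewrite -(bperm_vec (@twist_bs phi)) // ft.
by apply: (bvec_inj basis_bs); rewrite (bperm_vec (@twist_bs phi)) ?ft.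
Qed.

Let cp_vec x t : bvec (cp x t) = conj_act rho x (bvec t).
Proof. by rewrite (bperm_vec conj_bs) ?inE. Qed.

Let cp_fixT x phi t : x \in 'N(Q)%g -> t \in fixT phi ->
  cp x t \in fixT (ext_autJ x phi).
Proof.
by move=> Nx /fixTP ft; apply/fixTP; rewrite cp_vec ext_autJ_fixed.
Qed.

Let autJ_inj x : injective (@ext_autJ gT Q x).
Proof. by move=> phi psi /mulIg/mulgI. Qed.

(** Representatives of the components are unique only up to traces from proper subgroups, but these
    have coordinate 0 at fixed basis vectors, so the invariance of y passes to its coefficients
    there. *)
Let coef_inv (y : X) x phi t : x \in 'N(Q)%g -> actX x y = y ->
  t \in fixT phi ->
  bcoord (cp x t) (ext_repr y (ext_autJ x phi)) = bcoord t (ext_repr y phi).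
Proof.
move=> Nx xy ft; set psi := ext_autJ x phi.
have fr chi := ext_reprP y chi; have fxr := ext_autJ_fixed Nx (fr phi).
rewrite -[RHS](bcoord_perm conjK basis_bs conj_bs (x := x)) ?inE //.
apply/eqP; rewrite -subr_eq0 -bcoordB; apply/eqP.
apply: (bcoord_brauer_ker char_k (twist_action rho psi) basis_bs (@twist_bs psi)
  (subxx Q) pQ);
  last exact: cp_fixT.
rewrite -ext_ker_twist -(qclass_eq0 _ (U := ext_fixed rho psi));
  last exact: rpredB.
rewrite linearB /= subr_eq0; apply/eqP.
rewrite -/(ext_class rho psi (ext_repr y psi)) ext_reprK.
rewrite -{1}xy {1}(ext_sum y) linear_sum.
rewrite (big_morph (fun z : X => dcoord z psi) (fun f g =>
  dcoordD f g psi) (dsumE _ _)).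
rewrite (bigD1 phi) //= ext_act_inj // dsumE eqxx big1 ?addr0 // => chi ne.
rewrite ext_act_inj // dsumE; case: eqP => // /esym /autJ_inj eq_chi.
by rewrite eq_chi eqxx in ne.
Qed.

Let ext_autJ1 phi : ext_autJ 1%g phi = phi.
Proof. by rewrite /ext_autJ ext_conj1 invg1 mul1g mulg1. Qed.

Let ext_autJM x y phi : x \in 'N(Q)%g -> y \in 'N(Q)%g ->
  ext_autJ (x * y)%g phi = ext_autJ x (ext_autJ y phi).
Proof. by move=> Nx Ny; rewrite /ext_autJ ext_conjM // invMg !mulgA. Qed.

Let sQN : Q \subset 'N(Q)%g. Proof. exact: normG. Qed.

(* The pairs (phi, t) with phi <> 1 have no fixed point under Q, as the left  *)
(* action of Q on the basis is free: their orbit sums are proper traces.      *)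
Lemma ext_approx (y : X) (D : {group gT}) :
    Q \subset D -> D \subset 'N(Q)%g -> y \in fixed actX D ->
  exists2 a, a \in fixed (conj_act rho) D & y - ext_unit rho Q a \in I.
Proof.
move=> sQD sDN fy.
pose F (z : AutQ * T) : X :=
  bcoord z.2 (ext_repr y z.1) *: ext_inj rho z.1 (bvec z.2).
(* The identity component of y, lifted with Q-fixed basis vectors only; invariance of the
   coefficients makes the lift D-fixed. *)
pose a := \sum_(t in fixT (1%g : AutQ)) bcoord t (ext_repr y (1%g : AutQ)) *:
  bvec t.
exists a.
  apply/fixedP => x Dx; have Nx := subsetP sDN x Dx.
  have xy := fixedE fy Dx.
  have J1 : ext_autJ x (1%g : AutQ) = 1%g by rewrite /ext_autJ mulg1 mulVg.
  have cp_inj : injective (cp x).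
    by apply: can_inj (bpermK conjK basis_bs conj_bs _); rewrite inE.
  rewrite /a linear_sum [RHS](reindex_inj cp_inj) /=.
  apply: eq_big => [t|t ft]; last first.
    by rewrite linearZ /= -cp_vec -(coef_inv Nx xy ft) J1.
  apply/idP/idP => ft; first by rewrite -J1 cp_fixT.
  have Nx' : x^-1%g \in 'N(Q)%g by rewrite groupV.
  have := cp_fixT Nx' ft; rewrite (bpermK conjK basis_bs conj_bs) ?inE //.
  by rewrite /ext_autJ mulg1 mulVg.
pose S := [set z : AutQ * T | (z.2 \in fixT z.1) && (z.1 != 1%g)].
have inj_fix phi : ext_inj rho phi (ext_repr y phi) =
  \sum_(t in fixT phi) F (phi, t).
  have fr : ext_repr y phi \in fixed (twist rho phi) Q.
    by rewrite -ext_fixed_twist ext_reprP.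
  have := fixed_partP (twist_action rho phi) basis_bs (@twist_bs phi) (subxx Q)
    fr.
  rewrite -ext_ker_twist => ker.
  have -> : \sum_(t in fixT phi) F (phi, t) =
      ext_inj rho phi (fixed_part (twist rho phi) bs Q (ext_repr y phi)).
    by rewrite /fixed_part linear_sum; apply: eq_bigr => t _; rewrite linearZ.
  apply: dsumP => psi; rewrite !dsumE; case: eqP => // ->.
  apply: ext_classE; rewrite ?ext_reprP //; apply: rpred_sum => t ft.
  by rewrite rpredZ //; apply/fixTP.
have -> : y - ext_unit rho Q a = \sum_(z in S) F z.
  rewrite {1}(ext_sum y) (eq_bigr _ (fun phi _ =>
    inj_fix phi)) (bigD1 (1%g : AutQ)) //=.
  have -> : \sum_(t in fixT (1%g : AutQ)) F (1%g, t) = ext_unit rho Q a.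
    by rewrite /a linear_sum; apply: eq_bigr => t _; rewrite linearZ.
  rewrite addrAC subrr add0r pair_big_dep /=; apply: eq_big =>
    [[phi t]|[phi t] _] //.
  by rewrite [RHS]in_set /= andbC.
pose op x (z : AutQ * T) := (ext_autJ x z.1, cp x z.2).
have op1 z : z \in S -> op 1%g z = z.
  by case: z => phi t _; rewrite /op /=
    ext_autJ1 (bperm1 conjK basis_bs conj_bs).
have opM u v z : u \in Q -> v \in Q -> z \in S -> op (u * v)%g z =
  op u (op v z).
  case: z => phi t Qu Qv _; rewrite /op /= ext_autJM ?(subsetP sQN) //.
  by rewrite (bpermM conjK basis_bs conj_bs) ?inE.
have opS u z : u \in Q -> z \in S -> op u z \in S.
  case: z => phi t Qu; rewrite in_set => /andP[/= ft phi1]; rewrite in_set /=.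
  rewrite cp_fixT ?(subsetP sQN) //=.
  apply: contra phi1 => /eqP J1; apply/eqP; apply: (autJ_inj (x := u)).
  by rewrite J1 /ext_autJ mulg1 mulVg.
have opF u z : u \in Q -> z \in S -> actX u (F z) = F (op u z).
  case: z => phi t Qu; rewrite in_set /= => /andP[ft _].
  have Nu := subsetP sQN u Qu.
  rewrite /F /= linearZ /= ext_act_inj //; last exact/fixTP.
  by rewrite -cp_vec (coef_inv Nu) // (fixedE fy) // (subsetP sQD).
apply: (@orbit_sum_mem _ _ _ actX _ S Q op) => // z Sz.
pose R := Group (stab_of_group op1 opM Sz).
have prRQ : R \proper Q.
  rewrite properE; apply/andP; split; first by apply/subsetP => x;
    rewrite inE => /andP[].
  (* If Q fixed (phi, t), then u t u^-1 = t = phi(u) t u^-1 for u in Q; so u^-1 phi(u) fixes t from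
     the left, whence phi(u) = u by freeness, against phi <> 1. *)
  apply/negP => /subsetP sQR; have := Sz; case def_z: z => [phi t].
  rewrite in_set => /andP[/= ft]; case/eqP; apply: ext_autP => u Qu;
    rewrite perm1.
  have := sQR u Qu; rewrite inE Qu def_z xpair_eqE /= => /andP[_ /eqP cut].
  have ut : conj_act rho u (bvec t) = bvec t by rewrite -cp_vec cut.
  have /fixTP/ext_fixedP/(_ u Qu) := ft.
  rewrite -{2}ut conj_actE => /(congr1 (fun b => b * rho u)).
  rewrite -!mulrA imapVK !mulr1 => eq_u.
  apply: (mulgI u^-1%g); rewrite mulVg.
  apply: (bs_free (b := bvec t)); rewrite ?bvec_mem ?groupM ?groupV
    ?subg_aut_closed //.
  by rewrite imapM -mulrA eq_u mulrA imapVK mul1r.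
apply: (subvP (traces_ext_aug rho char_k pQ prRQ));
  apply: (@rtrace_in _ _ _ _ R).
by apply/fixedP => x; rewrite inE => /andP[Px /eqP xz]; rewrite opF // xz.
Qed.

End ExtendedApproximation.

(** * Brauer quotients and blocks *)

Section BrauerAction.

Variables (k : fieldType) (gT : finGroupType) (B : fdalgType k).
Variables (act : galgebra gT B) (Q : {group gT}).

Local Notation CQ := (brauerQuotient act Q).
Local Notation br := (Br act Q).
Local Notation bact := (brauer_act act Q).

Let actT : algebra_action [set: gT] act.
Proof. exact: galgebra_action. Qed.
Let linT : linear_action [set: gT] act.
Proof. by case: actT. Qed.

Lemma fixed_norm x a : x \in 'N(Q)%g -> a \in fixed act Q ->
  act x a \in fixed act Q.
Proof.
move=> Nx fa; rewrite -(normP (groupVr Nx)).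
by apply: (fixed_act linT); rewrite ?inE ?subsetT.
Qed.

Lemma Br_eq a b : a \in fixed act Q -> b \in fixed act Q ->
  a - b \in brauer_ker act Q -> br a = br b.
Proof. exact: qclass_eq. Qed.

Lemma brauer_act_Br x a : x \in 'N(Q)%g -> a \in fixed act Q ->
  bact x (br a) = br (act x a).
Proof.
move=> Nx fa; have fr : Brrepr (br a) \in fixed act Q by apply: qrepr_mem.
rewrite brauer_actE; apply: Br_eq; rewrite ?fixed_norm // -linearB.
by apply: (brauer_ker_norm linT); rewrite ?subsetT ?in_setT //; apply: qclassK.
Qed.

Lemma brauer_action : algebra_action 'N(Q)%g bact.
Proof.
have fix1 : 1 \in fixed act Q by apply: (fixed1 actT); apply: subsetT.
split=> [|x a b Nx|x Nx].
- split=> [v|x y v Nx Ny]; have [a fa ->] := Br_surj v.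
    by rewrite brauer_act_Br ?group1 ?Defs.gact_id.
  by rewrite !brauer_act_Br ?groupM ?fixed_norm ?Defs.gact_mulg.
- have [a' fa ->] := Br_surj a; have [b' fb ->] := Br_surj b.
  have fab : a' * b' \in fixed act Q by apply: (fixedM actT); rewrite ?subsetT.
  by rewrite -BrM // !brauer_act_Br // Defs.gactM BrM ?fixed_norm.
by rewrite -Br1 brauer_act_Br // Defs.gact1.
Qed.

Lemma BrX a n : a \in fixed act Q -> br (a ^+ n) = br a ^+ n.
Proof.
move=> fa; elim: n => [|n IH]; first by rewrite !expr0 Br1.
rewrite !exprS BrM ?IH //.
exact: (subalgX (S := fixed_subalgebra actT (subsetT Q))).
Qed.

Lemma Br_fixed (L : {set gT}) a : L \subset 'N(Q)%g -> a \in fixed act Q ->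
  a \in fixed act L -> br a \in fixed bact L.
Proof.
move=> sLN fa /fixedP fL; apply/fixedP => x Lx.
by rewrite brauer_act_Br ?fL // (subsetP sLN).
Qed.

Lemma Br_rtrace (P : {group gT}) a : Q \subset P -> P \subset 'N(Q)%g ->
  a \in fixed act Q -> br (rtrace act Q P a) = rtrace bact Q P (br a).
Proof.
move=> sQP sPN fa; rewrite !rtraceE linear_sum.
by apply: eq_bigr => X /(repr_lcosets sQP) PX;
  rewrite brauer_act_Br // (subsetP sPN).
Qed.

(** * A block of C(Q), its stabiliser and its conjugates *)

Section Block.

Variable f : CQ.
Hypothesis block_f : is_block f.

Let f0 : f != 0. Proof. by case: block_f. Qed.
Lemma block_idem : f * f = f. Proof. by case: block_f. Qed.
Lemma block_central y : f * y = y * f. Proof. by case: block_f => fC _ _ _;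
  apply: fC. Qed.

Let bactM x a b : x \in 'N(Q)%g -> bact x (a * b) = bact x a * bact x b.
Proof. by case: brauer_action => _ + _; apply. Qed.
Let bactK x y : x \in 'N(Q)%g -> bact x (bact x^-1%g y) = y.
Proof.
by case: brauer_action => -[b1 bM] _ _ Nx; rewrite -bM ?groupV // mulgV b1.
Qed.

Let bactVK x y : x \in 'N(Q)%g -> bact x^-1%g (bact x y) = y.
Proof. by move=> Nx; rewrite -{2}(invgK x) bactK ?groupV. Qed.

Lemma block_act_idem x : x \in 'N(Q)%g -> bact x f * bact x f = bact x f.
Proof. by move=> Nx; rewrite -bactM // block_idem. Qed.

Lemma block_act_central x y : x \in 'N(Q)%g -> bact x f * y = y * bact x f.
Proof. by move=> Nx; rewrite -{1 2}(bactK y Nx) -!bactM // block_central. Qed.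

Let block_dichotomy x : x \in 'N(Q)%g -> f * bact x f = 0 \/ f * bact x f = f.
Proof.
move=> Nx; have [fC _ ff prim] := block_f.
set g := f * bact x f.
have gC y : g * y = y * g.
  by rewrite /g -mulrA block_act_central // mulrA block_central -mulrA.
have fg : f * g = g by rewrite /g mulrA ff.
have gg : g * g = g.
  by rewrite /g mulrA -[f * _ * f]mulrA block_act_central // mulrA ff -mulrA
    block_act_idem.
case: (prim g (f - g)); rewrite ?mulrBr ?mulrBl ?gg ?gC ?fg ?ff ?subrr ?subr0
  //.
- by move=> y; rewrite mulrBl mulrBr block_central gC.
- by rewrite addrC subrK.
- by left.
by move/eqP; rewrite subr_eq0 => /eqP; right.
Qed.

(** The product is a central idempotent under f, hence 0 or f. If it is f, the conjugate of f by
    x^-1 lies under f, and being nonzero it equals f. *)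
Lemma block_conj_orthogonal x : x \in 'N(Q)%g -> bact x f != f ->
  f * bact x f = 0.
Proof.
move=> Nx nxf; have [//|fxf] := block_dichotomy Nx.
have Nx' : x^-1%g \in 'N(Q)%g by rewrite groupV.
have x'f : f * bact x^-1%g f = bact x^-1%g f.
  have := congr1 (bact x^-1%g) fxf; rewrite bactM // bactVK //.
  by rewrite block_central.
have [] := block_dichotomy Nx'; rewrite x'f => eq_f.
  by case/eqP: f0; rewrite -(bactK f Nx) eq_f linear0.
by case/eqP: nxf; rewrite -{1}eq_f bactK.
Qed.

Variable N : {group gT}.
Hypothesis sQN : Q \subset N.
Hypothesis prim_f : primitive_idempotent [set` fixed bact 'C_N(Q)%g]%classic f.

Lemma norm_stabiliserE x :
  (x \in norm_stabiliser f) = (x \in 'N(Q)%g) && (bact x f == f).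
Proof. by rewrite in_set. Qed.

Lemma norm_stabiliser_group : group_set (norm_stabiliser f).
Proof.
have [[b1 bM] _ _] := brauer_action.
apply/group_setP; split=> [|x y]; first by rewrite norm_stabiliserE group1 b1
  eqxx.
rewrite !norm_stabiliserE => /andP[Nx /eqP xf] /andP[Ny /eqP yf].
by rewrite groupM //= bM // yf xf.
Qed.
Canonical stabiliser_group := Group norm_stabiliser_group.

Lemma norm_stabiliser_sub : norm_stabiliser f \subset 'N(Q)%g.
Proof. by apply/subsetP => x; rewrite norm_stabiliserE => /andP[]. Qed.

Lemma norm_stabiliserQ : Q \subset norm_stabiliser f.
Proof.
apply/subsetP => x Qx; have Nx := subsetP (normG Q) x Qx;
  rewrite norm_stabiliserE Nx /=.
have [a fa ->] := Br_surj f; rewrite brauer_act_Br //.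
by rewrite (fixedE fa).
Qed.

Lemma norm_stabiliser_cent : 'C_N(Q)%g \subset norm_stabiliser f.
Proof.
apply/subsetP => x Cx; have [fC _ _ _] := prim_f.
rewrite norm_stabiliserE (fixedE fC) // eqxx andbT.
by apply: (subsetP (cent_sub Q)); case/setIP: Cx.
Qed.

Lemma fixed_block : f \in fixed bact (norm_stabiliser f).
Proof. by apply/fixedP => x; rewrite norm_stabiliserE => /andP[_ /eqP]. Qed.

Lemma Br_block j : j \in fixed act N -> j * j = j -> br j * f != 0 ->
  br j * f = f.
Proof.
move=> fj jj jf0; have fjQ := subvP (fixedS act sQN) j fj.
have [ff _ _ _] := prim_f.
have sCN : 'C_N(Q)%g \subset 'N(Q)%g.
  by apply: subset_trans (subsetIr _ _) (cent_sub Q).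
pose S := fixed_subalgebra brauer_action sCN.
have fbr : br j \in fixed bact 'C_N(Q)%g.
  by apply: Br_fixed => //; apply: (subvP (fixedS act (subsetIl _ _))).
have bb : br j * br j = br j by rewrite -BrM // jj.
have [||||b0|//] := @primitive_sub _ _ S f (br j * f) prim_f.
- exact: subalgM.
- by rewrite mulrA -[_ * f * br j]mulrA block_central mulrA bb -mulrA
  block_idem.
- by rewrite mulrA block_central -mulrA block_idem.
- by rewrite -mulrA block_idem.
by rewrite b0 eqxx in jf0.
Qed.

Variable c : B.
Hypothesis prim_c : primitive_idempotent [set` fixed act N]%classic c.
Hypothesis c_trace : c \in traces act Q N.
Hypothesis cf : br c * f != 0.

Let S := (N :&: 'N(Q))%G.
Let R := (norm_stabiliser f :&: N)%G.

(** As R is the stabiliser of f in S = N_N(Q), this is the sum of the distinct S-conjugates of f. *)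
Definition block_sum : CQ := rtrace bact R S f.
Local Notation s := block_sum.

Let sRS : R \subset S.
Proof.
apply/subsetP => x /setIP[Hx Nx]; apply/setIP; split=> //.
exact: (subsetP norm_stabiliser_sub).
Qed.
Let sSN : S \subset 'N(Q)%g. Proof. exact: subsetIr. Qed.
Let linB : linear_action 'N(Q)%g bact. Proof. by case: brauer_action. Qed.
Let fR : f \in fixed bact R.
Proof. exact: subvP (fixedS bact (subsetIl _ _)) _ fixed_block. Qed.

Lemma block_sum_mul : f * s = f.
Proof.
rewrite /s rtraceE mulr_sumr (bigD1 (R : {set gT})) /=; last first.
  by apply/lcosetsP; exists 1%g; rewrite ?mul1g.
rewrite (fixedE fR) ?block_idem; last exact: mem_repr (group1 R).
rewrite big1 ?addr0 // => X /andP[/lcosetsP[x Sx ->] nX].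
have Nx := subsetP sSN x Sx; have sRN := subset_trans sRS sSN.
rewrite (act_repr_lcoset linB) //; apply: block_conj_orthogonal => //.
apply: contra nX => xf; apply/eqP; apply: lcoset_id.
by case/setIP: Sx => Nx' _; rewrite in_setI norm_stabiliserE Nx xf.
Qed.

Let s_fixed : s \in fixed bact S.
Proof. exact: (rtrace_fixed linB). Qed.

Let s_idem : s * s = s.
Proof.
by rewrite {1}/s (rtraceMr brauer_action) // block_sum_mul.
Qed.

Let s_central y : s * y = y * s.
Proof.
rewrite /s rtraceE mulr_suml mulr_sumr; apply: eq_bigr =>
  X /(repr_lcosets sRS) SX.
by rewrite block_act_central // (subsetP sSN).
Qed.

(* Br_Q maps the local algebra cC^Nc onto the corner of C(Q)^{N_N(Q)} at      *)
(* Br_Q(c), which is therefore primitive and lies under the sum of the        *)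
(* conjugates of f.                                                           *)
Lemma block_sum_Br : s * br c = br c.
Proof.
have [fc c0 cc] := @primitiveW _ _ (fixed_subalgebra actT (subsetT N)) _ prim_c.
have fcQ := subvP (fixedS act sQN) c fc.
have brcc : br c * br c = br c by rewrite -BrM // cc.
pose w := 1 - s.
have wS : w \in fixed bact S by rewrite rpredB // (fixed1 brauer_action).
have wC y : w * y = y * w by rewrite /w mulrBl mulrBr mul1r mulr1 s_central.
have ww : w * w = w.
  by rewrite /w mulrBr mulr1 mulrBl mul1r s_idem subrr subr0.
have fw : f * w = 0 by rewrite /w mulrBr mulr1 block_sum_mul subrr.
suff wc0 : w * br c = 0.
  by move/eqP: wc0; rewrite /w mulrBl mul1r subr_eq0 => /eqP.
have /memv_imgP[a fa def_c] := c_trace.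
have sQS : Q \subset S by rewrite subsetI sQN normG.
have brtr b : b \in fixed act Q -> br (rtrace act Q N b) =
  rtrace bact Q S (br b).
  move=> fb; rewrite -Br_rtrace //; apply: Br_eq.
  - by apply: (subvP (fixedS act sQN)); apply: (rtrace_fixed linT);
    rewrite ?subsetT.
  - by apply: (subvP (fixedS act sQS)); apply: (rtrace_fixed linT);
    rewrite ?subsetT.
  apply: (brauer_rtrace linT); rewrite ?subsetT ?normG //.
  move=> x Nx sQQx; apply/normP.
  by apply/eqP; rewrite eq_sym eqEcard sQQx cardJg leqnn.
(* Since Br_Q turns Tr_Q^N into the trace from Q to N_N(Q), and c = Tr_Q^N(a), the element r0 of C^N
   lifts w Br_Q(c). *)
have [a' fa' def_a'] := Br_surj (w * br a).
pose r0 := rtrace act Q N a'.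
have fr0 : r0 \in fixed act N by apply: (rtrace_fixed linT); rewrite ?subsetT.
have br_r0 : br r0 = w * br c.
  rewrite /r0 brtr // -def_a' -(rtraceMl brauer_action) // -brtr //.
  by rewrite -def_c.
pose r := c * r0 * c.
have fN a1 b1 : a1 \in fixed act N -> b1 \in fixed act N ->
  a1 * b1 \in fixed act N.
  by apply: (fixedM actT); apply: subsetT.
have fQ' a1 : a1 \in fixed act N -> a1 \in fixed act Q by apply: (subvP (fixedS
  act sQN)).
have fr : r \in fixed act N by rewrite /r !fN.
have br_r : br r = w * br c.
  by rewrite /r !BrM ?fQ' ?fN // br_r0 mulrA -wC -!mulrA brcc brcc.
have wcwc : (w * br c) * (w * br c) = w * br c.
  by rewrite mulrA -[w * _ * w]mulrA -wC mulrA ww -mulrA brcc.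
(* If r is nilpotent, so is the idempotent w Br_Q(c), which then vanishes. If r is invertible under
   c, then Br_Q(c) f is a multiple of f w = 0. *)
have [||[n rn]|[b fb [cb bc rb br']]] :=
    @primitive_dichotomy _ _ (fixed_subalgebra actT (subsetT N)) c r prim_c fr.
- by rewrite /r !mulrA cc.
- by rewrite /r -!mulrA cc.
- have : br (r ^+ n.+1) = 0 by rewrite exprS rn mulr0 linear0.
  rewrite BrX ?fQ' // br_r => <-; elim: n {rn} => [|n IH];
    first by rewrite expr1.
  by rewrite exprS -IH wcwc.
case/eqP: cf; have /(congr1 br) := rb; rewrite BrM ?fQ' // br_r => <-.
by rewrite -block_central !mulrA fw !mul0r.
Qed.

End Block.

End BrauerAction.

(** * The correspondence *)

Section Correspondence.

Variables (k : fieldType) (p : nat) (gT : finGroupType) (A : fdalgType k).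
Variables (rho : interior gT A) (N Q : {group gT}).
Variable C : interior_subalgebra rho N.

Local Notation G := [set: gT]%G.
Local Notation actA := (conj_act rho).
Local Notation actC := (sub_galgebra C).
Local Notation actX := (ext_act rho Q).
Local Notation X := (extBrauer rho Q).
Local Notation I := (ext_aug rho Q).
Local Notation iota := (@sval_of k A C).
Local Notation bact := (brauer_act actC Q).

Hypothesis char_k : p \in [pchar k].
Hypothesis nNG : (N <| G)%g.

Let actAT : algebra_action G actA.
Proof. exact: (galgebra_action (conj_galgebra rho)). Qed.
Let linA : linear_action G actA. Proof. by case: actAT. Qed.
Let actCT : algebra_action G actC. Proof. exact: galgebra_action. Qed.
Let actXN : algebra_action 'N(Q)%g actX. Proof. exact: ext_action. Qed.
Let linX : linear_action 'N(Q)%g actX. Proof. by case: actXN. Qed.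

Let fixA (L : {set gT}) a b : a \in fixed actA L -> b \in fixed actA L ->
  a * b \in fixed actA L.
Proof. by apply: (fixedM actAT); apply: subsetT. Qed.
Let fixAS (L M : {set gT}) a : L \subset M -> a \in fixed actA M ->
  a \in fixed actA L.
Proof. by move=> sLM; apply: (subvP (fixedS _ sLM)). Qed.

Lemma sval_of_fixed (L : {set gT}) x : x \in fixed actC L ->
  iota x \in fixed actA L.
Proof. by move/fixedP => fx; apply/fixedP => u Lu; rewrite -sub_actE fx. Qed.

Lemma sval_of_rtrace (R P : {set gT}) x :
  iota (rtrace actC R P x) = rtrace actA R P (iota x).
Proof.
by rewrite !rtraceE linear_sum; apply: eq_bigr => Y _; rewrite -sub_actE.
Qed.

Lemma sval_of_brauer_ker (P : {group gT}) x :
  x \in brauer_ker actC P -> iota x \in brauer_ker actA P.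
Proof.
move=> /memv_sumP[F FW ->]; rewrite linear_sum; apply: rpred_sum => R prRP.
have /memv_imgP[y fy ->] := FW R prRP; rewrite /= sval_of_rtrace.
apply: (subvP (traces_brauer_ker actA prRP)); apply: rtrace_in.
exact: sval_of_fixed.
Qed.

Fact ext_emb_is_linear : linear (@ext_emb k gT A rho N C Q).
Proof. by move=> t x y; rewrite /ext_emb !linearP. Qed.
HB.instance Definition _ := GRing.isLinear.Build k (brauerQuotient actC Q) X _
  (@ext_emb k gT A rho N C Q) ext_emb_is_linear.

Lemma ext_emb_Br x : x \in fixed actC Q ->
  ext_emb (Br actC Q x) = ext_unit rho Q (iota x).
Proof. exact: ext_embE. Qed.

Lemma ext_emb_act x y : x \in 'N(Q)%g -> actX x (ext_emb y) =
  ext_emb (bact x y).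
Proof.
move=> Nx; have [a fa ->] := Br_surj y.
rewrite brauer_act_Br // !ext_emb_Br ?fixed_norm // ext_unit_act ?sval_of_fixed
  //.
by rewrite -sub_actE.
Qed.

(** * The p-subgroups meeting N in Q, and their traces in X *)

Definition meets_in (D : {group gT}) : bool := (p.-group D)%g &&
  (D :&: N == Q)%g.

Lemma meets_inP (D : {group gT}) :
  reflect ((p.-group D)%g /\ (D :&: N)%g = Q) (meets_in D).
Proof. by apply: (iffP andP) => -[pD /eqP]. Qed.

Lemma meets_in_sub D : meets_in D -> Q \subset D.
Proof. by case/meets_inP => _ <-; apply: subsetIl. Qed.

Lemma meets_in_norm D : meets_in D -> D \subset 'N(Q)%g.
Proof.
case/meets_inP => _ <-; apply: normsI; first exact: normG.
by apply: subset_trans (subsetT D) (normal_norm nNG).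
Qed.

Let conjN x : (N :^ x)%g = N.
Proof. by apply: (normsP (normal_norm nNG)); apply: in_setT. Qed.

Lemma meets_in_conj D x : meets_in D -> Q \subset (D :^ x)%g -> x \in 'N(Q)%g.
Proof.
case/meets_inP => _ DN sQD; apply/normP/eqP;
  rewrite eq_sym eqEcard cardJg leqnn andbT.
by rewrite -{2}DN conjIg conjN subsetI sQD -DN subsetIr.
Qed.

Lemma meets_in_capJ D (H : {group gT}) x : meets_in D -> Q \subset H ->
  x \in 'N(Q)%g -> meets_in (H :&: D :^ x)%G.
Proof.
case/meets_inP => pD DN sQH Nx; apply/meets_inP; split.
  by apply: pgroupS (subsetIr _ _) _; rewrite pgroupJ.
by rewrite /= -setIA -{1}(conjN x) -conjIg DN (normP Nx); apply/setIidPr.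
Qed.

(** Cosets outside N_G(Q) only contribute traces from proper subgroups of Q ([brauer_rtrace]),
    because Q <= D^x forces x to normalise Q = D :&: N. *)
Lemma ext_unit_trace D a : meets_in D -> a \in fixed actA D ->
  ext_unit rho Q (rtrace actA D G a) = rtrace actX D 'N(Q)%g (ext_unit rho Q a).
Proof.
move=> mD fa; have sQD := meets_in_sub mD; have sDN := meets_in_norm mD.
rewrite -ext_unit_rtrace //; apply/eqP; rewrite -subr_eq0 -linearB.
have sQG : Q \subset G by apply: subsetT.
have sQN : Q \subset 'N(Q)%g by apply: normG.
rewrite ext_unit_eq0; last first.
  rewrite rpredB //; first by apply: (fixAS sQG); apply: (rtrace_fixed linA);
    rewrite ?subsetT.
  by apply: (fixAS sQN); apply: (rtrace_fixed linA); rewrite ?subsetT.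
have := @brauer_rtrace _ _ _ _ _ linA D G Q a; rewrite setTI; apply=> //.
- exact: subsetT.
- by move=> x _; apply: meets_in_conj.
Qed.

(** A trace from R goes to a trace from R when R contains Q; otherwise it goes to 0, as Q is normal
    in D. *)
Lemma ext_unit_brauer_ker (D : {group gT}) a : Q \subset D ->
  D \subset 'N(Q)%g ->
  a \in brauer_ker actA D -> ext_unit rho Q a \in brauer_ker actX D.
Proof.
move=> sQD sDN /memv_sumP[F FW ->]; rewrite linear_sum; apply: rpred_sum =>
  R prRD.
have sRD := proper_sub prRD.
have /memv_imgP[b fb ->] := FW R prRD; rewrite /=.
have [sQR|nsQR] := boolP (Q \subset R).
  rewrite ext_unit_rtrace //; apply: (subvP (traces_brauer_ker actX prRD)).
  apply: rtrace_in; apply: ext_unit_fixed => //; last exact: fixAS fb.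
  exact: subset_trans sRD sDN.
suff /eqP -> : ext_unit rho Q (rtrace actA R D b) == 0 by rewrite mem0v.
have fbD : rtrace actA R D b \in fixed actA D by apply: (rtrace_fixed linA);
  rewrite ?subsetT.
rewrite ext_unit_eq0 ?(fixAS sQD) //.
apply: (traces_not_conj actAT sRD (subsetT D) sQD _ (rtrace_in D fb)) => y Dy.
apply: contra nsQR => sQR; rewrite -(conjSg _ _ y^-1%g).
by rewrite (normsP sDN) ?groupV.
Qed.

Hypothesis pQ : (p.-group Q)%g.
Variable bs : seq A.
Hypothesis basis_bs : basis_of {:A} bs.
Hypothesis bs_stable : forall w b, b \in bs -> biact rho w b \in bs.
Hypothesis bs_free : forall u b, u \in Q -> b \in bs -> rho u * b = b ->
  u = 1%g.

Variable c : subalg_of C.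
Hypothesis sQN : Q \subset N.
Hypothesis prim_c : primitive_idempotent [set` fixed actC N]%classic c.
Hypothesis fix_c : c \in fixed actC G.
Hypothesis c_trace : c \in traces actC Q N.

Variable fQ : brauerQuotient actC Q.
Hypothesis block_fQ : is_block fQ.
Hypothesis c_fQ : Br actC Q c * fQ != 0.
Hypothesis prim_fQ : primitive_idempotent [set` fixed bact 'C_N(Q)%g]%classic
  fQ.

Local Notation H := (stabiliser_group fQ).
Local Notation e := (ext_emb fQ).

Hypothesis e_normal : forall m, m \in fixed actX 'N(Q)%g -> e * m = e * m * e.

(** * The homomorphism theta and its image modulo I *)

Definition theta (a : A) : X := lmul e (ext_unit rho Q a).

Let thetaE a : theta a = e * ext_unit rho Q a. Proof. exact: lmulE. Qed.

Let sHN : H \subset 'N(Q)%g. Proof. exact: norm_stabiliser_sub. Qed.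
Let sQH : Q \subset H. Proof. exact: norm_stabiliserQ. Qed.
Let fixX (L : {set gT}) a b : L \subset 'N(Q)%g ->
  a \in fixed actX L -> b \in fixed actX L -> a * b \in fixed actX L.
Proof. by move=> sLN; apply: (fixedM actXN). Qed.
Let fixXS (L M : {set gT}) a : L \subset M -> a \in fixed actX M ->
  a \in fixed actX L.
Proof. by move=> sLM; apply: (subvP (fixedS _ sLM)). Qed.
Let IMr x y : x \in I -> x * y \in I. Proof. exact: ext_augMr. Qed.
Let IMl x y : x \in I -> y * x \in I. Proof. exact: ext_augMl. Qed.
Let actXM x a b : x \in 'N(Q)%g -> actX x (a * b) = actX x a * actX x b.
Proof. by case: actXN => _ + _; apply. Qed.

Let ee : e * e = e.
Proof. by rewrite -ext_embM block_idem. Qed.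

Let e_fixed : e \in fixed actX H.
Proof.
apply/fixedP => x Hx; rewrite ext_emb_act ?(subsetP sHN) //.
by rewrite (fixedE (fixed_block fQ)).
Qed.

Let e_orth x : x \in 'N(Q)%g -> x \notin H -> e * actX x e = 0.
Proof.
move=> Nx nHx; rewrite ext_emb_act // -ext_embM block_conj_orthogonal ?linear0
  //.
by apply: contra nHx => xf; rewrite norm_stabiliserE Nx.
Qed.

(** With y = Tr_D^H(z), the witness is Tr_D^G(a0), where a0 in A^D approximates z1 = e z e. Its
    image is Tr_D^{N_G(Q)}(tau(a0)) cut by e: the cosets inside H give e y e modulo I, and a coset
    of x outside H gives 0 modulo I, as e is orthogonal to its conjugate by x. *)
Lemma theta_trace_aug D y : meets_in D -> D \subset H ->
  y \in traces actX D H ->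
  exists2 a, a \in traces actA D G & e * y * e - theta a \in I.
Proof.
move=> mD sDH /memv_imgP[z fz ->]; have sDN := meets_in_norm mD.
have fe := fixXS sDH e_fixed.
rewrite (rtraceMl actXN) // (rtraceMr actXN) //; set z1 := e * z * e.
have ez1 : e * z1 * e = z1 by rewrite /z1 !mulrA ee -!mulrA ee.
have fz1 : z1 \in fixed actX D by rewrite /z1 !fixX.
clearbody z1.
have [a0 fa0 z1a0] := ext_approx char_k pQ basis_bs bs_stable bs_free
  (meets_in_sub mD) sDN fz1.
exists (rtrace actA D G a0); first exact: rtrace_in.
set t0 := ext_unit rho Q a0 in z1a0 *.
have ft0 : t0 \in fixed actX D.
  by apply: ext_unit_fixed => //; apply: fixAS (meets_in_sub mD) fa0.
have t0z1 : t0 - z1 \in I by rewrite -opprB rpredN.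
have fT : ext_unit rho Q (rtrace actA D G a0) \in fixed actX 'N(Q)%g.
  by rewrite (ext_unit_trace mD) //; apply: (rtrace_fixed linX).
rewrite thetaE (e_normal fT) (ext_unit_trace mD fa0) !rtraceE mulr_sumr
  mulr_suml.
rewrite [X in _ - X](bigID (mem (lcosets D H))) /=.
have inH Y : (Y \in lcosets D 'N(Q)%g) && (Y \in lcosets D H) =
  (Y \in lcosets D H).
  by rewrite andb_idl // => /lcosetsP[x Hx ->]; apply/lcosetsP; exists x;
    rewrite ?(subsetP sHN).
rewrite (eq_bigl _ _ inH) opprD addrA -sumrB rpredD ?rpredN //.
  apply: rpred_sum => Y /(repr_lcosets sDH) Hx; set x := repr Y.
  have Nx := subsetP sHN _ Hx.
  have -> : actX x z1 - e * actX x t0 * e = - (e * actX x (t0 - z1) * e).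
    rewrite linearB mulrBr mulrBl opprB -{1}ez1 !actXM //.
    by rewrite (fixedE e_fixed Hx).
  by rewrite rpredN IMr // IMl // ext_aug_act.
apply: rpred_sum => Y /andP[/lcosetsP[x Nx ->] nH].
rewrite (act_repr_lcoset linX sDN ft0 Nx).
have nHx : x \notin H by apply: contra nH => Hx; apply/lcosetsP; exists x.
have -> : actX x t0 = actX x (t0 - z1) + actX x z1 by rewrite -linearD subrK.
rewrite mulrDr mulrDl rpredD //; first by rewrite IMr // IMl // ext_aug_act.
by rewrite -ez1 !actXM // !mulrA e_orth // !mul0r mem0v.
Qed.

(** The ideal of X^H whose elements, cut by e, lift along [theta] modulo I. *)
Definition trace_ideal : {vspace X} :=
  (\sum_(D : {group gT} | (D \subset H) && meets_in D) traces actX D H)%VS.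
Local Notation J := trace_ideal.

Lemma traces_trace_ideal (D : {group gT}) : D \subset H -> meets_in D ->
  (traces actX D H <= J)%VS.
Proof. by move=> sDH mD; apply: (sumv_sup D); rewrite ?sDH. Qed.

Lemma trace_idealM a b : a \in fixed actX H -> b \in J -> a * b \in J /\
  b * a \in J.
Proof.
move=> fa /memv_sumP[F FW ->]; rewrite mulr_sumr mulr_suml.
split; apply: rpred_sum => D /[dup] /andP[sDH mD] ok;
  apply: (subvP (traces_trace_ideal sDH mD));
  by case: (traces_ideal actXN sDH sHN fa (FW D ok)).
Qed.

Lemma theta_lift y : y \in J ->
  exists2 a, a \in fixed actA G & e * y * e - theta a \in I.
Proof.
move=> /memv_sumP[F FW ->].
apply: (big_ind (fun y => exists2 a, a \in fixed actA G &
  e * y * e - theta a \in I)).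
- by exists 0; rewrite ?mem0v // thetaE linear0 !mulr0 mul0r subrr mem0v.
- move=> y1 y2 [a1 f1 I1] [a2 f2 I2]; exists (a1 + a2); first by rewrite rpredD.
  rewrite thetaE linearD !mulrDr -!thetaE mulrDl opprD addrACA.
  exact: rpredD.
move=> D /[dup] /andP[sDH mD] ok.
have [a Da Ia] := theta_trace_aug mD sDH (FW D ok); exists a => //.
by apply: (subvP (traces_fixed linA (subsetT D) (subxx G))).
Qed.

(** By Mackey, a trace from D to N_G(Q) is a sum of traces to H from groups H :&: y D y^-1, which
    again meet N in Q. *)
Lemma theta_trace_ideal D a : meets_in D -> a \in traces actA D G ->
  theta a \in J.
Proof.
move=> mD /memv_imgP[b fb ->]; rewrite thetaE (ext_unit_trace mD) //.
have sDN := meets_in_norm mD.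
have fub : ext_unit rho Q b \in fixed actX D.
  by apply: ext_unit_fixed => //; apply: fixAS (meets_in_sub mD) fb.
rewrite -lmulE memv_preim.
apply: (rtrace_mackey linX sDN (subxx _) sHN fub) => y Ny.
rewrite -memv_preim lmulE.
have mDy : meets_in (H :&: D :^ y^-1)%G by apply: meets_in_capJ;
  rewrite ?groupV.
apply: (subvP (traces_trace_ideal (subsetIl _ _) mDy)).
apply: (traces_ideal actXN (subsetIl _ _) sHN e_fixed _).1.
apply: rtrace_in; apply: (fixXS (subsetIr _ _)); exact: (fixed_act linX).
Qed.

Lemma theta_fixed a : a \in fixed actA G -> theta a \in fixed actX H.
Proof.
move=> fa; rewrite thetaE fixX //.
by apply: ext_unit_fixed => //; apply: fixAS fa; apply: subsetT.
Qed.

Lemma thetaM a b : a \in fixed actA G -> b \in fixed actA G ->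
  theta (a * b) = theta a * theta b.
Proof.
move=> fa fb; have fub x : x \in fixed actA G ->
  ext_unit rho Q x \in fixed actX 'N(Q)%g.
  by move=> fx; apply: ext_unit_fixed => //; apply: fixAS fx; apply: subsetT.
rewrite !thetaE ext_unitM; try exact: (fixAS (subsetT Q)).
by rewrite !mulrA -e_normal // fub.
Qed.

Lemma theta_eL a : e * theta a = theta a.
Proof. by rewrite thetaE mulrA ee. Qed.

Lemma theta_eR a : a \in fixed actA G -> theta a * e = theta a.
Proof.
move=> fa; rewrite thetaE -e_normal //.
by apply: ext_unit_fixed => //; apply: fixAS fa; apply: subsetT.
Qed.

(** Conjugacy with c gives Br_Q(j) f_Q <> 0, and f_Q is primitive in C(Q)^{C_N(Q)}, so Br_Q(j) f_Q =
    f_Q. *)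
Lemma theta_point j : j \in fixed actC G ->
  conjugacy_class [set` fixed actC N]%classic c j -> theta (iota j) = e.
Proof.
move=> fj cj; have fjN : j \in fixed actC N by apply: (subvP (fixedS actC
  (subsetT N))).
have fjQ : j \in fixed actC Q by apply: (subvP (fixedS actC (subsetT Q))).
pose S := fixed_subalgebra actCT (subsetT N).
have [_ _ jj] := primitiveW (S := S) (conj_primitive (S := S) cj prim_c).
have [u [v [fu fv uv vu def_c]]] := conj_sym (S := S) cj.
have fNQ x : x \in fixed actC N -> x \in fixed actC Q by apply: (subvP (fixedS
  actC sQN)).
have jf : Br actC Q j * fQ = fQ.
  apply: (Br_block block_fQ sQN prim_fQ) => //; apply: contraNneq c_fQ => j0.
  have fuj : u * j \in fixed actC N by apply: (subalgM (s := S)).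
  rewrite def_c !BrM ?fNQ // -[_ * _ * fQ]mulrA -(block_central block_fQ (Br
    actC Q v)).
  rewrite mulrA -[_ * _ * fQ]mulrA j0.
  by rewrite mulr0 mul0r.
by rewrite thetaE -ext_emb_Br // -ext_embM block_central // jf.
Qed.

Lemma theta_c : theta (iota c) = e.
Proof. by apply: theta_point => //; apply: (conj_refl (fixed_subalgebra actCT
  (subsetT N))). Qed.

(* Br_Q(c) is the sum of the conjugates of fQ, and e Br_Q(a) = 0 implies      *)
(* f Br_Q(a) = 0 for each conjugate f of fQ.                                  *)
Lemma theta_eq0 a : a \in fixed actA G -> iota c * a = a -> theta a = 0 ->
  a \in brauer_ker actA Q.
Proof.
move=> fa ca ta0; have faQ := fixAS (subsetT Q) fa.
rewrite -ext_unit_eq0 //; apply/eqP.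
have fcQ : c \in fixed actC Q by apply: (subvP (fixedS actC (subsetT Q))).
rewrite -ca ext_unitM ?sval_of_fixed // -ext_emb_Br //.
rewrite -(block_sum_Br block_fQ sQN prim_c c_trace c_fQ) ext_embM -mulrA.
rewrite ext_emb_Br // -ext_unitM ?sval_of_fixed // ca.
rewrite /block_sum rtraceE linear_sum mulr_suml big1 // => Y YP.
have Nx : repr Y \in 'N(Q)%g.
  have /(repr_lcosets (K := (H :&: N)%G)) Sx := YP.
  have : repr Y \in (N :&: 'N(Q))%g.
    apply: Sx; apply/subsetP => x /setIP[Hx Nx]; apply/setIP; split=> //.
    exact: (subsetP sHN).
  by case/setIP.
rewrite /= -ext_emb_act //.
have <- : actX (repr Y) (ext_unit rho Q a) = ext_unit rho Q a.
  by rewrite ext_unit_act // (fixedE fa) ?in_setT.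
by rewrite -actXM // -thetaE ta0 linear0.
Qed.

(** * Lifting primitive idempotents and conjugacy along theta *)

Let SA := fixed_subalgebra actAT (subsetT G).
Let SX := fixed_subalgebra actXN sHN.
Local Notation primA := (primitive_idempotent [set` fixed actA G]%classic).
Local Notation primX := (primitive_idempotent [set` fixed actX H]%classic).
Local Notation conjA := (conjugacy_class [set` fixed actA G]%classic).
Local Notation conjX := (conjugacy_class [set` fixed actX H]%classic).

Let augM x x' y y' : x - x' \in I -> y - y' \in I -> x * y - x' * y' \in I.
Proof.
move=> Ix Iy; have -> : x * y - x' * y' = (x - x') * y + x' * (y - y').
  by rewrite mulrBl mulrBr addrA subrK.
by apply: rpredD; [exact: IMr | exact: IMl].
Qed.

Let augX x y n : x - y \in I -> x ^+ n - y ^+ n \in I.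
Proof.
move=> Ixy; elim: n => [|n IH]; first by rewrite !expr0 subrr mem0v.
by rewrite !exprS augM.
Qed.

Let thetaX a n : a \in fixed actA G -> theta (a ^+ n.+1) = theta a ^+ n.+1.
Proof.
move=> fa; elim: n => [|n IH]; first by rewrite !expr1.
by rewrite exprS thetaM ?IH // -?exprS //; apply: (subalgX (S := SA)).
Qed.

Let idemX (g : X) n : g * g = g -> g ^+ n.+1 = g.
Proof. by move=> gg; elim: n => [|n IH]; rewrite ?expr1 // exprS IH. Qed.

(** In the local algebra iA^Gi the element i a i is invertible or nilpotent. If it were nilpotent, g
    = g^(n+1) would lie in I, which has no nonzero idempotent. *)
Lemma theta_unit i a g : primA i -> a \in fixed actA G -> g * g = g -> g != 0 ->
    g - theta (i * a * i) \in I ->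
  exists2 b, b \in fixed actA G & [/\ i * a * i * b = i & b * (i * a * i) = i].
Proof.
move=> prim fa gg g0 Ig; have [fi _ ii] := primitiveW (S := SA) prim.
have fr : i * a * i \in fixed actA G by rewrite !fixA.
have [||[n rn]|[b fb [_ _ rb br]]] := @primitive_dichotomy _ _ SA i (i * a * i)
  prim fr.
- by rewrite !mulrA ii.
- by rewrite -[LHS]mulrA ii.
- case/eqP: g0; apply: (ext_aug_idempotent char_k pQ gg).
  have := augX n.+1 Ig; rewrite -thetaX // [(i * a * i) ^+ _]exprS rn mulr0
    thetaE linear0 mulr0 subr0.
  by rewrite idemX.
by exists b.
Qed.

(* These are the primitive idempotents i <= c of A^G whose point strongly     *)
(* covers the point of c.                                                     *)
Definition covering i : Prop :=
  [/\ primA i, iota c * i = i, i * iota c = i, i \notin brauer_ker actA Q &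
      exists2 D, meets_in D & i \in traces actA D G].

Lemma covering_neq0 i : covering i -> theta i != 0.
Proof.
case=> prim ci _ nk _; have [fi _ _] := primitiveW (S := SA) prim.
by apply: contraNneq nk => ti; apply: theta_eq0.
Qed.

Lemma covering_idem i : covering i -> theta i * theta i = theta i.
Proof.
by case=> prim _ _ _ _; have [fi _ ii] := primitiveW (S := SA) prim;
  rewrite -thetaM // ii.
Qed.

Lemma covering_ideal i : covering i -> theta i \in J.
Proof. by case=> _ _ _ _ [D mD iD]; apply: theta_trace_ideal mD iD. Qed.

Lemma covering_fixed i : covering i -> i \in fixed actA G.
Proof. by case=> prim _ _ _ _; have [] := primitiveW (S := SA) prim. Qed.

(** A summand g of theta(i) lies in J, so it lifts to some i a i, invertible when g <> 0. The
    complement h annihilates g, hence lies in I and vanishes. *)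
Lemma covering_primitive i : covering i -> primX (theta i).
Proof.
move=> cov; have fi := covering_fixed cov; have [prim _ _ _ _] := cov.
have tt := covering_idem cov; have tJ := covering_ideal cov.
have [_ _ ii] := primitiveW (S := SA) prim.
split=> //; [exact: theta_fixed | exact: covering_neq0 |].
move=> g h fg fh gg hh gh hg sum.
have [g0|g0] := eqVneq g 0; [by left | right].
have tg : theta i * g = g by rewrite sum mulrDl gg hg addr0.
have gt : g * theta i = g by rewrite sum mulrDr gg gh addr0.
have th : h * theta i = h by rewrite sum mulrDr hg hh add0r.
have gJ : g \in J by rewrite -gt; apply: (trace_idealM fg tJ).1.
have [a fa] := theta_lift gJ.
have eg : e * g = g by rewrite -tg mulrA theta_eL.
have ge : g * e = g by rewrite -gt -mulrA theta_eR.
rewrite eg ge => Ia.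
have Ig : g - theta (i * a * i) \in I.
  have fia : i * a \in fixed actA G by rewrite fixA.
  rewrite !thetaM // -{1}tg -{1}gt mulrA; apply: augM;
    last by rewrite subrr mem0v.
  by apply: augM; rewrite // subrr mem0v.
have [b fb [rb _]] := theta_unit prim fa gg g0 Ig.
apply: (ext_aug_idempotent char_k pQ hh).
have fr : i * a * i \in fixed actA G by rewrite !fixA.
have : h * (g * theta b) - h * theta i \in I.
  rewrite -mulrBr; apply: IMl; rewrite -rb thetaM // -mulrBl; exact: IMr.
by rewrite mulrA hg mul0r sub0r rpredN th.
Qed.

(** The elements linking theta(i1) with theta(i2) lie in J and lift to a1, a2; then i1 a1 i2 a2 i1
    is invertible under i1 and [primitive_conj] applies. *)
Lemma covering_conj i1 i2 g g' : covering i1 -> primA i2 ->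
  g \in fixed actX H -> g' \in fixed actX H ->
  theta i1 = g * theta i2 * g' -> conjA i1 i2.
Proof.
move=> cov1 prim2 fg fg' def_t.
have [prim1 _ _ _ _] := cov1; have f1 := covering_fixed cov1.
have [f2 _ i22] := primitiveW (S := SA) prim2.
have [_ _ i11] := primitiveW (S := SA) prim1.
have t11 := covering_idem cov1; have J1 := covering_ideal cov1.
have t22 : theta i2 * theta i2 = theta i2 by rewrite -thetaM // i22.
pose g1 := theta i1 * g * theta i2; pose g2 := theta i2 * g' * theta i1.
have ft1 := theta_fixed f1; have ft2 := theta_fixed f2.
have [a1 fa1] : exists2 a, a \in fixed actA G & e * g1 * e - theta a \in I.
  apply: theta_lift; rewrite /g1 -mulrA.
  by apply: (trace_idealM _ J1).2; apply: fixX.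
have [a2 fa2] : exists2 a, a \in fixed actA G & e * g2 * e - theta a \in I.
  by apply: theta_lift; apply: (trace_idealM _ J1).1; apply: fixX.
have -> : e * g1 * e = g1 by rewrite /g1 -!mulrA theta_eR // mulrA theta_eL.
have -> : e * g2 * e = g2 by rewrite /g2 -!mulrA theta_eR // mulrA theta_eL.
move=> I2 I1.
have g12 : g1 * g2 = theta i1.
  rewrite /g1 /g2 !mulrA -[_ * theta i2 * theta i2]mulrA t22.
  by rewrite -2![theta i1 * _ * _]mulrA -def_t !t11.
have Ir : theta i1 - theta (i1 * (a1 * i2 * a2) * i1) \in I.
  have f3 : a1 * i2 * a2 \in fixed actA G by rewrite !fixA.
  have f4 : a1 * i2 \in fixed actA G by rewrite fixA.
  have f5 : i1 * (a1 * i2 * a2) \in fixed actA G by rewrite fixA.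
  rewrite !thetaM //; set t := theta i1 in I1 I2 t11 g12 *.
  have g1t : g1 * theta i2 = g1 by rewrite /g1 -[_ * theta i2 * theta i2]mulrA
    t22.
  have -> : t - t * (theta a1 * theta i2 * theta a2) * t =
      t * (g1 * theta i2 * g2) * t - t * (theta a1 * theta i2 * theta a2) * t.
    by rewrite g1t g12 !t11.
  apply: augM; last by rewrite subrr mem0v.
  apply: augM; first by rewrite subrr mem0v.
  apply: augM => //; apply: augM => //; by rewrite subrr mem0v.
have [|b fb [rb _]] := theta_unit prim1 _ t11 (covering_neq0 cov1) Ir;
  first by rewrite !fixA.
apply: (@primitive_conj _ _ SA i1 i2 (i1 * a1) (a2 * i1 * b)) => //.
- exact: fixA.
- by rewrite /= !fixA.
by rewrite -[LHS]rb !mulrA.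
Qed.

(** * Common defect groups and surjectivity *)

Lemma meets_in_of (D : {group gT}) : (p.-group D)%g -> Q \subset D ->
  iota c \notin brauer_ker actA D -> meets_in D.
Proof.
move=> pD sQD nk; apply/meets_inP; split=> //.
pose P := (D :&: N)%G; have sPD : P \subset D by apply: subsetIl.
have sPN : P \subset N by apply: subsetIr.
have sQP : Q \subset P by rewrite subsetI sQD.
(* Br_P(c) <> 0 follows from Br_D(c) <> 0 by the permutation basis of A; as c is a trace from Q,
   this puts P inside an N-conjugate of Q. *)
have nkP : c \notin brauer_ker actC P.
  apply: contra nk => kP.
  apply: (brauer_ker_sub_pgroup char_k linA basis_bs _ sPD (subsetT D) pD).
  - by move=> x b _; apply: bs_stable.
  - by apply: sval_of_fixed; apply: (subvP (fixedS actC (subsetT D))).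
  exact: sval_of_brauer_ker.
have [y Ny sPQ] := traces_not_conj_sub actCT sQN (subsetT N) sPN c_trace nkP.
apply/eqP; rewrite eq_sym eqEcard sQP /=.
by rewrite -(cardJg Q y) subset_leq_card.
Qed.

(** A minimal D from which i' is a trace contains Q, since other traces lie in I. Then Br_D(c) <> 0,
    because i' = e i' with e = theta(c), and [meets_in_of] applies. *)
Lemma ext_defect_group i' : primX i' -> e * i' = i' -> i' * e = i' ->
  exists D, [/\ meets_in D, D \subset H, i' \in traces actX D H &
    i' \notin brauer_ker actX D].
Proof.
move=> prim ei ie; have [fi i0 ii] := primitiveW (S := SX) prim.
have [D [sDH pD iD minD]] := minimal_defect_group char_k sHN fi.
have nk := minimal_brauer actXN sDH sHN pD prim iD minD.
have sDN := subset_trans sDH sHN.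
have sQD : Q \subset D.
  apply: contraNT i0 => nsQD; apply/eqP;
    apply: (ext_aug_idempotent char_k pQ ii).
  exact: (subvP (traces_ext_aug_not_sub rho char_k pQ sDH sHN sQH nsQD)).
exists D; split=> //; apply: meets_in_of => //; apply: contra nk => kc.
have ke : e \in brauer_ker actX D.
  rewrite -theta_c thetaE.
  apply: (brauer_ker_ideal actXN sDN (fixXS sDH e_fixed) _).1.
  exact: ext_unit_brauer_ker.
by rewrite -ei; apply: (brauer_ker_ideal actXN sDN (fixXS sDH fi) ke).2.
Qed.

(** A defect group D of theta(i) serves for i: a lift of theta(i) in A_D^G becomes invertible when
    cut by i, and tau respects the kernels of the Brauer maps at D. *)
Lemma covering_defect_group i : covering i ->
  exists D, [/\ meets_in D, D \subset H, theta i \in traces actX D H,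
    theta i \notin brauer_ker actX D & i \in traces actA D G] /\
    i \notin brauer_ker actA D.
Proof.
move=> cov; have fi := covering_fixed cov; have [prim _ _ _ _] := cov.
have [D [mD sDH tD nk]] := ext_defect_group (covering_primitive cov) (theta_eL
  i) (theta_eR fi).
have sDN := meets_in_norm mD.
exists D; split; first split=> //.
  have [a aD] := theta_trace_aug mD sDH tD.
  rewrite theta_eL theta_eR // => Ia.
  have fa : a \in fixed actA G by apply: (subvP (traces_fixed linA (subsetT D)
    (subxx G))).
  have tt := covering_idem cov.
  have Ir : theta i - theta (i * a * i) \in I.
    have fia : i * a \in fixed actA G by rewrite fixA.
    rewrite !thetaM // -{1}tt -{1}tt; apply: augM; last by rewrite subrr mem0v.
    by apply: augM; rewrite // subrr mem0v.
  have [b fb [rb _]] := theta_unit prim fa tt (covering_neq0 cov) Ir.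
  rewrite -rb; apply: (traces_ideal actAT (subsetT D) (subxx G) fb _).2.
  apply: (traces_ideal actAT (subsetT D) (subxx G) fi _).2.
  exact: (traces_ideal actAT (subsetT D) (subxx G) fi aD).1.
apply: contra nk => ki; rewrite thetaE.
apply: (brauer_ker_ideal actXN sDN (fixXS sDH e_fixed) _).1.
by apply: ext_unit_brauer_ker => //; apply: meets_in_sub.
Qed.

(* Some member c_t of a primitive decomposition of c lifts i'. *)
Lemma covering_lift i' : primX i' -> e * i' = i' -> i' * e = i' ->
  exists2 i, covering i & conjX (theta i) i'.
Proof.
move=> prim ei ie; have [fi' i0 ii] := primitiveW (S := SX) prim.
have [D [mD sDH iD nk]] := ext_defect_group prim ei ie.
pose SC := fixed_subalgebra actCT (subsetT N).
have [_ _ cc] := primitiveW (S := SC) prim_c.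
have fc : iota c \in fixed actA G by apply: sval_of_fixed.
have [|n [F [sumF FP]]] := @primitive_decomposition _ _ SA (iota c) fc.
  by rewrite -svalM cc.
have fF t : F t \in fixed actA G.
  by have [pF _ _] := FP t; have [] := primitiveW (S := SA) pF.
have def_i : i' = \sum_t i' * theta (F t) * i'.
  rewrite -mulr_suml -mulr_sumr.
  have -> : \sum_t theta (F t) = e.
    rewrite -theta_c sumF thetaE linear_sum mulr_sumr.
    by apply: eq_bigr => t _; rewrite thetaE.
  by rewrite ie ii.
have [|t _ [w fw [iw wi uw wu]]] := primitive_sum (S := SX) prim _ def_i.
  by move=> t _; rewrite /= !fixX // theta_fixed.
set i := F t in uw wu; have fi : i \in fixed actA G by apply: fF.
have {}uw : i' * theta i * w = i'.
  by move: uw; rewrite !mulrA ii -[_ * i' * i']mulrA ii -[_ * i' * w]mulrA iw.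
have {wu} wtw : w * theta i * w = w.
  by rewrite -{1}wi -[w * i' * _]mulrA -mulrA uw wi.
have [prim_i ci ic] := FP t; rewrite -/i in prim_i ci ic.
have [_ _ i_i] := primitiveW (S := SA) prim_i.
have tt : theta i * theta i = theta i by rewrite -thetaM // i_i.
have ft := theta_fixed fi.
(* An idempotent under theta(i) which, unlike theta(i) at this stage, is known to be a trace from D
   and so can be lifted. *)
pose g := theta i * w * theta i.
have gt : g * theta i = g by rewrite /g -[LHS]mulrA tt.
have tg : theta i * g = g by rewrite /g !mulrA tt.
have gg : g * g = g.
  rewrite {1}/g -mulrA tg /g !mulrA.
  by have -> : theta i * w * theta i * w = theta i * (w * theta i * w);
    [rewrite !mulrA | rewrite wtw].
have g0 : g != 0.
  apply: contraNneq i0 => g0; rewrite -uw -wtw -{1}wtw.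
  have -> : w * theta i * w * theta i * w = w * g * w by rewrite /g !mulrA.
  by rewrite g0 mulr0 mul0r mulr0.
have gD : g \in traces actX D H.
  apply: (traces_ideal actXN sDH sHN ft _).2;
    apply: (traces_ideal actXN sDH sHN ft _).1.
  by rewrite -iw; apply: (traces_ideal actXN sDH sHN fw iD).2.
have [a aD] := theta_trace_aug mD sDH gD.
have eg : e * g = g by rewrite -tg mulrA theta_eL.
have ge : g * e = g by rewrite -gt -[LHS]mulrA theta_eR.
rewrite eg ge.
move=> Ia.
have fa : a \in fixed actA G by apply: (subvP (traces_fixed linA (subsetT D)
  (subxx G))).
have Ir : g - theta (i * a * i) \in I.
  have fia : i * a \in fixed actA G by rewrite fixA.
  rewrite !thetaM // -{1}gt -{1}tg; apply: augM; last by rewrite subrr mem0v.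
  by apply: augM; rewrite // subrr mem0v.
have [b fb [rb _]] := theta_unit prim_i fa gg g0 Ir.
have cov : covering i.
  split=> //; last first.
    exists D; first exact: mD.
    rewrite -rb; apply: (traces_ideal actAT (subsetT D) (subxx G) fb _).2.
    apply: (traces_ideal actAT (subsetT D) (subxx G) fi _).2.
    exact: (traces_ideal actAT (subsetT D) (subxx G) fi aD).1.
  apply: contra g0; rewrite -ext_unit_eq0 ?(fixAS (subsetT Q)) // => /eqP ui0.
  by rewrite /g thetaE ui0 !mulr0.
exists i => //; apply: (conj_sym (S := SX)).
exact: (primitive_conj (S := SX) prim (covering_primitive cov) fi' fw (esym
  uw)).
Qed.

(* Being covered by i' <= e suffices: Q is normal in H, and i' is a trace     *)
(* from some D with D :&: N = Q.                                              *)
Lemma ext_strongly_covers alpha i' : point_of actX H alpha -> alpha i' ->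
    e * i' = i' -> i' * e = i' ->
  strongly_covers p bact actX (@ext_emb k gT A rho N C Q)
    (Q * 'C_N(Q))%g H Q [set fQ]%classic alpha.
Proof.
move=> pt_alpha ai' ei ie j -> _.
have prim : primX i'.
  have [i0 prim0 def_a] := pt_alpha; rewrite def_a in ai'.
  exact: (conj_primitive (S := SX) ai' prim0).
have [fi' i0 ii] := primitiveW (S := SX) prim.
have [D [mD sDH iD _]] := ext_defect_group prim ei ie.
have nQC : 'C_N(Q)%g \subset 'N(Q)%g.
  by apply: subset_trans (subsetIr _ _) (cent_sub Q).
pose M := (Q <*> 'C_N(Q))%G.
have defM : (Q * 'C_N(Q))%g = M by rewrite /M /= norm_joinEr.
have sMH : M \subset H by rewrite join_subG sQH norm_stabiliser_cent.
have sMN := subset_trans sMH sHN.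
have sQM : Q \subset M by apply: joing_subl.
have sMN' : M \subset N by rewrite join_subG sQN subsetIl.
pose SM := fixed_subalgebra actXN sMN.
(* Mackey again: as M <= N and x normalises Q, each M :&: x D x^-1 is Q. So every primitive
   idempotent of X^M under i' is a trace from Q too. *)
have iQM : i' \in traces actX Q M.
  have /memv_imgP[y fy ->] := iD.
  apply: (rtrace_mackey linX sDH sHN sMH fy) => x Hx.
  have Nx := subsetP sHN x Hx.
  have -> : (M :&: D :^ x^-1)%g = Q.
    have [_ DN] := meets_inP _ mD.
    apply/eqP; rewrite eqEsubset subsetI sQM /=; apply/andP; split.
      apply/subsetP => z /setIP[Mz]; rewrite mem_conjgV => Dzx.
      rewrite -(memJ_norm z Nx) -DN; apply/setIP; split=> //.
      by rewrite -(conjN x) memJ_conjg (subsetP sMN').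
    by rewrite -{1}(normP (groupVr Nx)) conjSg meets_in_sub.
  apply: rtrace_in.
  have := fixed_act linX Nx (subset_trans sDH sHN) fy.
  by apply: fixXS; rewrite -{1}(normP (groupVr Nx)) conjSg meets_in_sub.
have fiM : i' \in fixed actX M by apply: fixXS fi'.
have [n [F [sumF FP]]] := primitive_decomposition (S := SM) fiM ii.
case: n F sumF FP => [|n] F sumF FP; first by rewrite sumF big_ord0 eqxx in i0.
have [pf if_ fi_] := FP ord0; set f := F ord0 in pf if_ fi_.
have [ff f0 f_f] := primitiveW (S := SM) pf.
have cf_f : conjugacy_class [set` fixed actX M]%classic f f by apply: (conj_refl
  SM).
rewrite defM; exists i', (conjugacy_class [set` fixed actX M]%classic f).
split=> //.
- split; first by exists f.
  split=> //.
    move=> g [u [v [fu fv _ _ ->]]].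
    apply: (traces_ideal actXN sQM sMN fv _).2;
      apply: (traces_ideal actXN sQM sMN fu _).1.
    by rewrite -if_; apply: (traces_ideal actXN sQM sMN ff iQM).2.
  exists f => //; apply: contra f0 => kf.
  apply/eqP; apply: (ext_aug_idempotent char_k pQ f_f).
  exact: (subvP (brauer_ker_ext_aug rho char_k pQ)).
- by exists f.
exists f => //; split; first by rewrite -if_ mulrA ei.
by rewrite -fi_ -mulrA ie.
Qed.

(** * Strong covering of beta and the bijection *)

Local Notation beta := (conjugacy_class [set` fixed actC N]%classic c).

Lemma point_primitive alpha i : point_of actA G alpha -> alpha i -> primA i.
Proof.
by case=> i0 prim0 -> ai; apply: (conj_primitive (S := SA) ai prim0).
Qed.

Lemma point_class alpha i : point_of actA G alpha -> alpha i -> alpha = conjA i.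
Proof. by case=> i0 prim0 -> ai; apply: (conj_class_eq (S := SA)). Qed.

(** Br_Q(i) <> 0, as i has a constituent in a point with defect group Q. Hence a minimal D from
    which i is a trace contains Q up to conjugacy, and Br_D(c) <> 0 because i lies under c. *)
Lemma strongly_covers_covering alpha : point_of actA G alpha ->
    strongly_covers p actC actA iota N G Q beta alpha ->
  exists2 i, alpha i & covering i.
Proof.
move=> pt cov.
have [i [eps [[ai [ci ic]] [pt_eps [_ _ _ [f0 ef0 nk0]]] [f ef [if_ fi_]] _]]]
  :=
  cov c (conj_refl (fixed_subalgebra actCT (subsetT N)) c) fix_c.
exists i => //; have prim := point_primitive pt ai.
have [fi i0 ii] := primitiveW (S := SA) prim.
have nk : i \notin brauer_ker actA Q.
  apply: contra nk0 => ki; have [f1 prim1 def_e] := pt_eps.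
  pose SN := fixed_subalgebra actAT (subsetT N).
  rewrite def_e in ef ef0.
  have [u [v [fu fv _ _ ->]]] := conj_trans (S := SN) (conj_sym (S := SN) ef)
    ef0.
  have [ff _ _] := primitiveW (S := SN) (conj_primitive (S := SN) ef prim1).
  have ffQ : f \in fixed actA Q := fixAS sQN ff.
  apply: (brauer_ker_ideal actAT (subsetT Q) (fixAS sQN fv) _).2.
  apply: (brauer_ker_ideal actAT (subsetT Q) (fixAS sQN fu) _).1.
  by rewrite -if_; apply: (brauer_ker_ideal actAT (subsetT Q) ffQ ki).2.
split=> //.
have [D0 [_ pD0 iD0 minD0]] := minimal_defect_group char_k (subxx G) fi.
have [y _ sQD] := traces_not_conj_sub actAT (subsetT D0) (subxx G) (subsetT Q)
  iD0 nk.
pose D := (D0 :^ y)%G.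
have iD : i \in traces actA D G.
  by rewrite -(traces_conj linA (D := D) (x :=
    y)) ?subsetT ?inE //= -conjsgM mulgV conjsg1.
have pD : (p.-group D)%g by rewrite pgroupJ.
exists D => //; apply: meets_in_of => //.
have nkD : i \notin brauer_ker actA D.
  apply: (minimal_brauer actAT (subsetT D) (subxx G) pD prim iD).
  by move=> R sR pR iR; rewrite /= cardJg; apply: minD0.
apply: contra nkD => kc; rewrite -ci.
exact: (brauer_ker_ideal actAT (subsetT D) (fixAS (subsetT D) fi) kc).2.
Qed.

(** Some constituent f of i in A^N survives Br_Q. By Mackey and [rosenberg] it is a trace from one N
    :&: x D x^-1; this group has order |Q|, and an N-conjugate of it contains Q. *)
Lemma defect_constituent i D : i \in fixed actA G -> i * i = i ->
    i \notin brauer_ker actA Q -> meets_in D -> i \in traces actA D G ->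
  exists f, [/\ primitive_idempotent [set` fixed actA N]%classic f, i * f = f,
    f * i = f, f \notin brauer_ker actA Q & f \in traces actA Q N].
Proof.
move=> fi ii nk mD iD; have fiN := fixAS (subsetT N) fi.
pose SN := fixed_subalgebra actAT (subsetT N).
have [n [F [sumF FP]]] := primitive_decomposition (S := SN) fiN ii.
have [t nkt] : exists t, F t \notin brauer_ker actA Q.
  apply: contrapT => no; case/negP: nk; rewrite sumF; apply: rpred_sum => t _.
  by apply: contrapT => nkt; apply: no; exists t; apply/negP.
have [prim if_ fi_] := FP t; exists (F t); split=> //.
have [ff _ _] := primitiveW (S := SN) prim;
  set f := F t in nkt prim if_ fi_ ff *.
pose W x := traces actA (N :&: D :^ x^-1)%g N.
have fW : f \in (\sum_(x : gT) W x)%VS.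
  have iW : i \in (\sum_(x : gT) W x)%VS.
    have /memv_imgP[y fy ->] := iD.
    apply: (rtrace_mackey linA (subsetT D) (subxx G) (subsetT N) fy) => x _.
    apply: (subvP (sumv_sup x _ (subvv _))) => //.
    apply: (@rtrace_in _ _ _ _ (N :&: D :^ x^-1)%G).
    apply: (fixAS (subsetIr _ _)); apply: (fixed_act linA);
      rewrite ?inE ?subsetT //.
  rewrite -if_; have /memv_sumP[E EW ->] := iW; rewrite mulr_suml.
  apply: memv_sumr => x _.
  exact: (traces_ideal actAT (R := (N :&: D :^ x^-1)%G) (subsetIl _ _) (subsetT
    N) ff (EW x isT)).2.
have [||x _ fx] := @rosenberg _ _ SN _ _ _ _ prim _ _ fW.
- by move=> x _; apply: (traces_fixed linA (R := (N :&: D :^ x^-1)%G));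
  rewrite ?subsetIl ?subsetT.
- move=> x a b _ fa.
  exact: (traces_ideal actAT (R := (N :&: D :^ x^-1)%G) (subsetIl _ _) (subsetT
    N) fa).
pose R := (N :&: D :^ x^-1)%G; have sRN : R \subset N by apply: subsetIl.
have [y Ny sQR] := traces_not_conj_sub actAT sRN (subsetT N) sQN fx nkt.
have [_ DN] := meets_inP _ mD.
have defQ : Q = (R :^ y)%g :> {set gT}.
  apply/eqP; rewrite eqEcard sQR cardJg /=.
  by rewrite -{1}(conjN x^-1%g) setIC -conjIg DN cardJg.
by rewrite defQ -{1}(invgK y) (traces_conj linA) ?groupV ?subsetT.
Qed.

(** Every G-fixed j in beta has theta(j) = e, so theta(i) is linked to the image of a member of a
    primitive decomposition of j, which [covering_conj] shows to be conjugate to i. *)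
Lemma covering_strongly_covers alpha i : point_of actA G alpha -> alpha i ->
  covering i -> strongly_covers p actC actA iota N G Q beta alpha.
Proof.
move=> pt ai cov j bj fj.
have prim := covering_primitive cov; have [pi _ _ nk [D mD iD]] := cov.
have [ft _ tt] := primitiveW (S := SX) prim.
have fi := covering_fixed cov.
pose SC := fixed_subalgebra actCT (subsetT N).
have [_ _ jj] := primitiveW (S := SC) (conj_primitive (S := SC) bj prim_c).
have fij : iota j \in fixed actA G by apply: sval_of_fixed.
have [|n [F [sumF FP]]] := @primitive_decomposition _ _ SA (iota j) fij.
  by rewrite -svalM jj.
have fF t : F t \in fixed actA G.
  by have [pF _ _] := FP t; have [] := primitiveW (S := SA) pF.
have def_t : theta i = \sum_t theta i * theta (F t) * theta i.
  rewrite -mulr_suml -mulr_sumr.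
  have -> : \sum_t theta (F t) = e.
    rewrite -(theta_point fj bj) sumF thetaE linear_sum mulr_sumr.
    by apply: eq_bigr => t _; rewrite thetaE.
  by rewrite theta_eR // tt.
have [|t _ [w fw [_ _ uw _]]] := primitive_sum (S := SX) prim _ def_t.
  by move=> t _; rewrite /= !fixX // theta_fixed.
have [prim_t jt tj] := FP t.
have cij : conjA i (F t).
  apply: (covering_conj cov prim_t ft (g' := theta i * w));
    first by rewrite fixX.
  by rewrite -[LHS]uw !mulrA tt -[_ * theta i * theta i]mulrA tt.
have [u [v [fu fv uv vu def_Ft]]] := cij.
have [_ _ Ftt] := primitiveW (S := SA) prim_t.
have FD : F t \in traces actA D G.
  rewrite def_Ft; apply: (traces_ideal actAT (subsetT D) (subxx G) fv _).2.
  exact: (traces_ideal actAT (subsetT D) (subxx G) fu iD).1.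
have nkF : F t \notin brauer_ker actA Q.
  apply: contra nk => kF; have -> : i = v * F t * u.
    by rewrite def_Ft !mulrA vu mul1r -mulrA vu mulr1.
  apply: (brauer_ker_ideal actAT (subsetT Q) (fixAS (subsetT Q) fu) _).2.
  exact: (brauer_ker_ideal actAT (subsetT Q) (fixAS (subsetT Q) fv) kF).1.
have [f [pf Ff fF_ nkf fQN]] := defect_constituent (fF t) Ftt nkF mD FD.
pose SN := fixed_subalgebra actAT (subsetT N).
have cff : conjugacy_class [set` fixed actA N]%classic f f by apply: (conj_refl
  SN).
exists (F t), (conjugacy_class [set` fixed actA N]%classic f); split.
- by rewrite (point_class pt ai).
- split; first by exists f.
  split=> //; last by exists f.
  move=> g [u1 [v1 [fu1 fv1 _ _ ->]]].
  apply: (traces_ideal actAT sQN (subsetT N) fv1 _).2.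
  exact: (traces_ideal actAT sQN (subsetT N) fu1 fQN).1.
- by exists f.
exists f => //; split; first by rewrite -Ff mulrA jt.
by rewrite -fF_ -mulrA tj.
Qed.

Lemma strongly_covering_bijection :
  exists2 f : set A -> set X,
    set_bij
      [set alpha | point_of actA G alpha /\
         strongly_covers p actC actA iota N G Q beta alpha]%classic
      [set alpha | point_of actX H alpha /\
         strongly_covers p bact actX (@ext_emb k gT A rho N C Q)
           (Q * 'C_N(Q))%g H Q [set fQ]%classic alpha]%classic
      f &
    forall alpha, point_of actA G alpha ->
      strongly_covers p actC actA iota N G Q beta alpha ->
      exists D : {group gT},
        [/\ (p.-group D)%g, D :&: N = Q :> {set gT},
            defect_group p actA G alpha D &
            defect_group p actX H (f alpha) D].
Proof.
(* A chosen member of the point; the default 0 occurs only if alpha has no covering member. *)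
pose r (alpha : set A) := xget (0 : A) [set i | alpha i /\ covering i]%classic.
have rP alpha : point_of actA G alpha ->
    strongly_covers p actC actA iota N G Q beta alpha -> alpha (r alpha) /\
      covering (r alpha).
  move=> pt cov; have [i ai ci] := strongly_covers_covering pt cov.
  by have := @xgetPex _ (0 : A) [set i | alpha i /\ covering i]%classic; apply;
    exists i.
exists (fun alpha => conjX (theta (r alpha))); last first.
  move=> alpha pt cov; have [ar cr] := rP alpha pt cov.
  have [D [[mD sDH tD nkD rD] nkrD]] := covering_defect_group cr.
  have [pD DN] := meets_inP _ mD; exists D; split=> //.
    split=> //; first exact: subsetT; last by exists (r alpha).
    move=> i; rewrite (point_class pt ar) => -[u [v [fu fv _ _ ->]]].
    apply: (traces_ideal actAT (subsetT D) (subxx G) fv _).2.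
    exact: (traces_ideal actAT (subsetT D) (subxx G) fu rD).1.
  split=> //; last by exists (theta (r alpha)); first exact: (conj_refl SX).
  move=> i [u [v [fu fv _ _ ->]]].
  apply: (traces_ideal actXN sDH sHN fv _).2.
  exact: (traces_ideal actXN sDH sHN fu tD).1.
split.
- move=> alpha [pt cov]; have [ar cr] := rP alpha pt cov.
  have ptX : point_of actX H (conjX (theta (r alpha))).
    by exists (theta (r alpha)) => //; apply: covering_primitive.
  split=> //; apply: (ext_strongly_covers ptX (conj_refl SX _)).
    exact: theta_eL.
  by apply: theta_eR; apply: covering_fixed.
- move=> al1 al2 /set_mem[pt1 cov1] /set_mem[pt2 cov2] eqX.
  have [ar1 cr1] := rP al1 pt1 cov1; have [ar2 cr2] := rP al2 pt2 cov2.
  have : conjX (theta (r al2)) (theta (r al1)).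
    by rewrite -eqX; apply: (conj_refl SX).
  case=> u [v [fu fv _ _ def_t]].
  have [prim2 _ _ _ _] := cr2.
  have c12 := covering_conj cr1 prim2 fu fv def_t.
  rewrite (point_class pt1 ar1) (point_class pt2 ar2).
  exact: (conj_class_eq (S := SA)).
move=> al' [pt' cov'].
have fix_fQ : fQ \in fixed bact H by apply: fixed_block.
(* As H fixes f_Q, strong covering supplies a member of al' under e, which [covering_lift] can
   lift. *)
have [i' [_ [[ai' [ei' ie']] _ _ _]]] := cov' fQ erefl fix_fQ.
have prim' : primX i'.
  by have [i0 prim0 def_a] := pt'; rewrite def_a in ai';
    apply: (conj_primitive (S := SX) ai' prim0).
have [i cov_i ci'] := covering_lift prim' ei' ie'.
have [prim_i _ _ _ _] := cov_i.
have pt : point_of actA G (conjA i) by exists i.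
have ai : conjA i i by apply: (conj_refl SA).
have cov := covering_strongly_covers pt ai cov_i.
exists (conjA i) => //; have [ar cr] := rP _ pt cov.
have [u [v [fu fv uv vu def_r]]] := ar.
have fi := covering_fixed cov_i.
have crX : conjX (theta (r (conjA i))) (theta i).
  apply: (primitive_conj (S := SX) (covering_primitive cr) (covering_primitive
    cov_i)
    (theta_fixed fu) (theta_fixed fv)).
  by rewrite {1}def_r !thetaM ?fixA.
have [i0 _ def_a] := pt'.
have -> : al' = conjX i'.
  by rewrite def_a in ai' *; apply: (conj_class_eq (S := SX)).
apply: (conj_class_eq (S := SX)); exact: (conj_trans (S := SX) crX ci').
Qed.

End Correspondence.

Theorem theorem7p5 (k : fieldType) (p : nat) (char_k : p \in [pchar k])
    (gT : finGroupType) (G : {group gT}) (defG : G :=: [set: gT])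
    (N : {group gT}) (nNG : (N <| G)%g) (p_dvd_N : (p %| #|N|)%N)
    (A : fdalgType k) (rho : interior gT A)
    (basisA : exists2 bs : seq A, basis_of {:A} bs &
       forall w b, b \in bs -> biact rho w b \in bs)
    (projAl : projective_module (finset.setX G 1%g) (biact rho))
    (projAr : projective_module (finset.setX 1%g G) (biact rho))
    (C : interior_subalgebra rho N)
    (ppermC : p_permutation p (sub_galgebra C) G)
    (c : subalg_of C)
    (prim_c : primitive_idempotent
       [set` fixed (sub_galgebra C) N]%classic c)
    (c_fixG : c \in fixed (sub_galgebra C) G)
    (beta : set (subalg_of C))
    (beta_point : point_of (sub_galgebra C) N beta) (c_beta : beta c)
    (Q : {group gT})
    (defect_Q : defect_group p (sub_galgebra C) N beta Q)
    (fQ : brauerQuotient (sub_galgebra C) Q)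
    (max_fQ : maximal_brauer_pair p c N
       (existT (brauerQuotient (sub_galgebra C)) Q fQ))
    (prim_fQ : primitive_idempotent
       [set` fixed (brauer_act (sub_galgebra C) Q) 'C_N(Q)%g]%classic fQ)
    (H : {set gT}) (defH : H = norm_stabiliser fQ)
    (normalizes_basis : exists2 bs : seq (extBrauer rho Q),
       basis_of (fixed (ext_act rho Q) 'N(Q)%g) bs &
       forall s, s \in bs ->
         exists2 s', s' \in bs & ext_emb fQ * s = s' * ext_emb fQ) :
  exists2 f : set A -> set (extBrauer rho Q),
    set_bij
      [set alpha | point_of (conj_act rho) G alpha /\
         strongly_covers p (sub_galgebra C) (conj_act rho) (@sval_of k A C)
           N G Q beta alpha]%classic
      [set alpha | point_of (ext_act rho Q) H alpha /\
         strongly_covers p (brauer_act (sub_galgebra C) Q) (ext_act rho Q)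
           (@ext_emb k gT A rho N C Q)
           (Q * 'C_N(Q))%g H Q [set fQ]%classic alpha]%classic
      f &
    forall alpha, point_of (conj_act rho) G alpha ->
      strongly_covers p (sub_galgebra C) (conj_act rho) (@sval_of k A C)
        N G Q beta alpha ->
      exists D : {group gT},
        [/\ (p.-group D)%g, D :&: N = Q :> {set gT},
            defect_group p (conj_act rho) G alpha D &
            defect_group p (ext_act rho Q) H (f alpha) D].
Proof.
have eG : G = [set: gT]%G by apply: val_inj.
subst G H.
have [bs basis_bs bs_stable] := basisA.
have [sQN pQ beta_tr _] := defect_Q.
have [[_ _ block_fQ c_fQ] _] := max_fQ.
pose S := fixed_subalgebra (galgebra_action (sub_galgebra C) N) (subxx N).
have def_beta : beta = conjugacy_class [set` fixed (sub_galgebra C) N]%classic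
  c.
  have [i0 _ def_b] := beta_point; rewrite def_b in c_beta *.
  exact: (conj_class_eq (S := S)).
have bs_free u b : u \in Q -> b \in bs -> rho u * b = b -> u = 1%g.
  exact: left_free char_k projAl basis_bs bs_stable pQ.
(* For a basis element s, e s = s' e gives e s e = s' e e = e s; linearity does the rest. *)
have e_normal m : m \in fixed (ext_act rho Q) 'N(Q)%g ->
    ext_emb fQ * m = ext_emb fQ * m * ext_emb fQ.
  move=> fm; have [ss basis_ss ss_norm] := normalizes_basis.
  rewrite (coord_basis (X := in_tuple ss) basis_ss fm) mulr_sumr mulr_suml.
  apply: eq_bigr => t _; rewrite -fdalg_scaleAr -fdalg_scaleAl; congr (_ *: _).
  have [|s' _ ->] := ss_norm (in_tuple ss)`_t; first by rewrite mem_nth.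
  by rewrite -mulrA -ext_embM block_idem.
rewrite def_beta.
apply: (strongly_covering_bijection char_k nNG pQ basis_bs bs_stable bs_free sQN
  prim_c c_fixG _ block_fQ c_fQ prim_fQ e_normal).
exact: beta_tr.
Qed.
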